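(* Let $\mathcal S\subset\mathbb Z^2$ be a finite Hadamard model, with step polynomial $S(x,y)=U(x)+V(x)T(y)$ for Laurent polynomials $U,V,T$. Let $-m$ (resp. $M$) be the valuation (resp. degree) of $S(x,y)$ in $x$, and $-m'$ (resp. $M'$) its valuation (resp. degree) in $y$; assume $m,m'\ge0$ and $M,M'>0$, and that $T$ is normalized so that its coefficient of $y^{M'}$ is $1$. Write $\bar x=1/x$, $\bar y=1/y$ and $K(x,y)=1-tS(x,y)$. (1) The equation $S(x,y)=S(X,y)$, solved for $X$, admits $m+M$ solutions (including $x$ itself), which can be seen as Puiseux series in $\bar x$ with coefficients in an algebraic closure of $\mathbb Q(y)$ (below, Puiseux series in $\bar y$). Denote them $x_0(y),\ldots,x_{m+M-1}(y)$ with $x_0(y)=x$. Exactly $m$ of them, say $x_1(y),\ldots,x_m(y)$, do not involve positive powers of $x$. (2) The equation $S(x,y)=S(x,Y)$, solved for $Y$, reads $T(y)=T(Y)$. It admits $m'+M'$ solutions (including $y$ itself), which can be seen as Puiseux series in $\bar y$ with coefficients in $\mathbb C$. Denote them $y_0,\ldots,y_{m'+M'-1}$ with $y_0=y$. Exactly $m'$ of them, say $y_1,\ldots,y_{m'}$, do not involve positive powers of $y$. (3) The orbit of $(x,y)$ consists of all pairs $(x_i,y_j)$ for $0\le i\le m+M-1$ and $0\le j\le m'+M'-1$. (4) The generating function of quadrant walks with steps in $\mathcal S$ is $$Q(x,y)=[x^{\ge}y^{\ge}]\frac{\prod_{i=1}^m(1-\bar x\,x_i(y))\prod_{j=1}^{m'}(1-\bar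 y\,y_j)}{K(x,y)},$$ where the right-hand side is expanded first in powers of $t$, then $\bar x$, and finally $\bar y$. The extraction of the non-negative part in $x$ can be done explicitly and yields $$Q(x,y)=[y^{\ge}]\frac{\prod_{i=1}^m(1-\bar x\,X_i(y))\prod_{j=1}^{m'}(1-\bar y\,y_j)}{K(x,y)}=-[y^{\ge}]\frac{\prod_{j=1}^{m'}(1-\bar y\,y_j)}{t\,B_M(y)\prod_{i=m+1}^{m+M}(x-X_i)},$$ where $X_1(y),\ldots,X_m(y)$ are the roots (in $x$) of $1-tS(x,y)$, seen as Puiseux series in $t$ with coefficients in the algebraic closure of $\mathbb Q(y)$, that are finite at $t=0$, $X_{m+1},\ldots,X_{m+M}$ are the other roots, and $B_M(y)$ is the coefficient of $x^M$ in $S(x,y)$. (5) If $M=1$, then $S_x(x,y)=B_1(y)\prod_{i=1}^m(1-\bar x\,x_i(y))$. Similarly, if $M'=1$, then $T_y(y)=\prod_{j=1}^{m'}(1-\bar y\,y_j)$. In particular, if $M=M'=1$, then $$Q(x,y)=[x^{\ge}y^{\ge}]\frac{S_x(x,y)\,T_y(y)}{B_1(y)K(x,y)}.$$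
   Context: The step polynomial of a finite $\mathcal S\subset\mathbb Z^2$ is $S(x,y)=\sum_{(k,\ell)\in\mathcal S}x^ky^\ell$. The model is called Hadamard if $S(x,y)=U(x)+V(x)T(y)$ for some Laurent polynomials $U,V,T$. $Q(x,y)\equiv Q(x,y;t)=\sum_{i,j,n\ge0}q(i,j;n)x^iy^jt^n$, where $q(i,j;n)$ counts $n$-step walks with steps in $\mathcal S$ from $(0,0)$ to $(i,j)$ staying in $\mathbb N^2$, $\mathbb N=\{0,1,2,\ldots\}$. Puiseux series in $z$ are Laurent series in some fractional power $z^{1/p}$. For a power series in $t$ whose coefficients are (fractional) Laurent series in a variable $u$ (or in $\bar u$), $[u^{\ge}]$ denotes the operator that keeps, in the coefficient of each power of $t$, only the terms with non-negative exponent of $u$; $[x^\ge y^\ge]$ does so for $x$ and for $y$. Subscripts $x,y$ on $S$ and $T$ denote partial derivatives. Orbit: let $\overline{\mathbb K}$ be an algebraic closure of $\mathbb C(x,y)$. Two distinct pairs $\mathbf u,\mathbf v\in(\overline{\mathbb K}\setminus\{0\})^2$ are adjacent if $S(\mathbf u)=S(\mathbf v)$ and they differ in exactly one coordinate. The orbit of $(x,y)$ is its equivalence class under the reflexive and transitive closure of adjacency. *)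

(* Defs.v *)
From HB Require Import structures.
From mathcomp Require Import all_boot all_order all_algebra.
From mathcomp Require Import finmap.
From mathcomp Require Import boolp classical_sets functions cardinality fsbigop.
From mathcomp Require Import reals.
From mathcomp Require Import complex.
From mathcomp Require Import ring lra zify.
From Stdlib Require Import Relation_Operators.

Set Implicit Arguments.
Unset Strict Implicit.
Unset Printing Implicit Defensive.
Import Order.TTheory GRing.Theory Num.Theory.
Local Open Scope classical_set_scope.
Local Open Scope ring_scope.

(* A Puiseux series in z over K is given by its coefficients: the function
   f : rat -> K stands for \sum_q f q * z^q, and its support must lie in
   {k/p | k >= N} for some p > 0 and some integer N. *)
Definition puiseux_support (K : zmodType) (f : rat -> K) : Prop :=
  exists (p : nat) (N : int), (0 < p)%N /\
    forall q, f q != 0 -> exists2 k : int, N <= k & q = k%:~R / p%:R.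

Definition puiseux_pred (K : zmodType) : pred (rat -> K) :=
  fun f => `[< puiseux_support f >].

Record puiseux (K : zmodType) := Puiseux {
  pcoef : rat -> K;
  _ : puiseux_pred pcoef }.

HB.instance Definition _ (K : zmodType) := [isSub for @pcoef K].
HB.instance Definition _ (K : zmodType) := [Choice of puiseux K by <:].

Section Grid.
Implicit Types (p n m : nat) (q a b : rat).

Definition grid p n q := exists2 k : int, - n%:Z <= k & q = k%:~R / p%:R.

Lemma gridD p n m a b : grid p n a -> grid p m b -> grid p (n + m) (a + b).
Proof.
move=> [k hk ->] [l hl ->]; exists (k + l); first by lia.
by rewrite intrD mulrDl.
Qed.

Lemma gridW p n m a : (n <= m)%N -> grid p n a -> grid p m a.
Proof. by move=> nm [k hk ->]; exists k => //; lia. Qed.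

Lemma gridM p r n a : (0 < r)%N -> grid p n a -> grid (p * r) (n * r) a.
Proof.
move=> r0 [k hk ->]; exists (k * r%:Z); first by nia.
rewrite intrM natrM -mulf_div -[r%:Z%:~R]/(r%:R) divff ?mulr1 //.
by rewrite pnatr_eq0 -lt0n.
Qed.

Lemma grid_ge p n a : (0 < p)%N -> grid p n a -> - (n%:R / p%:R) <= a.
Proof.
move=> p0 [k hk ->]; rewrite -mulNr ler_pM2r ?invr_gt0 ?ltr0n //.
by rewrite -[n%:R]/(n%:Z%:~R) -mulrNz ler_int.
Qed.

Lemma grid_cover p n (B : rat) : (0 < p)%N ->
  exists2 s : seq rat, uniq s & forall a, grid p n a -> a <= B -> a \in s.
Proof.
move=> p0; pose N := Num.bound `|p%:R * B|.
have pR : (0 : rat) < p%:R by rewrite ltr0n.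
exists [seq (i%:Z - n%:Z)%:~R / p%:R | i <- iota 0 (n + N).+1].
  rewrite map_inj_uniq ?iota_uniq // => i j /(mulIf _) h.
  by have /intr_inj := h (invr_neq0 (lt0r_neq0 pR)); lia.
move=> a [k hk ->]; rewrite ler_pdivrMr // mulrC => hB.
have kN : k < N%:Z.
  rewrite -(ltr_int rat); apply: le_lt_trans hB _.
  exact: le_lt_trans (ler_norm _) (archi_boundP (normr_ge0 _)).
apply/mapP; exists (absz (k + n%:Z)); first by rewrite mem_iota; lia.
by congr (_%:~R / _); lia.
Qed.

End Grid.

Section PuiseuxZmod.
Variable K : zmodType.
Implicit Types f g : puiseux K.

Lemma puiseuxP f g : pcoef f =1 pcoef g -> f = g.
Proof. by move=> fg; apply: val_inj; apply: funext. Qed.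

Lemma supportE (f : rat -> K) : puiseux_support f <->
  exists p n : nat, (0 < p)%N /\ forall q, f q != 0 -> grid p n q.
Proof.
split=> [[p [N [p0 h]]]|[p [n [p0 h]]]].
  exists p, (absz N); split=> // q /h [k Nk ->]; exists k => //; lia.
by exists p, (- n%:Z); split.
Qed.

Lemma psupp f : puiseux_support (pcoef f).
Proof. by case: f => f /= /asboolP. Qed.

Lemma common2 (f g : rat -> K) : puiseux_support f -> puiseux_support g ->
  exists p n : nat, [/\ (0 < p)%N,
    forall q, f q != 0 -> grid p n q & forall q, g q != 0 -> grid p n q].
Proof.
move=> /supportE [p [n [p0 hf]]] /supportE [r [m [r0 hg]]].
exists (p * r)%N, (n * r + m * p)%N; split; first by rewrite muln_gt0 p0.
  by move=> q /hf /(gridM r0); apply: gridW; rewrite leq_addr.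
by move=> q /hg /(gridM p0); rewrite (mulnC r); apply: gridW; rewrite leq_addl.
Qed.

Lemma common3 (f g h : rat -> K) :
  puiseux_support f -> puiseux_support g -> puiseux_support h ->
  exists p n : nat, [/\ (0 < p)%N, forall q, f q != 0 -> grid p n q,
    forall q, g q != 0 -> grid p n q & forall q, h q != 0 -> grid p n q].
Proof.
move=> /common2 H /H [p [n [p0 hf hg]]] /supportE [r [m [r0 hh]]].
exists (p * r)%N, (n * r + m * p)%N; split; first by rewrite muln_gt0 p0.
- by move=> q /hf /(gridM r0); apply: gridW; rewrite leq_addr.
- by move=> q /hg /(gridM r0); apply: gridW; rewrite leq_addr.
by move=> q /hh /(gridM p0); rewrite (mulnC r); apply: gridW; rewrite leq_addl.
Qed.

Lemma zmod_closed_support :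
  zmod_closed (@puiseux_pred K).
Proof.
split=> [|f g]; rewrite -!topredE /=.
  by apply/asboolP; exists 1%N, 0; split=> // q; rewrite eqxx.
move=> /asboolP hf /asboolP hg; apply/asboolP/supportE.
have [p [n [p0 {}hf {}hg]]] := common2 hf hg.
exists p, n; split=> // q; rewrite -[(f - g) q]/(f q - g q).
have [f0|/hf //] := eqVneq (f q) 0; have [g0|/hg //] := eqVneq (g q) 0.
by rewrite f0 g0 subrr eqxx.
Qed.

HB.instance Definition _ := GRing.isZmodClosed.Build _ (@puiseux_pred K)
  zmod_closed_support.
HB.instance Definition _ := [SubChoice_isSubZmodule of puiseux K by <:].

Lemma pcoef0 q : pcoef (0 : puiseux K) q = 0. Proof. by []. Qed.
Lemma pcoefD f g q : pcoef (f + g) q = pcoef f q + pcoef g q.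
Proof. by []. Qed.
Lemma pcoefN f q : pcoef (- f) q = - pcoef f q. Proof. by []. Qed.
Lemma pcoefB f g q : pcoef (f - g) q = pcoef f q - pcoef g q.
Proof. by []. Qed.

Lemma pmono_support (c : K) (q : rat) :
  puiseux_support (fun r => if r == q then c else 0).
Proof.
exists (absz (denq q)), (numq q); split; first by rewrite absz_gt0 denq_neq0.
move=> r /=; case: (eqVneq r q) => [-> _|_]; last by rewrite eqxx.
exists (numq q) => //; rewrite -[(absz _)%:R]/((Posz (absz _))%:~R).
by rewrite absz_denq divq_num_den.
Qed.

(* the monomial c z^q *)
Definition pmono (c : K) (q : rat) : puiseux K :=
  Puiseux (asboolT (pmono_support c q)).

Definition pconst (c : K) : puiseux K := pmono c 0.

Lemma pseries_support (a : nat -> K) :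
  puiseux_support (fun q => if q == (Num.truncn q)%:R then a (Num.truncn q) else 0).
Proof.
exists 1%N, 0; split=> // q /=; case: (eqVneq q (Num.truncn q)%:R) => [-> _|_]; last by rewrite eqxx.
by exists (Num.truncn q)%:Z => //; rewrite divr1.
Qed.

(* the power series \sum_n a n * z^n *)
Definition pseries (a : nat -> K) : puiseux K :=
  Puiseux (asboolT (pseries_support a)).

Lemma pnonpos_support f :
  puiseux_support (fun q => if q <= 0 then pcoef f q else 0).
Proof.
have [p [N [p0 h]]] := psupp f; exists p, N; split=> // q.
by case: ifP => [_ /h|_]; rewrite ?eqxx.
Qed.

(* keeps the terms c z^q with q <= 0 *)
Definition pnonpos f : puiseux K := Puiseux (asboolT (pnonpos_support f)).

Lemma pnonpos_is_additive : zmod_morphism pnonpos.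
Proof.
by move=> f g; apply: puiseuxP => q; rewrite [RHS]pcoefB /=; case: ifP; rewrite ?subr0.
Qed.
HB.instance Definition _ :=
  GRing.isZmodMorphism.Build _ _ pnonpos pnonpos_is_additive.

(* Only non-negative powers of z occur in f. *)
Definition no_neg_power f : Prop := forall q, q < 0 -> pcoef f q = 0.

End PuiseuxZmod.

Section Map.
Variables (K K' : zmodType) (h : {additive K -> K'}).

Lemma pmap_support (f : puiseux K) : puiseux_support (fun q => h (pcoef f q)).
Proof.
have [p [N [p0 hf]]] := psupp f; exists p, N; split=> // q hq; apply: hf.
by apply: contraNneq hq => ->; rewrite raddf0.
Qed.

Definition puiseux_map (f : puiseux K) : puiseux K' :=
  Puiseux (asboolT (pmap_support f)).

Lemma puiseux_map_is_additive : zmod_morphism puiseux_map.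
Proof. by move=> f g; apply: puiseuxP => q; rewrite [RHS]pcoefB /= -raddfB. Qed.
HB.instance Definition _ :=
  GRing.isZmodMorphism.Build _ _ puiseux_map puiseux_map_is_additive.
End Map.

Section PuiseuxField.
Variable K : fieldType.
Implicit Types f g h : puiseux K.

Definition cauchy (f g : rat -> K) (q : rat) : K :=
  \sum_(a \in [set: rat]) f a * g (q - a).

Lemma cauchyE (f g : rat -> K) q (s : seq rat) : uniq s ->
  (forall a, f a != 0 -> g (q - a) != 0 -> a \in s) ->
  cauchy f g q = \sum_(a <- s) f a * g (q - a).
Proof.
move=> us hs; rewrite /cauchy (@fsbigE _ _ _ _ _ s) //.
  by apply: eq_bigl => a; rewrite in_setT.
move=> a _ as_.
have [f0|/hs H] := eqVneq (f a) 0; first by rewrite f0 mul0r.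
have [->|/H] := eqVneq (g (q - a)) 0; first by rewrite mulr0.
by rewrite (negPf as_).
Qed.

Lemma cauchy_neq0 (f g : rat -> K) q : cauchy f g q != 0 ->
  exists2 a, f a != 0 & g (q - a) != 0.
Proof.
move=> h; apply: contrapT => hn; case/eqP: h; apply: fsbig1 => a _.
have [f0|fa] := eqVneq (f a) 0; first by rewrite f0 mul0r.
have [->|ga] := eqVneq (g (q - a)) 0; first by rewrite mulr0.
by case: hn; exists a.
Qed.

Lemma cauchy_grid (f g : rat -> K) p n m :
  (forall q, f q != 0 -> grid p n q) -> (forall q, g q != 0 -> grid p m q) ->
  forall q, cauchy f g q != 0 -> grid p (n + m) q.
Proof.
move=> hf hg q /cauchy_neq0 [a /hf ha /hg hb].
by have := gridD ha hb; rewrite addrC subrK.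
Qed.

Lemma pmul_support f g : puiseux_support (cauchy (pcoef f) (pcoef g)).
Proof.
have [p [n [p0 hf hg]]] := common2 (psupp f) (psupp g).
apply/supportE; exists p, (n + n)%N; split=> //; exact: cauchy_grid.
Qed.

Definition pmul f g : puiseux K := Puiseux (asboolT (pmul_support f g)).

(* finite set of exponents covering a Cauchy product *)
Lemma cauchy_cover (f g : rat -> K) p n q : (0 < p)%N ->
  (forall q, f q != 0 -> grid p n q) -> (forall q, g q != 0 -> grid p n q) ->
  exists2 s, uniq s & forall a, f a != 0 -> g (q - a) != 0 -> a \in s.
Proof.
move=> p0 hf hg; have [s us hs] := grid_cover n (q + n%:R / p%:R) p0.
exists s => // a /hf fa /hg /(grid_ge p0) ga; apply: hs => //; lra.
Qed.

Lemma pmulC : commutative pmul.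
Proof.
move=> f g; apply: puiseuxP => q /=.
have [p [n [p0 hf hg]]] := common2 (psupp f) (psupp g).
have [s us hs] := cauchy_cover q p0 hf hg.
rewrite (cauchyE us hs) (@cauchyE _ _ _ [seq q - a | a <- s]).
- rewrite big_map; apply: eq_bigr => a _.
  by rewrite subKr mulrC.
- by rewrite map_inj_uniq // => a b /addrI /oppr_inj.
move=> a ga fa; apply/mapP; exists (q - a); last by rewrite subKr.
by apply: hs => //; rewrite subKr.
Qed.

Lemma pmulA : associative pmul.
Proof.
move=> f g h; apply: puiseuxP => q /=.
have [p [n [p0 hf hg hh]]] := common3 (psupp f) (psupp g) (psupp h).
pose c : rat := n%:R / p%:R.
have c0 : 0 <= c by rewrite divr_ge0.
have [s us hs] := grid_cover (n + n) (q + c + c) p0.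
have hfg := cauchy_grid hf hg; have hgh := cauchy_grid hg hh.
have cc : (n + n)%:R / p%:R = c + c :> rat by rewrite natrD mulrDl.
have gW a : grid p n a -> grid p (n + n) a by apply: gridW; rewrite leq_addr.
rewrite (@cauchyE _ _ _ s) //; last first.
  move=> a /hf fa /hgh /(grid_ge p0); rewrite cc => H; apply: hs; first exact: gW.
  lra.
rewrite [RHS](@cauchyE _ _ _ s) //; last first.
  by move=> b /hfg fgb /hh /(grid_ge p0) hb; apply: hs => //; rewrite -/c in hb; lra.
transitivity (\sum_(a <- s) \sum_(b <- s)
    pcoef f a * pcoef g (b - a) * pcoef h (q - b)).
  apply: eq_bigr => a _.
  have [->|fa] := eqVneq (pcoef f a) 0.
    by rewrite mul0r big1 // => b _; rewrite !mul0r.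
  rewrite (@cauchyE _ _ _ [seq b - a | b <- s]).
  - rewrite big_map mulr_sumr; apply: eq_bigr => b _.
    by rewrite opprB addrA subrK mulrA.
  - by rewrite map_inj_uniq // => b b' /addIr.
  move=> b gb hb; apply/mapP; exists (a + b); last by rewrite addrC addKr.
  apply: hs; first exact: gridD (hf _ fa) (hg _ gb).
  by have := grid_ge p0 (hh _ hb); rewrite -/c; lra.
rewrite exchange_big; apply: eq_bigr => b _ /=.
have [->|hb] := eqVneq (pcoef h (q - b)) 0.
  by rewrite mulr0 big1 // => a _; rewrite mulr0.
rewrite (@cauchyE _ _ _ s) // ?mulr_suml // => a fa ga.
apply: hs; first exact/gW/hf.
have := grid_ge p0 (hh _ hb); have := grid_ge p0 (hg _ ga); rewrite -/c; lra.
Qed.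

Lemma pmonoM_coef c r f q : cauchy (pcoef (pmono c r)) (pcoef f) q = c * pcoef f (q - r).
Proof.
rewrite (@cauchyE _ _ _ [:: r]) // ?big_seq1 /= ?eqxx // => a.
by case: (eqVneq a r) => [->|_]; rewrite ?inE ?eqxx.
Qed.

Lemma pmul1 : left_id (pconst (1 : K)) pmul.
Proof. by move=> f; apply: puiseuxP => q; rewrite /= pmonoM_coef mul1r subr0. Qed.

Lemma pmulDl : left_distributive pmul +%R.
Proof.
move=> f g h; apply: puiseuxP => q.
have [p [n [p0 hf hg hh]]] := common3 (psupp f) (psupp g) (psupp h).
have [s us hs] := grid_cover n (q + n%:R / p%:R) p0.
rewrite [RHS]pcoefD; change (cauchy (pcoef (f + g)) (pcoef h) q =
  cauchy (pcoef f) (pcoef h) q + cauchy (pcoef g) (pcoef h) q).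
rewrite !(@cauchyE _ _ _ s) //.
- by rewrite -big_split; apply: eq_bigr => a _; apply: mulrDl.
- by move=> a /hg fa /hh /(grid_ge p0) ga; apply: hs => //; lra.
- by move=> a /hf fa /hh /(grid_ge p0) ga; apply: hs => //; lra.
move=> a; rewrite pcoefD => fga /hh /(grid_ge p0) ga; apply: hs; last lra.
have [f0|/hf //] := eqVneq (pcoef f a) 0; apply: hg.
by apply: contraNneq fga => ->; rewrite f0 addr0.
Qed.

Lemma pconst1_neq0 : pconst (1 : K) != 0.
Proof.
by apply/eqP => /(congr1 (fun f => pcoef f 0)) /= /eqP; rewrite oner_eq0.
Qed.

HB.instance Definition _ := GRing.Zmodule_isComNzRing.Build (puiseux K)
  pmulA pmulC pmul1 pmulDl pconst1_neq0.

Lemma pcoefM f g q : pcoef (f * g) q = cauchy (pcoef f) (pcoef g) q.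
Proof. by []. Qed.

(* [invseq a n] = the coefficients b_n, ..., b_0 of 1 / \sum_i a_i z^i *)
Fixpoint invseq (a : nat -> K) (n : nat) : seq K :=
  if n is n'.+1 then
    let s := invseq a n' in
    - (a 0%N)^-1 * (\sum_(i < n) a i.+1 * s`_i) :: s
  else [:: (a 0%N)^-1].

Lemma size_invseq a n : size (invseq a n) = n.+1.
Proof. by elim: n => //= n ->. Qed.

Lemma nth_invseq a n i : (i <= n)%N -> (invseq a n)`_i = head 0 (invseq a (n - i)).
Proof.
elim: n i => [|n IHn] [|i] //= ; rewrite ltnS => /IHn ->.
by rewrite subSS.
Qed.

Lemma invseqP a n : a 0%N != 0 ->
  \sum_(i < n.+1) a i * head 0 (invseq a (n - i)) = (n == 0%N)%:R.
Proof.
move=> a0; rewrite big_ord_recl subn0; case: n => [|n].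
  by rewrite big_ord0 addr0 /= divff.
rewrite [head _ _]/= mulrA mulrN divff // mulN1r.
apply/eqP; rewrite addrC subr_eq0; apply/eqP; apply: eq_bigr => i _.
by rewrite nth_invseq -1?ltnS // [bump 0 i]/= subSS.
Qed.

Lemma puiseux_lead f : f != 0 -> exists (p : nat) (v : rat) (a : nat -> K),
  [/\ (0 < p)%N, a 0%N != 0, forall i, pcoef f (v + i%:R / p%:R) = a i &
      forall q, pcoef f q != 0 -> exists i : nat, q = v + i%:R / p%:R].
Proof.
move=> f0; have /supportE [p [n [p0 hf]]] := psupp f.
have hfi q : pcoef f q != 0 -> exists i : nat, q = (i%:Z - n%:Z)%:~R / p%:R.
  by move=> /hf [k hk ->]; exists (absz (k + n%:Z)); congr (_%:~R / _); lia.
have exi : exists i : nat, pcoef f ((i%:Z - n%:Z)%:~R / p%:R) != 0.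
  apply: contrapT => hn; case/eqP: f0; apply: puiseuxP => q.
  apply/eqP; apply: contra_notT hn => fq.
  by have [i qi] := hfi _ fq; exists i; rewrite -qi.
case: (ex_minnP exi) => i0 fi0 mini0.
exists p, ((i0%:Z - n%:Z)%:~R / p%:R),
  (fun i => pcoef f ((i0%:Z - n%:Z)%:~R / p%:R + i%:R / p%:R)).
split=> //; first by rewrite mul0r addr0.
move=> q fq; have [i qi] := hfi _ fq.
have i0i : (i0 <= i)%N by apply: mini0; rewrite -qi.
exists (i - i0)%N; rewrite qi -mulrDl; congr (_ / _).
by rewrite -[(i - i0)%:R]/((i - i0)%N%:Z%:~R) -intrD; congr _%:~R; lia.
Qed.

Lemma puiseux_has_inv f : f != 0 -> exists g, g * f = 1.
Proof.
move=> /puiseux_lead [p [v [a [p0 a0 fa hf]]]].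
have pR : (p%:R : rat) != 0 by rewrite pnatr_eq0 -lt0n.
have ivp_inj (w : rat) : injective (fun i : nat => w + i%:R / p%:R).
  by move=> i j /addrI /(mulIf (invr_neq0 pR)) /eqP; rewrite eqr_nat => /eqP.
pose b i := head 0 (invseq a i).
pose k := pseries b.
have kS : puiseux_support (fun q => pcoef k ((q + v) * p%:R)).
  have [r [m [r0 hv]]] : exists r n, (0 < r)%N /\
      forall q, pcoef (pmono (1 : K) (- v)) q != 0 -> grid r n q.
    exact/supportE/psupp.
  have {}hv : grid r m (- v) by apply: hv; rewrite /= eqxx oner_eq0.
  apply/supportE; exists (r * p)%N, (m * p)%N; split; first by rewrite muln_gt0 r0.
  move=> q /=; case: (eqVneq ((q + v) * p%:R)
    (Num.truncn ((q + v) * p%:R))%:R) => [qE _|]; last by rewrite eqxx.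
  have -> : q = - v + (Num.truncn ((q + v) * p%:R))%:R / p%:R.
    by rewrite -qE mulfK //; ring.
  rewrite -[X in grid _ X _]addn0; apply: gridD; first exact: gridM.
  exists ((Num.truncn ((q + v) * p%:R))%:Z * r%:Z); first by lia.
  rewrite intrM mulnC natrM -mulf_div -[r%:Z%:~R]/(r%:R) divff ?mulr1 //.
  by rewrite pnatr_eq0 -lt0n.
pose g := Puiseux (asboolT kS).
have hg r : pcoef g r != 0 -> exists i : nat, r = - v + i%:R / p%:R.
  rewrite /=; case: (eqVneq ((r + v) * p%:R)
    (Num.truncn ((r + v) * p%:R))%:R) => [qE _|]; last by rewrite eqxx.
  by exists (Num.truncn ((r + v) * p%:R)); rewrite -qE mulfK //; ring.
have gb i : pcoef g (- v + i%:R / p%:R) = b i.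
  by rewrite /= [_ + v]addrAC addNr add0r mulfVK // natrK eqxx.
move: g hg gb => g hg gb; exists g; rewrite mulrC; apply: puiseuxP => q.
rewrite pcoefM [RHS]/=.
case: (EM (exists n : nat, q = n%:R / p%:R)) => [[n ->]|nq]; last first.
  rewrite /cauchy fsbig1 => [|r _].
    case: eqVneq => // q0; case: nq; exists 0%N; by rewrite q0 mul0r.
  have [->|/hf [i ri]] := eqVneq (pcoef f r) 0; first by rewrite mul0r.
  have [->|/hg [j rj]] := eqVneq (pcoef g (q - r)) 0.
    by rewrite mulr0.
  case: nq; exists (i + j)%N; rewrite natrD mulrDl -[LHS](subrK r) rj ri.
  by rewrite addrACA addNr add0r addrC.
rewrite (@cauchyE _ _ _ [seq v + i%:R / p%:R | i <- iota 0 n.+1]); last first.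
- move=> r /hf [i ri] /hg [j rj]; apply/mapP; exists i => //.
  rewrite mem_iota /= add0n ltnS.
  have: n%:R / p%:R = (i + j)%:R / p%:R :> rat.
    rewrite -[LHS](subrK r) rj ri natrD mulrDl.
    by rewrite addrACA addNr add0r addrC.
  by move/(mulIf (invr_neq0 pR))/eqP; rewrite eqr_nat => /eqP ->; rewrite leq_addr.
- by rewrite map_inj_uniq ?iota_uniq.
rewrite big_map -[iota 0 n.+1]/(index_iota 0 n.+1) big_mkord.
transitivity (\sum_(i < n.+1) a i * b (n - i)%N).
  apply: eq_bigr => i _; rewrite fa; congr (_ * _); rewrite -gb; congr pcoef.
  by rewrite natrB -1?ltnS // mulrBl opprD addrCA.
rewrite invseqP // mulf_eq0 invr_eq0 (negPf pR) orbF pnatr_eq0.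
by case: (n == 0)%N.
Qed.

Definition pinv f : puiseux K :=
  if pselect (exists g, g * f = 1) is left h then sval (cid h) else 0.

Lemma pmulV f : f != 0 -> pinv f * f = 1.
Proof.
move=> /puiseux_has_inv h; rewrite /pinv; case: pselect => // h'.
by case: (cid h').
Qed.

Lemma pinv0 : pinv 0 = 0.
Proof.
rewrite /pinv; case: pselect => // h; case: (cid h) => g /= /eqP.
by rewrite mulr0 eq_sym oner_eq0.
Qed.

HB.instance Definition _ := GRing.ComNzRing_isField.Build (puiseux K) pmulV pinv0.

Lemma pconst_is_additive : zmod_morphism (@pconst K).
Proof.
by move=> a b; apply: puiseuxP => q; rewrite [RHS]pcoefB /=; case: ifP; rewrite ?subr0.
Qed.
Lemma pconst_is_monoid_morphism : monoid_morphism (@pconst K).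
Proof.
split=> // a b; apply: puiseuxP => q; rewrite pcoefM pmonoM_coef subr0 /=.
by case: ifP; rewrite ?mulr0.
Qed.
HB.instance Definition _ :=
  GRing.isZmodMorphism.Build _ _ (@pconst K) pconst_is_additive.
HB.instance Definition _ :=
  GRing.isMonoidMorphism.Build _ _ (@pconst K) pconst_is_monoid_morphism.

End PuiseuxField.

Section Subfields.
Variable L : fieldType.
Implicit Types (k A G : set L) (z : L).

Definition is_subfield A : Prop :=
  [/\ A 1, forall u v, A u -> A v -> A (u - v)
         & forall u v, A u -> A v -> A (u / v)].

Definition generated_subfield G : set L := smallest is_subfield G.

Definition algebraic_over k z : Prop :=
  exists p : {poly L}, [/\ p != 0, forall i, k p`_i & root p z].

Definition is_algebraic_closure k A : Prop :=
  [/\ is_subfield A, k `<=` A, forall z, A z -> algebraic_over k z &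
      forall p : {poly L}, (forall i, A p`_i) -> (1 < size p)%N ->
        exists2 z, A z & root p z].

End Subfields.

Definition complexF (R : realType) : fieldType := R[i].

Definition laurent (K : fieldType) := {fsfun int -> K with 0}.

(* P(a), its coefficients being mapped to A by h *)
Definition lpeval (K A : fieldType) (h : K -> A) (P : laurent K) (a : A) : A :=
  \sum_(k <- finsupp P) h (P k) * a ^ k.

(* P'(a) *)
Definition lpderiv_eval (K A : fieldType) (h : K -> A) (P : laurent K) (a : A) : A :=
  \sum_(k <- finsupp P) (h (P k) * a ^ (k - 1)) *~ k.

Section Model.
Variable S : {fset int * int}.

Section Eval.
Variable A : fieldType.
Implicit Types a b : A.

(* S(a, b), S_x(a, b), and the coefficient of x^k in S(x, b) *)
Definition stepeval a b : A := \sum_(s <- S) a ^ s.1 * b ^ s.2.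
Definition stepeval_dx a b : A :=
  \sum_(s <- S) (a ^ (s.1 - 1) * b ^ s.2) *~ s.1.
Definition stepcoefx (k : int) b : A := \sum_(s <- S | s.1 == k) b ^ s.2.

End Eval.

(* v and d are the valuation and the degree of S(x, y) in the variable whose
   exponent is given by e, which is fst for x and snd for y. *)
Definition has_val_deg (e : int * int -> int) (v d : int) : Prop :=
  [/\ forall s, s \in S -> v <= e s <= d,
      exists2 s, s \in S & e s = v & exists2 s, s \in S & e s = d].

Definition position (w : seq S) : int * int := \sum_(s <- w) val s.

Definition in_quadrant (p : int * int) : bool := (0 <= p.1) && (0 <= p.2).

(* q(i, j; n) *)
Definition quadrant_walks (i j n : nat) : nat :=
  #|[pred w : n.-tuple S |
      [forall k : 'I_n.+1, in_quadrant (position (take k w))]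
      && (position w == (i%:Z, j%:Z))]|.

End Model.

(* The iterated fields of series are
     puiseux C                      series in 1/y,
     puiseux (puiseux C)            series in 1/x over the previous field,
     puiseux (puiseux (puiseux C))  series in t over the previous field;
   the last one encodes the expansion in t first, then in 1/x, then in 1/y.
   The variable of puiseux is thus 1/y, 1/x and t respectively; in particular
   y and x have exponent -1. *)
Section Series.
Variable C : fieldType.
Local Notation Fy := (puiseux C).
Local Notation Fxy := (puiseux (puiseux C)).
Local Notation Fxyt := (puiseux (puiseux (puiseux C))).

Definition y_ : Fy := pmono 1 (-1).
Definition x_ : Fxy := pmono 1 (-1).
Definition yx_ : Fxy := pconst y_.

Definition cst_xy (c : C) : Fxy := pconst (pconst c).

(* Q(y) and C(x, y) *)
Definition Qy : set Fy := generated_subfield [set y_].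
Definition Cxy : set Fxy :=
  generated_subfield (range cst_xy `|` [set x_] `|` [set yx_]).

Definition t_ : Fxyt := pmono 1 1.

(* [x^>=] and [y^>=]: non-negative powers of x (resp. y) are non-positive
   powers of 1/x (resp. 1/y). *)
Definition nonneg_x : Fxyt -> Fxyt := puiseux_map (@pnonpos Fy).
Definition nonneg_y : Fxyt -> Fxyt := puiseux_map (puiseux_map (@pnonpos C)).

Variable S : {fset int * int}.

Definition hadamard (U V T : laurent C) : Prop :=
  stepeval S x_ yx_ =
    lpeval cst_xy U x_ + lpeval cst_xy V x_ * lpeval cst_xy T yx_.

Definition kernel : Fxyt := 1 - t_ * pconst (stepeval S x_ yx_).

(* Q(x, y; t); the inner sum has finite support *)
Definition quadrant_gf : Fxyt :=
  pseries (fun n => \sum_(p \in [set: nat * nat])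
    (quadrant_walks S p.1 p.2 n)%:R * x_ ^+ p.1 * yx_ ^+ p.2).

(* xs = [:: x_0; ...; x_(m+M-1)] lists the solutions X of S(X, y) = S(x, y) *)
Definition x_solutions (m M : nat) (xs : seq Fxy) : Prop :=
  [/\ size xs = (m + M)%N /\ uniq xs,
      xs`_0 = x_,
      forall X, X \in xs <-> X != 0 /\ stepeval S x_ yx_ = stepeval S X yx_,
      forall i q, algebraic_over Qy (pcoef xs`_i q) &
      forall i, (i < m + M)%N ->
        (no_neg_power xs`_i <-> (1 <= i <= m)%N)].

(* ys = [:: y_0; ...; y_(m'+M'-1)] lists the solutions Y of S(x, Y) = S(x, y) *)
Definition y_solutions (m' M' : nat) (ys : seq Fy) : Prop :=
  [/\ size ys = (m' + M')%N /\ uniq ys,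
      ys`_0 = y_,
      forall Y : Fxy, Y \in map (@pconst Fy) ys <->
        Y != 0 /\ stepeval S x_ yx_ = stepeval S x_ Y &
      forall j, (j < m' + M')%N ->
        (no_neg_power ys`_j <-> (1 <= j <= m')%N)].

(* Xs = [:: X_1; ...; X_(m+M)] lists the roots of 1 - t S(x, y). Here
   puiseux Fy is the field of series in t over Fy, not Fxy. *)
Definition kernel_roots (m M : nat) (Xs : seq (puiseux Fy)) : Prop :=
  [/\ size Xs = (m + M)%N /\ uniq Xs,
      forall X, X \in Xs <->
        X != 0 /\ 1 - pmono 1 1 * stepeval S X (pconst y_) = 0,
      forall i q, algebraic_over Qy (pcoef Xs`_i q) &
      forall i, (i < m + M)%N -> (no_neg_power Xs`_i <-> (i < m)%N)].

(* the inclusion of the series in t over Fy into the series in t over Fxy *)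
Definition kernel_root_emb : puiseux Fy -> Fxyt := puiseux_map (@pconst Fy).

Definition in_torus (A : set Fxy) (u : Fxy * Fxy) : Prop :=
  [/\ A u.1, A u.2, u.1 != 0 & u.2 != 0].

Definition adjacent (A : set Fxy) (u v : Fxy * Fxy) : Prop :=
  [/\ in_torus A u, in_torus A v, stepeval S u.1 u.2 = stepeval S v.1 v.2 &
      (u.1 = v.1 /\ u.2 <> v.2) \/ (u.1 <> v.1 /\ u.2 = v.2)].

Definition orbit_xy (A : set Fxy) : set (Fxy * Fxy) :=
  clos_refl_trans (Fxy * Fxy) (adjacent A) (x_, yx_).

End Series.
Arguments y_ {C}.
Arguments x_ {C}.
Arguments yx_ {C}.
Arguments t_ {C}.
Arguments Cxy {C}.
Arguments cst_xy {C}.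
Arguments kernel {C}.
Arguments quadrant_gf {C}.

(* Main.v *)
(* Puiseux's theorem (by a Tschirnhaus transformation and Hensel's lemma) makes the
   fields of iterated series algebraically closed, hence provides the roots; they
   are simple because a double root would be constant in the last variable.  Their
   coefficients are algebraic over Q(y) because the same theorem applies to the
   series over the algebraic closure of Q(y) inside the series in 1/y.

   In one variable, let s(x) be a Laurent polynomial of valuation -m and degree
   M > 0.  Hensel's lemma factors X^m (1 - t s(X)) as A(X; t) E(X; t), with A monic
   of degree m in X, A = X^m and E = 1 at t = 0.  The small roots of the kernel are
   the roots of A(X; t), and the small solutions of s(X) = s(x) are those of
   A(X; 1/s(x)).  The difference A(x; 1/s) - A(x; t), multiplied by x^-m and divided
   by 1 - t s, has only negative powers of x: a term a_k(x) (s^-k - t^k) with k > 0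
   has deg a_k < m, and (s^-k - t^k) / (1 - t s) is a sum of t^j s^(j-k) with j < k.
   Therefore the non-negative part of x^-m A(x; 1/s) / (1 - t s) is
   x^-m A(x; t) / (1 - t s) = 1 / E(x; t), which is a series in t with coefficients
   b_n polynomial in x, and b_(n+1) = [x^>=] (s b_n), b_0 = 1.

   For a Hadamard model, the b_n obtained from S(., y) are polynomials in T(y).  The
   one-variable statement for T(y) then shows that [y^>=] (b_n prod_j (1 - y_j / y))
   satisfies the step-by-step recursion of the quadrant walks. *)
Require Import Defs.
From HB Require Import structures.
From mathcomp Require Import all_boot all_order all_algebra.
From mathcomp Require Import finmap boolp classical_sets reals complex.
From mathcomp Require Import fsbigop.
From mathcomp Require Import ring lra zify.
From mathcomp Require Import separable.
From Stdlib Require Import Relation_Operators.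

Set Implicit Arguments.
Unset Strict Implicit.
Unset Printing Implicit Defensive.
Import Order.TTheory GRing.Theory Num.Theory.
Local Open Scope classical_set_scope.
Local Open Scope ring_scope.

(** * Valuations and substitution in power series *)

Section Valuation.
Variable K : fieldType.
Implicit Types (f g z : puiseux K) (u v q : rat).

(** The one-variable results are proved once, over any algebraically closed field K of
    characteristic 0, and used twice: for x with K the field of series in 1/y, and for y with K = C.
    In both cases the series variable is the inverse of the unknown, so x (or y) has valuation -1,
    and a solution without positive powers is one of non-negative valuation.

    Solutions and kernel roots are linked because the Hensel factor is kept as a sequence of
    polynomials in X: t or 1/s(x) can be substituted in it afterwards.

    The obstacle in y is that [y^>=] does not commute with multiplication by T(y). The exchange
    [y^>=](T g) = [y^>=](T [y^>=] g) is available when g is prod_j (1 - y_j / y) times a polynomial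
    in T(y), a form which the recursion in x preserves.

    For the orbit, a change of y at (x_i, y_j) amounts to T(Y) = T(y_j) only if V(x_i) is nonzero. A
    nonzero root of V is constant in x, whereas S(x_i, y) = S(x, y) has degree M > 0 in x. *)

Definition vge f v : Prop := forall q, q < v -> pcoef f q = 0.


Lemma vgeW u v f : u <= v -> vge f v -> vge f u.
Proof. by move=> uv h q qu; apply: h; apply: lt_le_trans uv. Qed.

Lemma vge_zero v : vge (0 : puiseux K) v. Proof. by []. Qed.

Lemma vge_inf f : (forall n : nat, vge f n%:R) -> f = 0.
Proof.
move=> h; apply: puiseuxP => q; rewrite pcoef0.
apply: (h (Num.bound `|q|)); exact: le_lt_trans (ler_norm q) (archi_boundP _).
Qed.

Lemma vgeD v f g : vge f v -> vge g v -> vge (f + g) v.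
Proof. by move=> hf hg q qv; rewrite pcoefD hf // hg // addr0. Qed.

Lemma vgeN v f : vge f v -> vge (- f) v.
Proof. by move=> hf q qv; rewrite pcoefN hf // oppr0. Qed.

Lemma vgeB v f g : vge f v -> vge g v -> vge (f - g) v.
Proof. by move=> hf hg; apply: vgeD => //; apply: vgeN. Qed.

Lemma vge_sum v (I : Type) (r : seq I) (P : pred I) (F : I -> puiseux K) :
  (forall i, P i -> vge (F i) v) -> vge (\sum_(i <- r | P i) F i) v.
Proof.
move=> h; elim/big_ind: _ => [|f g|//]; [exact: vge_zero | exact: vgeD].
Qed.

Lemma pcoef_sum (I : Type) (r : seq I) (P : pred I) (F : I -> puiseux K) q :
  pcoef (\sum_(i <- r | P i) F i) q = \sum_(i <- r | P i) pcoef (F i) q.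
Proof. exact: (big_morph (fun f => pcoef f q) (fun f g => pcoefD f g q) (pcoef0 K q)). Qed.

Lemma vgeM u v f g : vge f u -> vge g v -> vge (f * g) (u + v).
Proof.
move=> hf hg q quv; rewrite pcoefM; apply/eqP/negP => /negP /cauchy_neq0 [a fa ga].
have ua : u <= a by rewrite leNgt; apply/negP => /hf fa0; rewrite fa0 eqxx in fa.
have vq : v <= q - a by rewrite leNgt; apply/negP => /hg ga0; rewrite ga0 eqxx in ga.
by lra.
Qed.

Lemma pcoefM_lead u v f g : vge f u -> vge g v ->
  pcoef (f * g) (u + v) = pcoef f u * pcoef g v.
Proof.
move=> hf hg; rewrite pcoefM (@cauchyE _ _ _ _ [:: u]) //.
  by rewrite big_seq1 addrAC subrr add0r.
move=> a fa ga; rewrite inE eq_le.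
have -> : u <= a by rewrite leNgt; apply/negP => /hf fa0; rewrite fa0 eqxx in fa.
have vq : v <= u + v - a by rewrite leNgt; apply/negP => /hg ga0; rewrite ga0 eqxx in ga.
by rewrite andbT; lra.
Qed.

Lemma pcoef1 q : pcoef (1 : puiseux K) q = (q == 0)%:R.
Proof. by rewrite /= ; case: (q == 0). Qed.

Lemma vge_mono c u : vge (pmono c u) u.
Proof. by move=> q qu /=; rewrite lt_eqF. Qed.

Lemma vge_const c : vge (pconst c) 0.
Proof. exact: vge_mono. Qed.

Lemma vge1 : vge 1 0. Proof. exact: vge_const. Qed.

Lemma vge_exp v f n : vge f v -> vge (f ^+ n) (n%:R * v).
Proof.
move=> hf; elim: n => [|n IHn]; first by rewrite expr0 mul0r; exact: vge1.
by rewrite exprS -natr1 mulrDl mul1r addrC; apply: vgeM.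
Qed.

Lemma vgeM0 v f g : vge f 0 -> vge g v -> vge (f * g) v.
Proof. by move=> hf hg; rewrite -[v]add0r; apply: vgeM. Qed.



Definition has_val f v : Prop := vge f v /\ pcoef f v != 0.

Lemma has_val_ex f : f != 0 -> exists v, has_val f v.
Proof.
move=> /puiseux_lead [p [v [a [p0 a0 fa hf]]]]; exists v; split=> [q qv|]; last first.
  by have := fa 0%N; rewrite mul0r addr0 => ->.
apply/eqP/negP => /negP /hf [i qE]; move: qv; rewrite qE -subr_lt0 addrAC subrr add0r.
by apply/negP; rewrite -leNgt divr_ge0.
Qed.

Lemma has_val_neq0 f v : has_val f v -> f != 0.
Proof. by case=> _; apply: contra_neq => ->. Qed.

Lemma has_val_vge f u v : has_val f v -> vge f u -> u <= v.
Proof. by move=> [_ fv] hu; rewrite leNgt; apply: contra_neqN fv => /hu. Qed.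

Lemma has_val_uniq f u v : has_val f u -> has_val f v -> u = v.
Proof.
by move=> hu hv; apply/le_anti; rewrite (has_val_vge hv hu.1) (has_val_vge hu hv.1).
Qed.

Lemma has_valM f g u v : has_val f u -> has_val g v -> has_val (f * g) (u + v).
Proof.
move=> [f1 f2] [g1 g2]; split; first exact: vgeM.
by rewrite pcoefM_lead // mulf_neq0.
Qed.

Lemma has_val_mono c u : c != 0 -> has_val (pmono c u) u.
Proof. by move=> c0; split; [exact: vge_mono | rewrite /= eqxx]. Qed.

Lemma has_val_const c : c != 0 -> has_val (pconst c) 0.
Proof. exact: has_val_mono. Qed.

Lemma has_val1 : has_val 1 0.
Proof. exact/has_val_const/oner_neq0. Qed.

Lemma has_valV f v : has_val f v -> has_val f^-1 (- v).
Proof.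
move=> hf; have f0 := has_val_neq0 hf.
have [w hw] : exists w, has_val f^-1 w by apply/has_val_ex; rewrite invr_neq0.
have := has_valM hf hw; rewrite divff // => /has_val_uniq/(_ has_val1).
by move=> h; rewrite (_ : - v = w) //; lra.
Qed.

Lemma has_valX f v n : has_val f v -> has_val (f ^+ n) (n%:R * v).
Proof.
move=> hf; elim: n => [|n IHn]; first by rewrite expr0 mul0r; exact: has_val1.
by rewrite exprS -natr1 mulrDl mul1r addrC; apply: has_valM.
Qed.


Lemma has_valDl f g u v : has_val f u -> vge g v -> u < v -> has_val (f + g) u.
Proof.
move=> [h1 h2] hg uv; split; first by apply: vgeD => //; apply: vgeW hg; apply: ltW.
by rewrite pcoefD hg // addr0.
Qed.

Lemma vgeP f v : (forall w, has_val f w -> v <= w) -> vge f v.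
Proof.
move=> h; have [->|/has_val_ex [w hw]] := eqVneq f 0; first exact: vge_zero.
by apply: vgeW (hw.1); apply: h.
Qed.

Lemma pcoef_monoM c r f q : pcoef (pmono c r * f) q = c * pcoef f (q - r).
Proof. by rewrite pcoefM pmonoM_coef. Qed.

Lemma pcoef_constM c f q : pcoef (pconst c * f) q = c * pcoef f q.
Proof. by rewrite pcoef_monoM subr0. Qed.

Lemma pmonoM c d u v : pmono c u * pmono d v = pmono (c * d) (u + v) :> puiseux K.
Proof.
apply: puiseuxP => q; rewrite pcoef_monoM /= subr_eq addrC.
by case: ifP; rewrite ?mulr0 // addrC => ->.
Qed.

Lemma pmonoX u n : pmono 1 u ^+ n = pmono 1 (u *+ n) :> puiseux K.
Proof. by elim: n => [//|n IHn]; rewrite exprS IHn pmonoM mulr1 mulrS. Qed.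

Lemma pmonoV c u : c != 0 -> (pmono c u)^-1 = pmono c^-1 (- u) :> puiseux K.
Proof.
move=> c0; have h : pmono c u * pmono c^-1 (- u) = 1 by rewrite pmonoM divff // subrr.
apply: (mulfI (has_val_neq0 (has_val_mono u c0))).
by rewrite h divff // (has_val_neq0 (has_val_mono u c0)).
Qed.

Lemma pmonoXz u (k : int) : pmono 1 u ^ k = pmono 1 (u * k%:~R) :> puiseux K.
Proof.
case: k => n; first by rewrite -exprnP pmonoX -mulr_natr.
by rewrite NegzE -exprnN pmonoX pmonoV ?oner_neq0 // invr1 mulrNz mulrN -mulr_natr.
Qed.

Lemma pmono_neq0 c u : c != 0 -> (pmono c u : puiseux K) != 0.
Proof. by move/(has_val_mono u)/has_val_neq0. Qed.

End Valuation.

Section Subst.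
Variable K : fieldType.
Implicit Types (z : puiseux K) (a b : nat -> K).

Definition psum z a N : puiseux K := \sum_(n < N) pconst (a n) * z ^+ n.

Lemma psum_tail z a e N N' : 0 <= e -> vge z e -> (N <= N')%N ->
  vge (psum z a N' - psum z a N) (N%:R * e).
Proof.
move=> e0 hz NN'.
rewrite /psum -!(big_mkord xpredT (fun n => pconst (a n) * z ^+ n)).
rewrite (big_cat_nat (leq0n N) NN') /= addrAC subrr add0r big_nat_cond; apply: vge_sum => n.
move=> /andP [/andP [Nn _] _]; apply: vgeM0; first exact: vge_const.
apply: vgeW (vge_exp (n := n) hz); rewrite ler_wpM2r // ler_nat //.
Qed.

Lemma grid0_exp z p n : (0 < p)%N -> (forall q, pcoef z q != 0 -> grid p 0 q) ->
  forall q, pcoef (z ^+ n) q != 0 -> grid p 0 q.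
Proof.
move=> p0 hz; elim: n => [|n IHn] q.
  rewrite expr0 pcoef1; case: (eqVneq q 0) => [-> _|_]; last by rewrite eqxx.
  by exists 0; rewrite ?oppr0 // mul0r.
by rewrite exprS pcoefM; apply: (cauchy_grid (n := 0) (m := 0)).
Qed.

Lemma grid_pos z e : 0 <= e -> vge z e -> exists p, (0 < p)%N /\
  forall q, pcoef z q != 0 -> grid p 0 q.
Proof.
move=> e0 hz; have [p [n [p0 h]]] := (Defs.supportE _).1 (psupp z).
exists p; split=> // q zq; have [k _ qE] := h q zq; exists k => //.
have : e <= q by rewrite leNgt; apply/negP => /hz z0; rewrite z0 eqxx in zq.
move=> /(le_trans e0); rewrite qE pmulr_lge0 ?invr_gt0 ?ltr0n // ler0z.
by rewrite oppr0.
Qed.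

(** The coefficient of exponent q is read off a partial sum long enough for the tail to have
    valuation above q. The estimate holds for every lower bound e' of the valuation of [z], so that
    [psubst] need not mention the chosen [e]. *)
Lemma psubst_ex z a e : 0 < e -> vge z e -> exists f : puiseux K,
  forall e' N, 0 <= e' -> vge z e' -> vge (f - psum z a N) (N%:R * e').
Proof.
move=> e0 hz; pose N q := Num.bound `|q / e|.
have hN q : q < (N q)%:R * e.
  rewrite -ltr_pdivrMr //; exact: le_lt_trans (ler_norm _) (archi_boundP _).
have [p [p0 hp]] := grid_pos (ltW e0) hz.
have sf : puiseux_support (fun q => pcoef (psum z a (N q)) q).
  apply/Defs.supportE; exists p, 0%N; split=> // q; rewrite /psum pcoef_sum => h.
  have [n zn] : exists n, pcoef (z ^+ n) q != 0.
    apply: contrapT => hn; case/eqP: h; apply: big1 => i _; rewrite pcoef_constM.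
    have [->|h] := eqVneq (pcoef (z ^+ i) q) 0; rewrite ?mulr0 //.
    by case: hn; exists i.
  exact: grid0_exp zn.
exists (Puiseux (asboolT sf)) => e' M e'0 hz' q qM; rewrite pcoefB /=.
have [MN|/ltnW NM] := leqP M (N q).
  by rewrite -pcoefB (psum_tail a e'0 hz' MN).
by rewrite -opprB -pcoefB (psum_tail a (ltW e0) hz NM) ?oppr0.
Qed.

(* [\sum_n a n * z ^ n], which is meaningful when [z] has positive valuation,
   and [0] otherwise. *)
Definition psubst z a : puiseux K :=
  if pselect (exists f : puiseux K, forall e N, 0 <= e -> vge z e ->
    vge (f - psum z a N) (N%:R * e)) is left h then sval (cid h) else 0.

Section Pos.
Variables (z : puiseux K) (e : rat).
Hypotheses (e0 : 0 < e) (hz : vge z e).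

Lemma psubstP a N : vge (psubst z a - psum z a N) (N%:R * e).
Proof.
rewrite /psubst; case: pselect => [h|[]]; last exact: psubst_ex hz.
by case: (cid h) => f /= hf; apply: hf => //; apply: ltW.
Qed.

(** The value is characterized by its congruences with the partial sums; the identities on [psubst]
    below are checked modulo valuation N e. *)
Lemma psubst_uniq a f : (forall N, vge (f - psum z a N) (N%:R * e)) ->
  psubst z a = f.
Proof.
move=> hf; apply/eqP; rewrite -subr_eq0; apply/eqP/vge_inf => n.
pose N := Num.bound `|n%:R / e|.
have hN : n%:R <= N%:R * e.
  rewrite -ler_pdivrMr //; apply/ltW.
  exact: le_lt_trans (ler_norm _) (archi_boundP _).
apply: vgeW hN _; have := vgeB (@psubstP a N) (hf N).
by rewrite opprB addrA subrK.
Qed.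

Lemma psubst_eq a b : a =1 b -> psubst z a = psubst z b.
Proof. by move=> /funext ->. Qed.

Lemma psubstD a b : psubst z (fun n => a n + b n) = psubst z a + psubst z b.
Proof.
apply: psubst_uniq => N.
have -> : psum z (fun n => a n + b n) N = psum z a N + psum z b N.
  by rewrite /psum -big_split; apply: eq_bigr => i _; rewrite raddfD mulrDl.
rewrite opprD addrACA; apply: vgeD; exact: psubstP.
Qed.

Lemma psubst0 : psubst z (fun=> 0) = 0.
Proof.
apply: psubst_uniq => N; rewrite sub0r; apply: vgeN; apply: vge_sum => i _.
by rewrite raddf0 mul0r; exact: vge_zero.
Qed.

Lemma psubst_sum (I : Type) (r : seq I) (P : pred I) (F : I -> nat -> K) :
  psubst z (fun n => \sum_(i <- r | P i) F i n) =
  \sum_(i <- r | P i) psubst z (F i).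
Proof.
elim: r => [|i r IHr].
  by rewrite big_nil -[RHS]psubst0; apply: psubst_eq => n; rewrite big_nil.
rewrite big_cons; case: ifP => Pi; rewrite -IHr -?psubstD.
  by apply: psubst_eq => n; rewrite big_cons Pi.
by apply: psubst_eq => n; rewrite big_cons Pi.
Qed.

Definition conv (A : nzRingType) (a b : nat -> A) n := \sum_(i < n.+1) a i * b (n - i)%N.

(** In the product of the partial sums, the terms with i + j < N make up the partial sum of
    [conv a b], and the others have valuation at least N e. *)
Lemma psum_conv a b N :
  vge (psum z a N * psum z b N - psum z (conv a b) N) (N%:R * e).
Proof.
have zge k : (N <= k)%N -> vge (z ^+ k) (N%:R * e).
  by move=> Nk; apply: vgeW (vge_exp (n := k) hz); rewrite ler_pM2r // ler_nat.
have -> : psum z a N * psum z b N =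
    \sum_(i < N) \sum_(j < N) pconst (a i) * pconst (b j) * z ^+ (i + j).
  rewrite /psum big_distrl; apply: eq_bigr => i _ /=.
  by rewrite big_distrr; apply: eq_bigr => j _ /=; rewrite mulrACA exprD.
have -> : psum z (conv a b) N =
    \sum_(i < N) \sum_(j < N | (i + j < N)%N) pconst (a i) * pconst (b j) * z ^+ (i + j).
  transitivity (\sum_(n < N) \sum_(i < N | (i <= n)%N)
      pconst (a i) * pconst (b (n - i)%N) * z ^+ n).
    apply: eq_bigr => n _; rewrite /conv raddf_sum mulr_suml.
    rewrite (big_ord_widen_cond N xpredT (fun i => pconst (a i * b (n - i)%N) * z ^+ n)) //.
    by apply: eq_big => // i _; rewrite rmorphM.
  rewrite (exchange_big_dep xpredT) //=; apply: eq_bigr => i _.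
  rewrite -(big_mkord (fun n => i <= n)%N
     (fun n => pconst (a i) * pconst (b (n - i)%N) * z ^+ n)).
  rewrite -(big_mkord (fun j => i + j < N)%N
     (fun j => pconst (a i) * pconst (b j) * z ^+ (i + j))).
  rewrite big_mkcond (big_cat_nat (leq0n i) (ltnW (ltn_ord i))) /=.
  rewrite big_nat_cond big1 ?add0r => [|n]; last first.
    by move=> /andP [/andP [_ ni] _]; rewrite leqNgt ni.
  rewrite -{1}[val i]add0n big_addn [RHS]big_mkcond.
  rewrite [RHS](big_cat_nat (leq0n (N - i)%N) (leq_subr i N)) /=.
  rewrite [X in _ = _ + X]big_nat_cond [X in _ = _ + X]big1 ?addr0 => [|n].
    rewrite [LHS]big_nat_cond [RHS]big_nat_cond; apply: eq_bigr => n.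
    rewrite andbT /= => nN; rewrite leq_addl addnK addnC.
    by case: ifP => //; lia.
  by move=> /andP [/andP [h _] _]; case: ifP => //; lia.
rewrite -sumrB; apply: vge_sum => i _.
rewrite (bigID (fun j : 'I_N => i + j < N)%N) /= addrAC subrr add0r.
apply: vge_sum => j; rewrite -leqNgt => Nij.
apply: vgeM0; last exact: zge.
by rewrite -rmorphM; exact: vge_const.
Qed.

Lemma vge_psum a N : vge (psum z a N) 0.
Proof.
apply: vge_sum => i _; apply: vgeM0; first exact: vge_const.
by apply: vgeW (vge_exp (n := i) hz); rewrite mulr_ge0 // ltW.
Qed.

Lemma vge_psubst a : vge (psubst z a) 0.
Proof. by have := @psubstP a 0; rewrite /psum big_ord0 subr0 mul0r. Qed.

Lemma psubstM a b : psubst z (conv a b) = psubst z a * psubst z b.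
Proof.
apply: psubst_uniq => N.
have -> : psubst z a * psubst z b - psum z (conv a b) N =
  (psubst z a - psum z a N) * psubst z b +
  psum z a N * (psubst z b - psum z b N) +
  (psum z a N * psum z b N - psum z (conv a b) N) by ring.
apply: vgeD; last exact: psum_conv.
apply: vgeD; last by apply: vgeM0; [exact: vge_psum | exact: psubstP].
by rewrite mulrC; apply: vgeM0; [exact: vge_psubst | exact: psubstP].
Qed.

Lemma psubst_const c : psubst z (fun n => if n == 0%N then c else 0) = pconst c.
Proof.
apply: psubst_uniq => -[|N]; first by rewrite /psum big_ord0 subr0 mul0r; exact: vge_const.
rewrite /psum big_ord_recl expr0 mulr1 /= big1 ?addr0 ?subrr => [|i _]; first exact: vge_zero.
by rewrite raddf0 mul0r.
Qed.

Lemma psubst_lin c d :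
  psubst z (fun n => if n == 0%N then c else if n == 1%N then d else 0) =
  pconst c + pconst d * z.
Proof.
apply: psubst_uniq => -[|[|N]].
- rewrite /psum big_ord0 subr0 mul0r; apply: vgeD; first exact: vge_const.
  by apply: vgeM0; [exact: vge_const | apply: vgeW hz; apply: ltW].
- rewrite /psum big_ord1 expr0 mulr1 /= addrAC subrr add0r mul1r.
  by apply: vgeM0; [exact: vge_const | exact: hz].
rewrite /psum 2!big_ord_recl expr0 mulr1 /= expr1 big1 ?addr0 ?subrr => [|i _].
  exact: vge_zero.
by rewrite raddf0 mul0r.
Qed.


Lemma pcoef_psubst0 a : pcoef (psubst z a) 0 = a 0%N.
Proof.
have := @psubstP a 1 0; rewrite /psum big_ord1 mul1r expr0 mulr1 => /(_ e0) /eqP.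
by rewrite pcoefB subr_eq0 => /eqP ->; rewrite /= .
Qed.

End Pos.

(** A series with exponents in N/p is an ordinary power series evaluated at z^(1/p); this brings
    ramified series within reach of Hensel's lemma. *)
Lemma psubst_pmono (f : puiseux K) p : (0 < p)%N ->
    (forall q, pcoef f q != 0 -> exists n : nat, q = n%:R / p%:R) ->
  psubst (pmono 1 p%:R^-1) (fun n => pcoef f (n%:R / p%:R)) = f.
Proof.
move=> p0 hf; have pR : (0 : rat) < p%:R^-1 by rewrite invr_gt0 ltr0n.
apply: (psubst_uniq pR (@vge_mono _ 1 _)) => N q qN.
rewrite pcoefB /psum pcoef_sum.
under eq_bigr => i _ do rewrite pcoef_constM pmonoX /= -[_^-1 *+ _]mulr_natl.
have inj (i j : nat) : (i%:R / p%:R == j%:R / p%:R :> rat) = (i == j).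
  by rewrite (inj_eq (mulIf (lt0r_neq0 pR))) eqr_nat.
case: (EM (exists n : nat, q = n%:R / p%:R)) => [[n qE]|nq]; last first.
  rewrite big1 ?subr0 => [|i _]; first by apply/eqP/negP => /negP /hf.
  by case: eqP => h; rewrite ?mulr0 //; case: nq; exists i.
have nN : (n < N)%N by move: qN; rewrite qE ltr_pM2r // ltr_nat.
rewrite qE (bigD1 (Ordinal nN)) //= eqxx mulr1 big1 ?addr0 ?subrr // => i.
by rewrite inj -val_eqE /= eq_sym => /negbTE ->; rewrite mulr0.
Qed.

End Subst.

(** * Hensel's lemma *)

Lemma leq_size_mul a b c d : (a < c -> b <= d -> (a + b).-1 <= c.-1 + d)%N.
Proof. lia. Qed.

(* A power series with coefficients in [{poly K}] is given by the sequence of its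
   coefficients; [conv] is the product. *)
Section Hensel.
Variable K : fieldType.
Implicit Types (f g h : nat -> {poly K}).

Section Lift.
Variables (g0 h0 : {poly K}) (f : nat -> {poly K}) (d : nat).
Hypotheses (mg0 : g0 \is monic) (cop : coprimep g0 h0) (f0 : f 0%N = g0 * h0).
Hypotheses (sf : forall n, (size (f n) <= (size g0).-1 + d)%N) (sh0 : (size h0 <= d)%N).

Lemma bezout_step (e : {poly K}) : exists gh : {poly K} * {poly K},
  [/\ e = g0 * gh.2 + gh.1 * h0, (size gh.1 < size g0)%N &
      (size e <= (size g0).-1 + d)%N -> (size gh.2 <= d)%N].
Proof.
have g00 := monic_neq0 mg0.
have [[u v] /= uv] := Bezout_eq1_coprimepP g0 h0 cop.
pose g1 : {poly K} := (e * v) %% g0; pose h1 : {poly K} := e * u + (e * v) %/ g0 * h0.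
have eE : e = g0 * h1 + g1 * h0.
  rewrite /h1 /g1 -[LHS]mulr1 -uv mulrDr mulrA [e * (v * h0)]mulrA.
  rewrite {1}(divp_eq (e * v) g0); ring.
exists (g1, h1); split=> //=; first by rewrite ltn_modp.
move=> se; have [->|h10] := eqVneq h1 0; first by rewrite size_poly0.
have sg : (0 < size g0)%N by rewrite size_poly_gt0.
have s1 : (size (g0 * h1)%R <= (size g0).-1 + d)%N.
  have -> : g0 * h1 = e - g1 * h0 by rewrite eE addrK.
  apply: leq_trans (size_polyD _ _) _; rewrite size_polyN geq_max se /=.
  have [->|h00] := eqVneq h0 0; first by rewrite mulr0 size_poly0.
  apply: leq_trans (size_polyMleq _ _) (leq_size_mul _ sh0).
  by rewrite ltn_modp.
by move: s1; rewrite size_monicM // -!subn1 leq_subLR; move: sg; set a := size g0; set b := size h1; lia.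
Qed.

Definition bstep e := sval (cid (bezout_step e)).

(** Course-of-values recursion: the list holds all pairs (g_i, h_i) for i <= n, since the next pair
    depends on all of them. *)
Fixpoint hseq n : seq ({poly K} * {poly K}) :=
  if n is n'.+1 then
    let s := hseq n' in
    rcons s (bstep (f n - \sum_(1 <= i < n) (nth 0 s i).1 * (nth 0 s (n - i)).2))
  else [:: (g0, h0)].

Lemma size_hseq n : size (hseq n) = n.+1.
Proof. by elim: n => //= n IHn; rewrite size_rcons IHn. Qed.

Lemma nth_hseq n k : (k <= n)%N -> nth 0 (hseq n) k = nth 0 (hseq k) k.
Proof.
elim: n => [|n IHn]; first by rewrite leqn0 => /eqP ->.
rewrite leq_eqVlt => /orP [/eqP -> //|]; rewrite ltnS => kn.
by rewrite /= nth_rcons size_hseq ltnS kn IHn.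
Qed.

(** In degree n the equation isolates g_0 h_n + g_n h_0, which [bezout_step] solves. The bounds on
    sizes are uniform in n, so that both factors lift to polynomials. *)
Lemma hensel_seq : exists g h : nat -> {poly K},
  [/\ g 0%N = g0, h 0%N = h0, f =1 conv g h,
      forall n, (0 < n)%N -> (size (g n) < size g0)%N & forall n, (size (h n) <= d)%N].
Proof.
pose g n := (nth 0 (hseq n) n).1; pose h n := (nth 0 (hseq n) n).2.
pose E n := f n - \sum_(1 <= i < n) g i * h (n - i)%N.
have stepE n : (g n.+1, h n.+1) = bstep (E n.+1).
  rewrite -[LHS]surjective_pairing /= nth_rcons size_hseq ltnn eqxx.
  congr bstep; congr (_ - _); rewrite !big_nat; apply: eq_bigr => i /andP [i1 iN].
  by rewrite !(@nth_hseq n) //; lia.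
have stepP n : [/\ E n.+1 = g0 * h n.+1 + g n.+1 * h0, (size (g n.+1) < size g0)%N &
      (size (E n.+1) <= (size g0).-1 + d)%N -> (size (h n.+1) <= d)%N].
  by have := svalP (cid (bezout_step (E n.+1))); rewrite -/(bstep _) -stepE.
have gs n : (0 < n)%N -> (size (g n) < size g0)%N.
  by case: n => // n _; have [] := stepP n.
exists g, h; split=> //.
  case=> [|n]; first by rewrite /conv big_ord1 f0.
  have [eE _ _] := stepP n; rewrite /conv big_ord_recl big_ord_recr /= subn0 subnn.
  have -> : f n.+1 = E n.+1 + \sum_(1 <= i < n.+1) g i * h (n.+1 - i)%N by rewrite subrK.
  rewrite eE big_add1 big_mkord /= -addrA; congr (_ + _); rewrite addrC.
  by congr (_ + _); apply: eq_bigr => i _.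
elim/ltn_ind => -[_|n IHn]; first exact: sh0.
have [_ _] := stepP n; apply; rewrite /E big_nat.
apply: leq_trans (size_polyD _ _) _; rewrite size_polyN geq_max sf /=.
apply: leq_trans (size_sum _ _ _) _; apply/bigmax_leqP_seq => i _ /andP [i1 iN].
apply: leq_trans (size_polyMleq _ _) _.
apply: leq_size_mul (gs i i1) _; apply: IHn; lia.
Qed.

End Lift.

Section LiftPoly.
Variables (z : puiseux K) (e : rat).
Hypotheses (e0 : 0 < e) (hz : vge z e).

(** Transposes a series of polynomials into a polynomial whose coefficients are series evaluated at
    [z]; one sequence [g] can thus be evaluated at several [z]. *)
Definition plift d g : {poly puiseux K} := \poly_(j < d) psubst z (fun n => (g n)`_j).

Lemma coef_plift d g j : (forall n, (size (g n) <= d)%N) ->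
  (plift d g)`_j = psubst z (fun n => (g n)`_j).
Proof.
move=> sg; rewrite coef_poly; case: ltnP => // dj.
rewrite -(psubst0 e0 hz); apply: psubst_eq => n.
by rewrite nth_default // (leq_trans (sg n)).
Qed.

Lemma plift_conv d1 d2 d3 g h :
  (forall n, (size (g n) <= d1)%N) -> (forall n, (size (h n) <= d2)%N) ->
  (forall n, (size (conv g h n) <= d3)%N) ->
  plift d3 (conv g h) = plift d1 g * plift d2 h.
Proof.
move=> s1 s2 s3; apply/polyP => j; rewrite coef_plift // coefM.
transitivity (psubst z (fun n => \sum_(i < j.+1)
    conv (fun n => (g n)`_i) (fun n => (h n)`_(j - i)) n)).
  apply: psubst_eq => n; rewrite /conv coef_sum exchange_big /=.
  by apply: eq_bigr => i _; rewrite coefM.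
rewrite (psubst_sum e0 hz); apply: eq_bigr => i _.
by rewrite (psubstM e0 hz) !coef_plift.
Qed.

Lemma plift_eq d g h : g =1 h -> plift d g = plift d h.
Proof. by move=> gh; apply/polyP => j; rewrite !coef_poly; under psubst_eq => n do rewrite gh. Qed.

End LiftPoly.
End Hensel.

(** * Puiseux's theorem *)

Definition alg_closed (K : fieldType) : Prop :=
  forall p : {poly K}, (1 < size p)%N -> exists x, root p x.

Definition char0 (K : fieldType) : Prop := forall n : nat, n.+1%:R != 0 :> K.

Section MonicLift.
Variables (K : fieldType) (z : puiseux K) (e : rat).
Hypotheses (e0 : 0 < e) (hz : vge z e).

Lemma lift_monic (g : nat -> {poly K}) r : g 0%N \is monic -> size (g 0%N) = r.+1 ->
  (forall n, (0 < n)%N -> (size (g n) < size (g 0%N))%N) ->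
  plift z r.+1 g \is monic /\ size (plift z r.+1 g) = r.+1.
Proof.
move=> mg sg0 sg.
have c1 : psubst z (fun n => (g n)`_r) = 1.
  rewrite -[RHS](psubst_const e0 hz 1); apply: psubst_eq => -[|n].
    by move/monicP: mg; rewrite lead_coefE sg0.
  by rewrite nth_default // -ltnS -sg0 sg.
have s : size (plift z r.+1 g) = r.+1 by rewrite size_poly_eq // c1 oner_neq0.
by split=> //; rewrite monicE lead_coefE s /= coef_poly ltnS leqnn c1.
Qed.
End MonicLift.

Lemma coef_XsubC_exp (A : comNzRingType) (c : A) n : (0 < n)%N ->
  (('X - c%:P) ^+ n)`_n.-1 = - (c *+ n).
Proof.
move=> n0; have := @coefPn_prod_XsubC _ (nseq n c).
rewrite size_nseq -lt0n => /(_ n0).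
by rewrite !big_nseq -!Monoid.iteropE /= -[iterop _ _ _ _]/(('X - c%:P) ^+ n) => ->.
Qed.

Section CommonDenominator.
Variable K : fieldType.

Lemma common_denom (s : seq (puiseux K)) : exists p : nat, (0 < p)%N /\
  forall f, f \in s -> forall q, pcoef f q != 0 -> exists k : int, q = k%:~R / p%:R.
Proof.
elim: s => [|f s [p [p0 hp]]]; first by exists 1%N; split.
have [r [n [r0 hr]]] := (Defs.supportE _).1 (psupp f).
exists (r * p)%N; split; first by rewrite muln_gt0 r0.
move=> g; rewrite inE => /orP [/eqP -> q /hr /(gridM p0) [k _ ->]|gs q fq].
  by exists k.
have [k ->] := hp g gs q fq; exists (r%:Z * k).
rewrite intrM natrM -mulf_div -[r%:Z%:~R]/(r%:R) divff ?mul1r //.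
by rewrite pnatr_eq0 -lt0n.
Qed.

Lemma common_denom_nonneg (s : seq (puiseux K)) :
    (forall f, f \in s -> vge f 0) -> exists p : nat, (0 < p)%N /\
  forall f, f \in s -> forall q, pcoef f q != 0 -> exists n : nat, q = n%:R / p%:R.
Proof.
move=> hs; have [p [p0 hp]] := common_denom s; exists p; split=> // f fs q fq.
have [k qE] := hp f fs q fq.
have : 0 <= q by rewrite leNgt; apply/negP => /(hs f fs) f0; rewrite f0 eqxx in fq.
rewrite qE pmulr_lge0 ?invr_gt0 ?ltr0n // ler0z => k0.
by exists (absz k); rewrite -[(absz k)%:R]/((absz k)%:Z%:~R) gez0_abs.
Qed.

End CommonDenominator.

Section PuiseuxTheorem.
Variable K : fieldType.
Hypotheses (Kcl : alg_closed K) (K0 : char0 K).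

(* The reduction of [q] at [z = 0] is not a power of a linear factor [X - c]: its
   second coefficient vanishes, which would force [c = 0], but another one does not. *)
Lemma puiseux_factor (q : {poly puiseux K}) : q \is monic -> (2 < size q)%N ->
    (forall j, vge q`_j 0) -> q`_(size q).-2 = 0 ->
    (exists2 j, (j < (size q).-1)%N & pcoef q`_j 0 != 0) ->
  exists G H : {poly puiseux K}, [/\ q = G * H, G \is monic & (1 < size G < size q)%N].
Proof.
move=> mq sq vq qn1 [j0 j0q qj0].
have [p [p0 hp]] : exists p : nat, (0 < p)%N /\ forall j r, pcoef q`_j r != 0 ->
    exists n : nat, r = n%:R / p%:R.
  have [|p [p0 hp]] := @common_denom_nonneg K q.
    by move=> f /(nthP 0) [j _ <-].
  exists p; split=> // j r; have [jq|jq] := ltnP j (size q).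
    by apply: hp; apply: mem_nth.
  by rewrite nth_default // pcoef0 eqxx.
pose f n : {poly K} := \poly_(j < size q) pcoef q`_j (n%:R / p%:R).
pose z : puiseux K := pmono 1 p%:R^-1.
have e0 : (0 : rat) < p%:R^-1 by rewrite invr_gt0 ltr0n.
have hz : vge z p%:R^-1 by exact: vge_mono.
have fE n j : (f n)`_j = pcoef q`_j (n%:R / p%:R).
  by rewrite coef_poly; case: ltnP => // h; rewrite nth_default.
have sf n : (size (f n) <= size q)%N by exact: size_poly.
have qf : q = plift z (size q) f.
  apply/polyP => j; rewrite (coef_plift e0 hz) // -[LHS](psubst_pmono p0 (hp j)).
  by apply: psubst_eq => n; rewrite fE.
pose qb := f 0%N.
have qbE j : qb`_j = pcoef q`_j 0 by rewrite fE mul0r.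
have sqb : size qb = size q.
  rewrite size_poly_eq // mul0r -lead_coefE (monicP mq) pcoef1 eqxx.
  exact: oner_neq0.
have mqb : qb \is monic.
  by rewrite monicE lead_coefE sqb qbE -lead_coefE (monicP mq) pcoef1 eqxx.
have qb0 := monic_neq0 mqb.
have [c rc] : exists c, root qb c by apply: Kcl; rewrite sqb (ltn_trans _ sq).
have [mu [h0]] := multiplicity_XsubC qb c; rewrite qb0 /= => h0c qbE2.
have mu0 : (0 < mu)%N.
  by case: mu qbE2 => // qbE2; move: rc h0c; rewrite qbE2 expr0 mulr1 => ->.
pose g0 : {poly K} := ('X - c%:P) ^+ mu.
have mg0 : g0 \is monic by rewrite monic_exp // monicXsubC.
have sg0 : size g0 = mu.+1 by rewrite size_exp_XsubC.
have mh0 : h0 \is monic by move: mqb; rewrite qbE2 monicMr.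
have sh : (size q = mu + size h0)%N.
  by rewrite -sqb qbE2 mulrC size_Mmonic ?monic_neq0 // sg0 addSn.
have sh0 : (1 < size h0)%N.
  rewrite ltnNge; apply: contraNN qj0 => sh0.
  have h01 : h0 = 1 by move: mh0; rewrite (size1_polyC sh0) => /monicP; rewrite lead_coefC => ->.
  have qmu : size q = mu.+1 by rewrite sh h01 size_poly1 addn1.
  have qbX : qb = ('X - c%:P) ^+ mu by rewrite qbE2 h01 mul1r.
  have c0 : c = 0.
    have := qbE mu.-1; have -> : mu.-1 = (size q).-2 by rewrite qmu.
    rewrite qn1 pcoef0 qmu qbX coef_XsubC_exp // => /eqP; rewrite oppr_eq0.
    case: mu mu0 {g0 mg0 sg0 qbE2 sh qmu qbX} => // n _; rewrite -mulr_natr mulf_eq0.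
    by rewrite (negbTE (K0 n)) orbF => /eqP.
  move: j0q; rewrite -qbE qbX c0 subr0 coefXn qmu /=.
  by move=> h; rewrite ltn_eqF.
have cop : coprimep g0 h0 by rewrite coprimep_expl // coprimep_sym coprimep_XsubC.
have sfd n : (size (f n) <= (size g0).-1 + size h0)%N by rewrite sg0 -sh.
have f0 : f 0%N = g0 * h0 by rewrite -/qb qbE2 mulrC.
have [g [h [gE hE fgh sg shn]]] := hensel_seq mg0 cop f0 sfd (leqnn _).
have sgn n : (size (g n) <= mu.+1)%N.
  by case: n => [|n]; rewrite ?gE -sg0 // ltnW // sg.
have [mG sG] := @lift_monic K z _ e0 hz g mu ltac:(by rewrite gE) ltac:(by rewrite gE)
   ltac:(by rewrite gE).
exists (plift z mu.+1 g), (plift z (size h0) h); split=> //.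
  rewrite {1}qf (plift_eq _ _ fgh).
  by apply: (plift_conv e0 hz) => // n; rewrite -fgh.
by rewrite sG sh ltnS mu0 -addn1 ltn_add2l.
Qed.

Definition pval (f : puiseux K) : rat := if pselect (exists v, has_val f v) is left h
  then sval (cid h) else 0 :> rat.

Lemma pvalP (f : puiseux K) : f != 0 -> has_val f (pval f).
Proof.
move=> /has_val_ex h; rewrite /pval; case: pselect => // h'.
by case: (cid h').
Qed.

Lemma tschirnhaus (p : {poly puiseux K}) : p \is monic -> (2 < size p)%N ->
  exists c, (p \Po ('X + c%:P))`_(size p).-2 = 0.
Proof.
move=> mp sp; have [n sE] : exists n, size p = n.+1.
  by case: (size p) sp => // n _; exists n.
have pn : p`_n = 1 by have /monicP := mp; rewrite lead_coefE sE.
have n0 : (1 < n)%N by rewrite -ltnS -sE.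
pose a := p`_n.-1; pose r := \poly_(i < n.-1) p`_i.
have pE : p = 'X ^+ n + a *: 'X ^+ n.-1 + r.
  apply/polyP => i; rewrite !coefD coefZ !coefXn coef_poly.
  have [->|ni] := eqVneq i n.
    rewrite pn (_ : _ == _ = false); last by lia.
    by rewrite ifF ?mulr0 ?addr0 //; lia.
  have [->|ni1] := eqVneq i n.-1; first by rewrite mulr1 add0r ltnn addr0.
  rewrite mulr0 !add0r; case: ltnP => // h; rewrite nth_default // sE; lia.
(* Replacing X by X + c adds n c to the coefficient [a] of X^(n-1); characteristic 0 allows the
   division by n. *)
exists (- a / n%:R).
have nR : n%:R != 0 :> puiseux K.
  case: n n0 {a r pE sE pn} => // n _; rewrite -(rmorph_nat (@pconst K)).
  by rewrite fmorph_eq0; exact: K0.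
set c := - a / _; have cE : 'X + c%:P = 'X - (- c)%:P by rewrite polyCN opprK.
have -> : (size p).-2 = n.-1 by rewrite sE.
rewrite pE !comp_polyD comp_polyZ !comp_Xn_poly cE !coefD coefZ.
rewrite coef_XsubC_exp ?(ltnW n0) //.
have -> : (('X - (- c)%:P) ^+ n.-1)`_n.-1 = 1.
  have := monic_exp n.-1 (monicXsubC (- c)); rewrite monicE lead_coefE size_exp_XsubC.
  by move/eqP.
rewrite [(r \Po _)`_ _]nth_default; last first.
  by rewrite size_comp_poly2 ?size_XsubC // size_poly.
by rewrite mulNrn opprK mulr1 addr0 -[c *+ n]mulr_natr /c mulfVK // addNr.
Qed.

(** Newton polygon: [la] is the least slope val(p_j) / (n - j). Substituting X = z^la Y and dividing
    by z^(n la) gives all coefficients non-negative valuation, and the one where the minimum is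
    attained gets valuation 0. *)
Lemma puiseux_scale (p : {poly puiseux K}) : p \is monic -> (2 < size p)%N ->
    p`_(size p).-2 = 0 -> (exists2 j, (j < (size p).-1)%N & p`_j != 0) ->
  exists (w : puiseux K) (q : {poly puiseux K}),
  [/\ q \is monic, size q = size p, q`_(size q).-2 = 0,
      (forall j, vge q`_j 0) /\ (exists2 j, (j < (size q).-1)%N & pcoef q`_j 0 != 0) &
      forall y, root q y -> root p (w * y)].
Proof.
move=> mp sp pn1 [j0 j0p pj0]; set n := (size p).-1 in j0p.
have sE : size p = n.+1 by rewrite /n; case: (size p) sp.
pose F (j : 'I_n) := pval p`_j / (n - j)%:R.
case: (@arg_minP _ _ _ (Ordinal j0p) (fun j : 'I_n => p`_j != 0) F pj0).
move=> j1 pj1 minj; set la := F j1 in minj.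
pose q := \poly_(j < n.+1) (pmono 1 (- ((n - j)%:R * la)) * p`_j).
have qE j : q`_j = pmono 1 (- ((n - j)%:R * la)) * p`_j.
  rewrite coef_poly; case: ltnP => // h.
  by rewrite [p`_j]nth_default ?mulr0 // sE.
have qn : q`_n = 1.
  by rewrite qE subnn mul0r oppr0 -[p`_n]/(p`_(size p).-1) -lead_coefE (monicP mp) mulr1.
have sq : size q = n.+1 by rewrite size_poly_eq // -qE qn oner_neq0.
exists (pmono 1 la), q; split.
- by rewrite monicE lead_coefE sq /= qn.
- by rewrite sq sE.
- by rewrite qE sq -sE pn1 mulr0.
- split=> [j|].
    have [jn|jn] := ltnP j n; last first.
      have [->|jn'] := eqVneq j n; first by rewrite qn; exact: vge1.
      by rewrite nth_default ?sq; [exact: vge_zero | lia].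
    have [pj|pj] := eqVneq p`_j 0; first by rewrite qE pj mulr0; exact: vge_zero.
    have := minj (Ordinal jn) pj; rewrite /F /= ler_pdivlMr; last by rewrite ltr0n subn_gt0.
    move=> h; rewrite qE.
    apply: (@vgeW _ 0 (- ((n - j)%:R * la) + (n - j)%:R * la)); first by rewrite addNr.
    apply: vgeM; first exact: vge_mono.
    by apply: vgeW (pvalP pj).1; rewrite mulrC.
  exists j1; first by rewrite sq.
  have jn : ((n - j1)%:R : rat) != 0 by rewrite pnatr_eq0 subn_eq0 -ltnNge.
  rewrite qE pcoef_monoM mul1r sub0r opprK /la /F mulrC mulfVK //.
  exact: (pvalP pj1).2.
move=> y /rootP qy; apply/rootP.
have -> : p.[pmono 1 la * y] = pmono 1 (n%:R * la) * q.[y].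
  rewrite !horner_coef sE sq mulr_sumr; apply: eq_bigr => i _.
  have iE : la *+ i = n%:R * la + - ((n - i)%:R * la).
    by rewrite natrB -1?ltnS // -[la *+ _]mulr_natl; ring.
  have uv (u v : rat) : pmono 1 (u + v) = pmono 1 u * pmono 1 v :> puiseux K.
    by rewrite pmonoM mulr1.
  rewrite qE exprMn pmonoX iE uv.
  move: (pmono 1 _) (pmono 1 _) (y ^+ i) => u v w; ring.
by rewrite qy mulr0.
Qed.

(** Induction on the degree: after the shift and the scaling, a monic polynomial of degree at least
    2 is either X^n or has a proper monic factor, whose root is carried back. *)
Theorem puiseux_closed : alg_closed (puiseux K).
Proof.
suff H n (p : {poly puiseux K}) : (size p <= n)%N -> p \is monic -> (1 < size p)%N ->
    exists x, root p x.
  move=> p sp; have p0 : p != 0 by rewrite -size_poly_gt0 ltnW.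
  have l0 : (lead_coef p)^-1 != 0 by rewrite invr_eq0 lead_coef_eq0.
  have [||x] := H _ ((lead_coef p)^-1 *: p) (leqnn _).
  - by rewrite monicE lead_coefZ mulVf // lead_coef_eq0.
  - by rewrite size_scale.
  by rewrite rootZ //; exists x.
elim: n p => [|n IHn] p sn mp sp; first by rewrite leqNgt (ltn_trans _ sp) in sn.
have [s2|s2] := leqP (size p) 2.
  have -> : p = 'X - (- p`_0)%:P.
    apply/polyP => -[|[|i]]; rewrite coefB coefX coefC ?polyCN /= ?opprK ?add0r ?subr0 //.
      have s2' : size p = 2%N by apply/eqP; rewrite eqn_leq s2 sp.
      by have /monicP := mp; rewrite lead_coefE s2'.
    by rewrite nth_default ?oppr0 ?(leq_trans s2).
  by exists (- p`_0); rewrite root_XsubC.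
have [c pc] := tschirnhaus mp s2.
set p1 := p \Po ('X + c%:P) in pc.
have s1 : size p1 = size p by rewrite size_comp_poly2 // size_XaddC.
have m1 : p1 \is monic.
  by rewrite monicE lead_coef_comp ?size_XaddC // (monicP mp) lead_coefXaddC expr1n mulr1.
suff [x] : exists x, root p1 x by rewrite root_comp => px; eexists; exact: px.
have [[j jn pj]|nj] := EM (exists2 j, (j < (size p1).-1)%N & p1`_j != 0); last first.
  (* All coefficients below the leading one vanish: the polynomial is X^n. *)
  exists 0; apply/rootP; rewrite horner_coef0; apply/eqP/negP => /negP h; apply: nj.
  by exists 0%N => //; rewrite s1; case: (size p) sp => // -[].
rewrite -s1 in pc.
have [|w [q [mq sq qn1 [vq jq] hq]]] := puiseux_scale m1 _ pc (ex_intro2 _ _ j jn pj).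
  by rewrite s1.
have [|G [H [qGH mG /andP [G1 Gq]]]] := puiseux_factor mq _ vq qn1 jq.
  by rewrite sq s1.
have [||x Gx] := IHn G _ mG => //.
  by rewrite -ltnS (leq_trans Gq) // sq s1.
by exists (w * x); apply: hq; rewrite qGH rootM Gx.
Qed.

End PuiseuxTheorem.

(** * Change of the field of coefficients and splitting into linear factors *)

Section PuiseuxMap.
Variables (K K' : fieldType) (h : {rmorphism K -> K'}).

Lemma puiseux_map_monoid : monoid_morphism (puiseux_map h).
Proof.
split=> [|f g]; apply: puiseuxP => q.
  by rewrite pcoef1 /= ; case: eqP => _; rewrite ?rmorph1 ?rmorph0.
rewrite [RHS]pcoefM /= .
have [p [n [p0 hf hg]]] := common2 (psupp f) (psupp g).
have [s us hs] := cauchy_cover q p0 hf hg.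
rewrite (cauchyE us hs) (@cauchyE _ _ _ _ s us) ?rmorph_sum.
  by apply: eq_bigr => a _; rewrite rmorphM.
by move=> a /=; rewrite !fmorph_eq0; apply: hs.
Qed.

HB.instance Definition _ :=
  GRing.isMonoidMorphism.Build _ _ (puiseux_map h) puiseux_map_monoid.

Lemma puiseux_map_mono c u : puiseux_map h (pmono c u) = pmono (h c) u.
Proof. by apply: puiseuxP => q /=; case: ifP; rewrite ?rmorph0. Qed.

Lemma puiseux_map_psum z a N :
  puiseux_map h (psum z a N) = psum (puiseux_map h z) (h \o a) N.
Proof.
rewrite rmorph_sum; apply: eq_bigr => i _.
by rewrite rmorphM rmorphXn /= puiseux_map_mono.
Qed.

Lemma vge_puiseux_map f v : vge f v -> vge (puiseux_map h f) v.
Proof. by move=> hf q qv /=; rewrite hf ?rmorph0. Qed.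

Lemma puiseux_map_psubst z e a : 0 < e -> vge z e ->
  puiseux_map h (psubst z a) = psubst (puiseux_map h z) (h \o a).
Proof.
move=> e0 hz; apply/esym/(psubst_uniq e0 (vge_puiseux_map hz)) => N.
rewrite -puiseux_map_psum -rmorphB; apply: vge_puiseux_map.
exact: (psubstP e0 hz).
Qed.

End PuiseuxMap.

Section AlgClosed.
Variable K : fieldType.
Hypothesis Kcl : alg_closed K.

Lemma closed_split (p : {poly K}) : p != 0 ->
  exists rs : seq K, p = lead_coef p *: \prod_(r <- rs) ('X - r%:P).
Proof.
have [n] := ubnP (size p); elim: n p => // n IHn p; rewrite ltnS => pn p0.
have [s1|s1] := leqP (size p) 1.
  by exists [::]; rewrite big_nil (size1_polyC s1) lead_coefC alg_polyC.
have [r /factor_theorem [q pE]] := Kcl s1.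
have q0 : q != 0 by apply: contraNneq p0 => q0; rewrite pE q0 mul0r.
have [|rs qE] := IHn q _ q0.
  by apply: leq_trans pn; rewrite pE size_Mmonic ?monicXsubC // size_XsubC addn2.
have lE : lead_coef p = lead_coef q by rewrite pE lead_coef_Mmonic ?monicXsubC.
by exists (r :: rs); rewrite big_cons lE {1}pE {1}qE -scalerAl mulrC.
Qed.


(** The polynomial already splits over K, so the larger field brings no new root. This is what
    forces roots to be constants, or series over a smaller field. *)
Lemma root_map_closed (L : fieldType) (h : {rmorphism K -> L}) (p : {poly K}) r :
  p != 0 -> root (map_poly h p) r -> exists2 c, root p c & r = h c.
Proof.
move=> p0; have [rs pE] := closed_split p0.
rewrite pE linearZ /= rootZ ?fmorph_eq0 ?lead_coef_eq0 //.
rewrite rmorph_prod /= => hr.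
have {hr} : r \in map h rs.
  rewrite -root_prod_XsubC big_map; congr root: hr.
  by apply: eq_bigr => c _; rewrite rmorphB /= map_polyX map_polyC.
move=> /mapP [c crs ->]; exists c => //.
by rewrite rootZ ?lead_coef_eq0 // root_prod_XsubC.
Qed.

Lemma coprime_noroot (p q : {poly K}) : p != 0 ->
  (forall r, root p r -> ~~ root q r) -> coprimep p q.
Proof.
move=> p0 h; rewrite coprimep_def eqn_leq andbC size_poly_gt0 gcdp_eq0 negb_and p0 /=.
rewrite leqNgt; apply/negP => /Kcl [r]; rewrite root_gcd => /andP [/h /negP pr qr].
by apply: pr.
Qed.

Lemma separable_split (p : {poly K}) : p != 0 ->
    (forall r, root p r -> ~~ root p^`() r) ->
  exists rs : seq K, [/\ uniq rs, size rs = (size p).-1,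
    forall r, (r \in rs) = root p r &
    p = lead_coef p *: \prod_(r <- rs) ('X - r%:P)].
Proof.
move=> p0 h; have [rs pE] := closed_split p0.
have l0 : lead_coef p != 0 by rewrite lead_coef_eq0.
exists rs; split=> //.
- rewrite -separable_prod_XsubC.
  have : separable_poly p by rewrite unlock; apply: coprime_noroot.
  by apply: dvdp_separable; rewrite {1}pE dvdpZr.
- by rewrite {1}pE size_scale // size_prod_XsubC.
by move=> r; rewrite {1}pE rootZ // root_prod_XsubC.
Qed.

End AlgClosed.

(** * Walks in dimension one *)

Section Model1D.
Variables (K : fieldType) (sp : {poly K}) (m M : nat).
Hypotheses (Kcl : alg_closed K) (K0 : char0 K).
Hypotheses (ssp : size sp = (m + M).+1) (M0 : (0 < M)%N).
Hypothesis (sp0 : (0 < m)%N -> sp`_0 != 0).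

(* The coefficients of [X^m (1 - t s(X))] in the powers of [t]. *)
Definition kernel_seq n : {poly K} :=
  if n == 0%N then 'X^m else if n == 1%N then - sp else 0.

Lemma kernel_seq_factor : exists g h : nat -> {poly K},
  [/\ g 0%N = 'X^m, h 0%N = 1, kernel_seq =1 conv g h,
      forall n, (0 < n)%N -> (size (g n) <= m)%N & forall n, (size (h n) <= M.+1)%N].
Proof.
have [] := @hensel_seq K 'X^m 1 kernel_seq M.+1 (monicXn _ _) (coprimep1 _).
- by rewrite mulr1.
- move=> n; rewrite size_polyXn /= /kernel_seq; case: ifP => _.
    by rewrite size_polyXn addnS ltnS leq_addr.
  by case: ifP => _; rewrite ?size_polyN ?ssp ?size_poly0 // addnS.
- by rewrite size_poly1.
move=> g [h [h1 h2 h3 h4 h5]]; exists g, h; split=> // n n0.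
by have := h4 n n0; rewrite size_polyXn ltnS.
Qed.

Variables (g h : nat -> {poly K}).
Hypotheses (g0 : g 0%N = 'X^m) (h0 : h 0%N = 1) (gh : kernel_seq =1 conv g h).
Hypotheses (sg : forall n, (0 < n)%N -> (size (g n) <= m)%N).
Hypothesis (sh : forall n, (size (h n) <= M.+1)%N).

Local Notation F := (puiseux K).
Local Notation cst := (@pconst K).

Lemma sp_neq0 : sp != 0.
Proof. by rewrite -size_poly_gt0 ssp. Qed.

Lemma leq_size_factor n : (size (g n) <= m.+1)%N.
Proof. by case: n => [|n]; rewrite ?g0 ?size_polyXn // leqW ?sg. Qed.

(* [X^m (1 - sigma s(X))], where [sp = X^m s(X)] *)
Definition kerpoly (sigma : F) : {poly F} := 'X^m - sigma *: map_poly cst sp.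

Section Roots.
Variables (sigma : F) (e : rat).
Hypotheses (e0 : 0 < e) (hs : vge sigma e) (sigma0 : sigma != 0).
Local Notation P := (kerpoly sigma).
Local Notation G := (plift sigma m.+1 g).
Local Notation E := (plift sigma M.+1 h).

Lemma kerpoly_factor : P = G * E.
Proof.
have sr n : (size (kernel_seq n) <= (m + M).+1)%N.
  rewrite /kernel_seq; case: ifP => _; first by rewrite size_polyXn ltnS leq_addr.
  by case: ifP => _; rewrite ?size_polyN ?ssp ?size_poly0.
rewrite -(plift_conv e0 hs (d3 := (m + M).+1) leq_size_factor sh); last first.
  by move=> n; rewrite -gh.
rewrite -(plift_eq _ _ gh); apply/polyP => j; rewrite (coef_plift e0 hs) //.
rewrite -[RHS](_ : psubst sigma (fun n => if n == 0%N then ('X^m : {poly K})`_j else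
   if n == 1%N then - sp`_j else 0) = _); last first.
  apply: psubst_eq => n; rewrite /kernel_seq; case: ifP => // _.
  by case: ifP; rewrite ?coefN ?coef0.
rewrite (psubst_lin e0 hs) coefB coefZ coef_map !coefXn raddfN mulNr mulrC.
by congr (_ - _); case: eqP => _; rewrite ?raddf0.
Qed.

Lemma factor_monic : G \is monic /\ size G = m.+1.
Proof.
apply: (lift_monic e0 hs); rewrite g0 ?monicXn ?size_polyXn //; exact: sg.
Qed.

(** [E] is 1 modulo positive valuation, so its value at a point of non-negative valuation has
    constant coefficient 1. *)
Lemma cofactor_neq0 r : vge r 0 -> E.[r] != 0.
Proof.
move=> hr; suff h1 : pcoef E.[r] 0 = 1 by apply: contra_eq_neq h1 => ->; rewrite pcoef0 eq_sym oner_neq0.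
rewrite horner_coef pcoef_sum; set d := size E.
have vr i : vge (r ^+ i) 0 by have := vge_exp (n := i) hr; rewrite mulr0.
transitivity (\sum_(i < d) (if i == 0%N :> nat then 1 else 0 : K)).
  apply: eq_bigr => i _; rewrite -[X in pcoef _ X]addr0.
  rewrite pcoefM_lead ?(coef_plift e0 hs) //; last exact: (vge_psubst e0 hs).
  rewrite (pcoef_psubst0 e0 hs) h0 coef1; case: eqP => [->|_]; last by rewrite mulr0n mul0r.
  by rewrite expr0 mul1r pcoef1 eqxx.
(* The index 0 must occur in the sum, that is, [E] must not be the zero polynomial. *)
have d0 : (0 < d)%N.
  rewrite size_poly_gt0; apply/eqP => E0.
  have := kerpoly_factor; rewrite E0 mulr0 => /eqP.
  rewrite subr_eq0 => /eqP /(congr1 (fun p : {poly F} => size p)).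
  rewrite size_polyXn size_scale // size_map_poly ssp; lia.
by case: d d0 => // d _; rewrite big_ord_recl big1 ?addr0.
Qed.

(** [G] is monic with coefficients of non-negative valuation: at a point of valuation v < 0 the term
    r^m has strictly the least valuation and cannot be cancelled. *)
Lemma root_factor_small r : root G r -> vge r 0.
Proof.
have [mG sG] := factor_monic.
move=> Gr; apply: vgeP => v hv; rewrite leNgt; apply/negP => v0.
have : has_val G.[r] (m%:R * v).
  rewrite horner_coef sG big_ord_recr /= addrC.
  have -> : G`_m = 1 by have /monicP := mG; rewrite lead_coefE sG.
  rewrite mul1r; apply: (@has_valDl _ _ _ _ (m%:R * v - v)); [exact: has_valX| |by lra].
  apply: vge_sum => i _; apply: (@vgeW _ _ (i%:R * v)).
    have : (i.+1%:R : rat) <= m%:R by rewrite ler_nat.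
    by rewrite -natr1; nra.
  apply: vgeM0; last exact: (has_valX _ hv).1.
  by rewrite (coef_plift e0 hs _ leq_size_factor); exact: (vge_psubst e0 hs).
by move=> /has_val_neq0; rewrite (rootP Gr) eqxx.
Qed.

Lemma small_rootE r : root P r && `[< no_neg_power r >] = root G r.
Proof.
apply/andP/idP => [[Pr /asboolP r0]|Gr].
  move: Pr; rewrite kerpoly_factor rootM => /orP [//|/rootP Er].
  by have := cofactor_neq0 r0; rewrite Er eqxx.
split; first by rewrite kerpoly_factor rootM Gr.
by apply/asboolP; exact: root_factor_small.
Qed.

Lemma root0_kerpoly : ~~ root P 0.
Proof.
apply/negP => /rootP; rewrite horner_coef0 coefB coefXn coefZ coef_map eq_sym.
have [m00|m0] := posnP m.
  rewrite mulr1n => /eqP; rewrite subr_eq0 => /eqP h1.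
  have : vge (1 : F) e by rewrite h1 mulrC; apply: vgeM0 hs; exact: vge_const.
  by move=> /(_ 0 e0)/eqP; rewrite pcoef1 eqxx oner_eq0.
rewrite mulr0n sub0r => /eqP; rewrite oppr_eq0 mulf_eq0 (negbTE sigma0).
by rewrite fmorph_eq0 (negbTE (sp0 m0)).
Qed.

(** Otherwise c^m, a nonzero constant, would be a multiple of [sigma] by a constant, hence of
    positive valuation. *)
Lemma const_not_root c : ~~ root P (cst c).
Proof.
apply/negP => Pc.
have c0 : c != 0.
  by apply: contraTneq Pc => ->; rewrite raddf0 root0_kerpoly.
move/rootP: Pc; rewrite !hornerE horner_map /= -rmorphXn /= => /eqP.
rewrite subr_eq0 => /eqP cE.
have : vge (cst (c ^+ m)) e by rewrite cE mulrC; apply: vgeM0 hs; exact: vge_const.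
move=> /(_ 0 e0)/eqP; rewrite /= expf_eq0.
by rewrite (negbTE c0) andbF.
Qed.

Lemma size_kerpoly : size P = (m + M).+1.
Proof.
have sE : size (- (sigma *: map_poly cst sp)) = (m + M).+1.
  by rewrite size_polyN size_scale // size_map_poly.
by rewrite /kerpoly addrC size_polyDl sE // size_polyXn ltnS -[X in (X < _)%N]addn0 ltn_add2l.
Qed.

Lemma lead_kerpoly : lead_coef P = - (sigma * cst (lead_coef sp)).
Proof.
rewrite lead_coefE size_kerpoly coefB coefXn coefZ coef_map lead_coefE ssp /=.
by rewrite -[X in _ == X]addn0 eqn_add2l gtn_eqF // sub0r.
Qed.

(* At a double root [r], the derivative of [X^m / sp] vanishes, so that [r] is a
   constant, and so is [sigma]. *)
Lemma kerpoly_sep r : root P r -> ~~ root P^`() r.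
Proof.
move=> Pr; apply/negP => P'r.
pose w : {poly K} := (sp * 'X^(m.-1)) *+ m - 'X^m * sp^`().
have w0 : w != 0.
  have splead : sp`_(m + M) != 0.
    by have := sp_neq0; rewrite -lead_coef_eq0 lead_coefE ssp.
  have MR : M%:R != 0 :> K by case: M M0 => // k _; exact: K0.
  (* The top coefficient of [w] is m - (m + M) = -M times the leading coefficient of [sp]. *)
  apply/eqP => /(congr1 (fun p : {poly K} => p`_(m + M + m).-1)).
  rewrite coef0 coefB coefMn coefXnM coef_deriv.
  case: (posnP m) => [m00|m0].
    rewrite m00 mulr0n sub0r add0n addn0 subn0 => /eqP; rewrite prednK //.
    rewrite -[_ *+ M]mulr_natr oppr_eq0 mulf_eq0 (negbTE MR) orbF.
    by move: splead; rewrite m00 => /negbTE ->.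
  have -> : (m + M + m).-1 = (m + M + m.-1)%N by lia.
  rewrite coefMXn !ifF; [|lia|lia].
  have -> : (m + M + m.-1 - m).+1 = (m + M)%N by lia.
  rewrite addnK mulrnDr opprD addrA subrr sub0r -[_ *+ M]mulr_natr => /eqP.
  by rewrite oppr_eq0 mulf_eq0 (negbTE MR) orbF (negbTE splead).
have : root (map_poly cst w) r.
  apply/rootP; move/rootP: Pr; move/rootP: P'r.
  rewrite /kerpoly /w !(derivE, rmorphB, rmorphMn, rmorphM, hornerE) /= !map_polyXn.
  rewrite !hornerE -deriv_map hornerMn hornerXn.
  set A := (map_poly cst sp).[r]; set A' := (_^`()).[r] => h1 h2.
  have {}h1 : r ^+ m.-1 *+ m = sigma * A' by apply/eqP; rewrite -subr_eq0; apply/eqP.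
  have {}h2 : r ^+ m = sigma * A by apply/eqP; rewrite -subr_eq0; apply/eqP.
  by rewrite hornerMn hornerM hornerXn -/A -mulrnAr h1 h2; ring.
move=> /(root_map_closed Kcl w0) [c _ rc].
by have := const_not_root c; rewrite -rc Pr.
Qed.

Lemma kerpoly_roots : exists rs : seq F, [/\ uniq rs, size rs = (m + M)%N,
    forall r, (r \in rs) = root P r &
    P = - (sigma * cst (lead_coef sp)) *: \prod_(r <- rs) ('X - r%:P)].
Proof.
have P0 : P != 0 by rewrite -size_poly_gt0 size_kerpoly.
have [rs] := separable_split (puiseux_closed Kcl K0) P0 kerpoly_sep.
by rewrite size_kerpoly lead_kerpoly; exists rs.
Qed.

(** [G] divides the separable [P], and its roots are the small ones; the product depends only on
    their set, whatever the order of the given list. *)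
Lemma small_roots_prod (rs : seq F) : uniq rs ->
    (forall r, r \in rs <-> root P r /\ no_neg_power r) ->
  G = \prod_(r <- rs) ('X - r%:P) /\ size rs = m.
Proof.
move=> urs hrs; have [mG sG] := factor_monic.
have G0 := monic_neq0 mG; have P0 : P != 0 by rewrite -size_poly_gt0 size_kerpoly.
have PGE := kerpoly_factor.
have sepG r : root G r -> ~~ root G^`() r.
  move=> Gr; have := @kerpoly_sep r; rewrite {1}PGE rootM Gr => /(_ isT).
  apply: contraNN => G'r; rewrite PGE derivM rootE !hornerE.
  by rewrite (rootP Gr) (rootP G'r) !mul0r addr0.
have [gs [ugs sgs hgs]] := separable_split (puiseux_closed Kcl K0) G0 sepG.
rewrite (monicP mG) scale1r => GE.
have pgs : perm_eq gs rs.
  apply: uniq_perm => // r; rewrite hgs -small_rootE.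
  by apply/andP/idP => [[h1 /asboolP h2]|/hrs [h1 h2]]; [exact/hrs | split=> //; apply/asboolP].
by rewrite {1}GE (perm_big _ pgs) -(perm_size pgs) sgs sG.
Qed.

End Roots.
End Model1D.

(** * Polynomials in x as series in 1/x *)

Section PolyInX.
Variable K : fieldType.
Local Notation F := (puiseux K).
Local Notation cst := (@pconst K).
Local Notation x := (@y_ K).
Implicit Types p q : {poly K}.

(* [@y_ (puiseux C)] is convertible to [@x_ C], so that [x] below stands for the
   [x] as well as for the [y] of the model. *)
Definition polyx p : F := (map_poly cst p).[x].

Lemma x_neq0 : x != 0.
Proof. exact: pmono_neq0 (oner_neq0 _). Qed.

Lemma has_val_x : has_val x (-1).
Proof. exact: has_val_mono (oner_neq0 _). Qed.

Lemma has_val_xVn n : has_val (x ^- n) n%:R.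
Proof.
have := has_valV (has_valX n has_val_x); by rewrite mulrN mulr1 opprK.
Qed.

Lemma polyxE p : polyx p = \sum_(j < size p) pmono p`_j (- j%:R).
Proof.
rewrite /polyx horner_coef size_map_poly; apply: eq_bigr => j _.
by rewrite coef_map pmonoX pmonoM mulr1 add0r mulNrn.
Qed.

Lemma polyx_is_zmod : zmod_morphism polyx.
Proof. by move=> p q; rewrite /polyx rmorphB hornerD hornerN. Qed.
Lemma polyx_is_monoid : monoid_morphism polyx.
Proof. by split=> [|p q]; rewrite /polyx ?rmorph1 ?hornerC // rmorphM hornerM. Qed.
HB.instance Definition _ := GRing.isZmodMorphism.Build _ _ polyx polyx_is_zmod.
HB.instance Definition _ := GRing.isMonoidMorphism.Build _ _ polyx polyx_is_monoid.

Lemma polyxX : polyx 'X = x.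
Proof. by rewrite /polyx map_polyX hornerX. Qed.

Lemma vge_polyx n p : (size p <= n.+1)%N -> vge (polyx p) (- n%:R).
Proof.
move=> sp; rewrite polyxE; apply: vge_sum => j _; apply: vgeW (@vge_mono _ _ _).
by rewrite lerN2 ler_nat -ltnS (leq_trans (ltn_ord j)).
Qed.

Lemma has_val_polyx p n : size p = n.+1 -> has_val (polyx p) (- n%:R).
Proof.
move=> sp; rewrite polyxE sp big_ord_recr /= addrC.
apply: (@has_valDl _ _ _ _ (- n%:R + 1)); last by lra.
  by apply: has_val_mono; have := lead_coef_eq0 p; rewrite lead_coefE sp /= => ->;
    rewrite -size_poly_gt0 sp.
apply: vge_sum => j _; apply: vgeW (@vge_mono _ _ _).
have : (j.+1%:R : rat) <= n%:R by rewrite ler_nat.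
by rewrite -natr1; lra.
Qed.

Lemma pnonpos_vge (f : F) v : vge f v -> 0 < v -> pnonpos f = 0.
Proof.
move=> hf v0; apply: puiseuxP => q /=; case: ifP => // q0.
by apply: hf; apply: le_lt_trans q0 v0.
Qed.

Lemma pnonpos_polyx p : pnonpos (polyx p) = polyx p.
Proof.
apply: puiseuxP => q /=; case: ifP => // /negbT; rewrite -ltNge => q0.
rewrite polyxE pcoef_sum big1 // => j _ /=; case: eqP => // qE.
by move: q0; rewrite qE oppr_gt0 ltrn0.
Qed.


Lemma vge_xVn_polyx m p : (size p <= m)%N -> vge (x ^- m * polyx p) 1.
Proof.
case: m => [|m] sp.
  by move: sp; rewrite leqn0 size_poly_eq0 => /eqP ->; rewrite raddf0 mulr0; exact: vge_zero.
apply: (@vgeW _ _ (m.+1%:R + - m%:R)); first by rewrite -natr1; lra.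
by apply: vgeM; [exact: (has_val_xVn _).1 | exact: vge_polyx].
Qed.

Lemma polyx_scaleXn (c : K) n : polyx (c *: 'X^n) = pconst c * x ^+ n.
Proof. by rewrite /polyx map_polyZ map_polyXn hornerZ hornerXn. Qed.

Lemma polyx_deriv_scaleXn (c : K) n :
  polyx (c *: 'X^n)^`() = pconst c * (x ^+ n.-1 *+ n).
Proof. by rewrite derivZ derivXn -scalerMnr raddfMn /= polyx_scaleXn mulrnAr. Qed.

End PolyInX.

(** * Power series in t and division by the kernel *)

Section Geometric.
Variable F : fieldType.
Local Notation T := (@pmono F 1 1).

Lemma vge_t : vge T (1 : rat). Proof. exact: vge_mono. Qed.

Lemma pcoef_psubstT (a : nat -> F) (n : nat) : pcoef (psubst T a) n%:R = a n.
Proof.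
have := @psubstP _ _ _ ltr01 vge_t a n.+1 n%:R; rewrite mulr1 ltr_nat leqnn => /(_ isT) /eqP.
rewrite pcoefB subr_eq0 => /eqP ->; rewrite /psum pcoef_sum.
under eq_bigr => i _ do rewrite pcoef_constM pmonoX /=.
rewrite big_ord_recr /= eqxx mulr1 big1 ?add0r // => i _.
by rewrite eqr_nat gtn_eqF ?mulr0.
Qed.

Lemma pseriesE (a : nat -> F) : pseries a = psubst T a.
Proof.
apply/esym/(psubst_uniq ltr01 vge_t) => N q; rewrite mulr1 => qN.
rewrite pcoefB /psum pcoef_sum.
under eq_bigr => i _ do rewrite pcoef_constM pmonoX /=.
rewrite /=; case: eqP => [qE|nq]; last first.
  rewrite big1 ?subrr // => i _; case: eqP => [qi|_]; rewrite ?mulr0 //.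
  by case: nq; rewrite qi natrK.
have nN : (Num.truncn q < N)%N by rewrite -(ltr_nat rat) -qE.
rewrite (bigD1 (Ordinal nN)) //= -qE eqxx mulr1 big1 ?addr0 ?subrr // => i.
rewrite -val_eqE /= => hi; rewrite qE eqr_nat eq_sym (negbTE hi) mulr0 //.
Qed.

Lemma psubstT_inj (a b : nat -> F) : psubst T a = psubst T b -> a =1 b.
Proof. by move=> ab n; rewrite -!pcoef_psubstT ab. Qed.

Lemma psubst_geom (s : F) :
  psubst T (fun n => s ^+ n) * (1 - T * pconst s) = 1.
Proof.
have -> : 1 - T * pconst s = psubst T (fun n => if n == 0%N then 1 else if n == 1%N then - s else 0).
  by rewrite (psubst_lin ltr01 vge_t) raddfN mulNr mulrC.
rewrite -(psubstM ltr01 vge_t) -[RHS](psubst_const ltr01 vge_t 1); apply: psubst_eq => -[|n].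
  by rewrite /conv big_ord1 expr0 mulr1.
rewrite /conv !big_ord_recr /= subnn subSnn big1 ?add0r.
  by rewrite mulr1 mulrN -exprSr addNr.
move=> i _; have -> : (n.+1 - i)%N = (n - i).-1.+2 by have := ltn_ord i; lia.
by rewrite mulr0.
Qed.

Lemma kernel_neq0 (s : F) : 1 - T * pconst s != 0.
Proof.
apply: contraNneq (oner_neq0 (puiseux F)) => h.
by rewrite -(psubst_geom s) h mulr0.
Qed.

Lemma div_kernel (s : F) (a : nat -> F) :
  psubst T a / (1 - T * pconst s) = psubst T (conv a (fun n => s ^+ n)).
Proof.
apply: (mulIf (kernel_neq0 s)); rewrite mulfVK ?kernel_neq0 //.
rewrite (psubstM ltr01 vge_t a (fun n => s ^+ n)).
have eq1 : psubst T a * (psubst T (fun n => s ^+ n) * (1 - T * pconst s)) =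
    psubst T a by rewrite (psubst_geom s) [LHS]mulr1.
by move: eq1; rewrite [X in X = _ -> _]mulrA => /esym.
Qed.

(** Only additivity of [h] is assumed, because it will be a projection such as [x^>=], which is not
    multiplicative. *)
Lemma puiseux_map_psubstT (h : {additive F -> F}) (a : nat -> F) :
  puiseux_map h (psubst T a) = psubst T (h \o a).
Proof.
rewrite -!pseriesE; apply: puiseuxP => q /=.
by case: ifP => // _; rewrite raddf0.
Qed.

Lemma psubstT_const (f : F) :
  pconst f = psubst T (fun n => if n == 0%N then f else 0).
Proof. by rewrite (psubst_const ltr01 vge_t). Qed.

Lemma psubstT_scale (f : F) a : pconst f * psubst T a = psubst T (fun n => f * a n).
Proof.
rewrite psubstT_const -(psubstM ltr01 vge_t); apply: psubst_eq => n.
by rewrite /conv big_ord_recl big1 ?addr0 /= ?subn0 // => i _; rewrite mul0r.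
Qed.

End Geometric.

(** * The polynomials b_n and the non-negative part in x *)

Section Model1DSeries.
Variables (K : fieldType) (sp : {poly K}) (m M : nat).
Hypotheses (ssp : size sp = (m + M).+1) (M0 : (0 < M)%N).
Variables (g h : nat -> {poly K}).
Hypotheses (g0 : g 0%N = 'X^m) (h0 : h 0%N = 1) (gh : kernel_seq sp m =1 conv g h).
Hypotheses (sg : forall n, (0 < n)%N -> (size (g n) <= m)%N).
Local Notation F := (puiseux K).
Local Notation cst := (@pconst K).
Local Notation x := (@y_ K).
Local Notation T := (@pmono F 1 1).

Definition laurentx : F := x ^- m * polyx sp.
Local Notation s := laurentx.

Lemma has_val_laurentx : has_val s (- M%:R).
Proof.
have := has_valM (has_val_xVn K m) (has_val_polyx ssp).
by rewrite natrD opprD addrA subrr add0r.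
Qed.

Lemma has_val_laurentxV : has_val s^-1 M%:R.
Proof. by have := has_valV has_val_laurentx; rewrite opprK. Qed.

Lemma laurentx_neq0 : s != 0. Proof. exact: has_val_neq0 has_val_laurentx. Qed.

(** The coefficient of t^n in x^-m A(x; t) / (1 - t s(x)), that is, in 1 / E(x; t). *)
Definition walkpoly : nat -> F := conv (fun i => x ^- m * polyx (g i)) (fun k => s ^+ k).
Local Notation b := walkpoly.

Lemma walkpoly0 : b 0%N = 1.
Proof.
rewrite /walkpoly /conv big_ord1 g0 rmorphXn /= polyxX expr0 mulr1 mulVf //.
by rewrite expf_neq0 // x_neq0.
Qed.

Lemma walkpolyS n : b n.+1 = s * b n + x ^- m * polyx (g n.+1).
Proof.
rewrite /walkpoly /conv big_ord_recr /= subnn expr0 mulr1; congr (_ + _).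
rewrite mulr_sumr; apply: eq_bigr => i _; rewrite subSn; last by rewrite -ltnS.
by rewrite exprS mulrCA.
Qed.

(* [\sum_n b_n t^n] is the inverse of the second Hensel factor, which is
   [1 + O(t)] with coefficients polynomial in [x]. *)
Lemma walkpoly_inv : psubst T b * psubst T (fun n => polyx (h n)) = 1.
Proof.
rewrite (psubstM ltr01 (@vge_t F)) -mulrA mulrCA -(psubstM ltr01 (@vge_t F)).
rewrite -[RHS](psubst_geom s); congr (_ * _).
have -> : 1 - T * pconst s = psubst T (fun n => if n == 0%N then 1 else if n == 1%N then - s else 0).
  by rewrite (psubst_lin ltr01 (@vge_t F)) raddfN mulNr mulrC.
apply: psubst_eq => n.
transitivity (x ^- m * polyx (kernel_seq sp m n)).
  rewrite gh /conv rmorph_sum mulr_sumr; apply: eq_bigr => i _.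
  by rewrite rmorphM mulrA.
rewrite /kernel_seq; case: ifP => _.
  by rewrite rmorphXn /= polyxX mulVf // expf_neq0 // x_neq0.
by case: ifP => _; rewrite ?raddf0 ?mulr0 // raddfN mulrN.
Qed.

(** The recursive inversion of a power series divides only by its constant coefficient, which is 1
    for E; the coefficients therefore remain polynomials. *)
Lemma walkpoly_poly n : exists p, b n = polyx p.
Proof.
pose e n := polyx (h n).
have e00 : e 0%N = 1 by rewrite /e h0 rmorph1.
pose c n := head 0 (invseq e n).
have ce : psubst T c * psubst T e = 1.
  rewrite mulrC -(psubstM ltr01 (@vge_t F)) -[RHS](psubst_const ltr01 (@vge_t F) 1).
  apply: psubst_eq => k; rewrite /conv invseqP; last by rewrite e00 oner_neq0.
  by case: eqP.
have bc : b =1 c.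
  apply: psubstT_inj; have e0 : psubst T e != 0.
    by apply: contraNneq (oner_neq0 (puiseux F)) => h1; rewrite -ce h1 mulr0.
  by apply: (mulIf e0); rewrite ce walkpoly_inv.
rewrite bc; elim/ltn_ind: n => -[_|n IHn].
  by exists 1; rewrite /c /= e00 invr1 rmorph1.
have [p pE] : exists p, \sum_(i < n.+1) e i.+1 * (invseq e n)`_i = polyx p.
  have hp (i : 'I_n.+1) : exists q, (invseq e n)`_i = polyx q.
    by rewrite nth_invseq -1?ltnS //; apply: IHn; rewrite ltnS leq_subr.
  have [q hq] := choice hp.
  exists (\sum_(i < n.+1) h i.+1 * q i); rewrite rmorph_sum; apply: eq_bigr => i _.
  by rewrite rmorphM hq.
by exists (- p); rewrite /c /= e00 invr1 mulN1r pE raddfN.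
Qed.

Lemma pnonpos_walkpoly n : pnonpos (b n) = b n.
Proof. by have [p ->] := walkpoly_poly n; exact: pnonpos_polyx. Qed.

(** The difference b_(n+1) - s b_n is x^-m times a polynomial of degree below m, so it disappears in
    the projection, which fixes b_(n+1). *)
Lemma walkpoly_rec n : b n.+1 = pnonpos (s * b n).
Proof.
rewrite -[LHS]pnonpos_walkpoly walkpolyS raddfD /=.
by rewrite [X in _ + X](pnonpos_vge (vge_xVn_polyx (sg (ltn0Sn n)))) // addr0.
Qed.

(* With [1/s] substituted for [t], the first Hensel factor has the small
   solutions of [s(X) = s(x)] as roots. After multiplication by [x ^- m * s ^+ n],
   its terms beyond [t^n] only contribute negative powers of [x]. *)
Local Notation G := (plift s^-1 m.+1 g).

Lemma size_factor n : (size (g n) <= m.+1)%N.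
Proof. exact: (leq_size_factor g0 sg). Qed.

Lemma natr_M_gt0 : (0 : rat) < M%:R. Proof. by rewrite ltr0n. Qed.
Lemma vge_laurentxV : vge s^-1 M%:R. Proof. exact: has_val_laurentxV.1. Qed.

Lemma pnonpos_small_roots n : pnonpos (x ^- m * G.[x] * s ^+ n) = b n.
Proof.
rewrite -[RHS]pnonpos_walkpoly; apply/eqP; rewrite -subr_eq0 -raddfB /=; apply/eqP.
pose a j i := (g i)`_j.
(* As s^(n-i) = s^n (1/s)^i, the polynomial b_n is x^-m G(x) s^n with G truncated after the power n
   of 1/s. *)
have bE : b n = x ^- m * (\sum_(j < m.+1) psum s^-1 (a j) n.+1 * x ^+ j) * s ^+ n.
  have -> : \sum_(j < m.+1) psum s^-1 (a j) n.+1 * x ^+ j =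
      \sum_(i < n.+1) polyx (g i) * s^-1 ^+ i.
    under eq_bigr => j _ do rewrite /psum mulr_suml.
    rewrite exchange_big /=; apply: eq_bigr => i _.
    rewrite /polyx (@horner_coef_wide _ m.+1) ?size_map_poly ?size_factor // mulr_suml.
    by apply: eq_bigr => j _; rewrite coef_map mulrAC.
  rewrite /walkpoly /conv mulr_sumr mulr_suml; apply: eq_bigr => i _.
  rewrite !mulrA -[RHS]mulrA; congr (_ * _).
  have iN : (i <= n)%N by rewrite -ltnS.
  have -> : s ^+ n = s ^+ (n - i) * s ^+ i by rewrite -exprD subnK.
  by rewrite mulrCA -exprMn mulVf ?laurentx_neq0 // expr1n mulr1.
have GE : G.[x] = \sum_(j < m.+1) psubst s^-1 (a j) * x ^+ j.
  by rewrite /plift horner_poly.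
rewrite bE GE -mulrBl -mulrBr -sumrB big_ord_recr /=.
(* The coefficient of X^m in A is exactly 1, so it is unaffected by the truncation; only powers x^j
   with j < m remain. *)
have am : a m =1 (fun n => if n == 0%N then 1 else 0).
  by case=> [|k]; rewrite /a ?g0 ?coefXn ?eqxx // nth_default ?sg.
rewrite (psubst_eq _ am) (psubst_const natr_M_gt0 vge_laurentxV).
have -> : psum s^-1 (a m) n.+1 = 1.
  rewrite /psum big_ord_recl expr0 mulr1 am big1 ?addr0 // => i _.
  by rewrite am raddf0 mul0r.
rewrite subrr addr0; apply: (@pnonpos_vge _ _ 1) => //.
have hsn : vge (s ^+ n) (n%:R * - M%:R) := (has_valX n has_val_laurentx).1.
(* The four contributions come from x^-m, the tail in 1/s, x^j with j < m, and s^n; they add up to M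
   + 1. *)
apply: (@vgeW _ _ (m%:R + (n.+1%:R * M%:R + (1 - m%:R)) + n%:R * - M%:R)).
  have : (1 : rat) <= M%:R by rewrite ler1n.
  by rewrite -natr1; lra.
apply: vgeM => //; apply: vgeM; first exact: (has_val_xVn _ _).1.
apply: vge_sum => j _; rewrite -mulrBl.
apply: vgeM; first exact: (psubstP natr_M_gt0 vge_laurentxV).
have hx : vge (x ^+ j) (j%:R * -1) := (has_valX j (has_val_x K)).1.
apply: vgeW hx; have : (j.+1%:R : rat) <= m%:R by rewrite ler_nat.
by rewrite -natr1; lra.
Qed.


Lemma nonneg_small_roots :
  puiseux_map (@pnonpos K) (pconst (x ^- m * G.[x]) / (1 - T * pconst s)) = psubst T b.
Proof.
rewrite [pconst (_ * _)]psubstT_const div_kernel puiseux_map_psubstT; apply: psubst_eq => n.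
rewrite /= /conv big_ord_recl big1 ?addr0 /= ?subn0 ?pnonpos_small_roots // => i _.
by rewrite mul0r.
Qed.

(* With [t] itself substituted, its roots are those of the kernel. *)
Local Notation emb := (puiseux_map cst).
Local Notation Gt := (plift (pmono 1 1) m.+1 g).

Lemma kernel_factor :
  (pconst x) ^- m * (map_poly emb Gt).[pconst x] / (1 - T * pconst s) = psubst T b.
Proof.
suff -> : pconst x ^- m * (map_poly emb Gt).[pconst x] =
    psubst T (fun i => x ^- m * polyx (g i)) by exact: div_kernel.
have tE : emb (pmono 1 1) = T by rewrite puiseux_map_mono rmorph1.
rewrite (@horner_coef_wide _ m.+1) ?size_map_poly ?size_poly //.
transitivity (psubst T (fun n => \sum_(j < m.+1) (x ^- m * (cst (g n)`_j * x ^+ j)))); last first.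
  apply: psubst_eq => n; rewrite -mulr_sumr /polyx.
  rewrite (@horner_coef_wide _ m.+1) ?size_map_poly ?size_factor //.
  by congr (_ * _); apply: eq_bigr => j _; rewrite coef_map.
rewrite (psubst_sum ltr01 (@vge_t F)) mulr_sumr; apply: eq_bigr => j _.
rewrite coef_map (coef_plift ltr01 (@vge_t K)) //=; last exact: size_factor.
rewrite (puiseux_map_psubst _ _ ltr01 (@vge_t K)) tE.
rewrite -!rmorphXn /= -rmorphV ?unitfE ?expf_neq0 ?x_neq0 //=.
rewrite [_ * pconst (x ^+ j)]mulrC !psubstT_scale.
by apply: psubst_eq => n; rewrite [X in _ * X]mulrC.
Qed.

End Model1DSeries.

Lemma prod_small_roots (F : fieldType) (x : F) (rs : seq F) m : x != 0 -> size rs = m ->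
  \prod_(r <- rs) (1 - x^-1 * r) = x ^- m * (\prod_(r <- rs) ('X - r%:P)).[x].
Proof.
move=> x0 <-; rewrite horner_prod; elim: rs => [|r rs IHrs].
  by rewrite !big_nil mulr1 invr1.
rewrite !big_cons IHrs /= exprS invfM hornerXsubC mulrACA; congr (_ * _).
by rewrite mulrBr mulVf.
Qed.

(** * Algebraic closures of subfields *)

Section Subfield.
Variables (L : fieldType) (A : set L).

Definition subfield_pred of is_subfield A : pred L := fun z => `[< A z >].

(** A subset becomes a field type, so that [algebraicOver] applies to it and Puiseux series can be
    formed over it. *)
Record subfield_of (hA : is_subfield A) :=
  SubfieldOf { sf_val : L; _ : subfield_pred hA sf_val }.

Variable hA : is_subfield A.

HB.instance Definition _ := [isSub for @sf_val hA].
HB.instance Definition _ := [Choice of subfield_of hA by <:].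

Lemma subfield_divring : divring_closed (subfield_pred hA).
Proof.
case: (hA) => A1 Asub Adiv; split.
- by rewrite unfold_in; apply/asboolP.
- by move=> u v; rewrite !unfold_in => /asboolP hu /asboolP hv; apply/asboolP/Asub.
- by move=> u v; rewrite !unfold_in => /asboolP hu /asboolP hv; apply/asboolP/Adiv.
Qed.

HB.instance Definition _ := GRing.isDivringClosed.Build L (subfield_pred hA) subfield_divring.
HB.instance Definition _ := [SubChoice_isSubComUnitRing of subfield_of hA by <:].
HB.instance Definition _ := [SubComUnitRing_isSubIntegralDomain of subfield_of hA by <:].
HB.instance Definition _ := [SubIntegralDomain_isSubField of subfield_of hA by <:].

Definition sfv : {rmorphism subfield_of hA -> L} := \val.

Lemma sfv_in (z : subfield_of hA) : A (sfv z).
Proof. by have /asboolP := valP z. Qed.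

Lemma sfv_ex z : A z -> exists w, sfv w = z.
Proof. by move=> Az; exists (SubfieldOf (asboolT Az : subfield_pred hA z)). Qed.

Lemma sfv_poly (p : {poly L}) : (forall i, A p`_i) ->
  exists q : {poly subfield_of hA}, map_poly sfv q = p.
Proof.
move=> hp; have [c hc] := choice (fun i => sfv_ex (hp i)).
exists (\poly_(i < size p) c i); apply/polyP => i.
rewrite coef_map coef_poly; case: ltnP => h; first exact: hc.
by rewrite nth_default.
Qed.

Lemma algebraic_overE z : algebraic_over A z <-> algebraicOver sfv z.
Proof.
split=> [[p [p0 hp rp]]|[q q0 rq]].
  have [q qE] := sfv_poly hp; exists q; last by rewrite qE.
  by apply: contraNneq p0 => q0; rewrite -qE q0 rmorph0.
exists (map_poly sfv q); split=> //; first by rewrite map_poly_eq0.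
by move=> i; rewrite coef_map; exact: sfv_in.
Qed.

Definition algebraics : set L := [set z | algebraic_over A z].

Lemma algebraics_subfield : is_subfield algebraics.
Proof.
split=> [|u v|u v]; rewrite /algebraics /=.
- by apply/algebraic_overE; exact: algebraic1.
- by move=> /algebraic_overE hu /algebraic_overE hv; apply/algebraic_overE/algebraic_sub.
by move=> /algebraic_overE hu /algebraic_overE hv; apply/algebraic_overE/algebraic_div.
Qed.

Lemma sub_algebraics z : A z -> algebraics z.
Proof. by move=> /sfv_ex [w <-]; apply/algebraic_overE/algebraic_id. Qed.

(** Transitivity of algebraicity, obtained from that of integrality, the two notions being the same
    over a field. *)
Lemma root_algebraics (p : {poly L}) z : p != 0 -> (forall i, algebraics p`_i) ->
  root p z -> algebraics z.
Proof.
move=> p0 hp rp; apply/algebraic_overE/integral_algebraic/(integral_root p0 rp).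
by apply/integral_poly => i; apply/integral_algebraic/algebraic_overE/hp.
Qed.

Lemma algebraics_closure : alg_closed L -> is_algebraic_closure A algebraics.
Proof.
move=> Lcl; split=> //; [exact: algebraics_subfield|exact: sub_algebraics|].
move=> p hp sp; have [z rz] := Lcl p sp; exists z => //.
by apply: root_algebraics rz => //; rewrite -size_poly_gt0 ltnW.
Qed.

(** Factors X - w with w in B are split off until z is one of the w. This makes the later results
    valid for every algebraic closure inside L, not just for [algebraics]. *)
Lemma closure_algebraics B z : is_algebraic_closure A B -> algebraics z -> B z.
Proof.
case=> [[B1 Bsub Bdiv] AB _ Bcl] [p [p0 hp rp]].
have {hp} hp i : B p`_i by apply: AB.
have B0 : B 0 by rewrite -(subrr 1); apply: Bsub.
have Bmul u v : B u -> B v -> B (u * v).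
  by move=> hu hv; rewrite -[v]invrK -[v^-1]mul1r; apply: (Bdiv) => //; apply: (Bdiv).
have Badd u v : B u -> B v -> B (u + v).
  by move=> hu hv; rewrite -[v]opprK -[- v]add0r; apply: (Bsub) => //; apply: (Bsub).
have [n] := ubnP (size p); elim: n p p0 hp rp => // n IHn p p0 hp rp sn.
have [s1|s1] := leqP (size p) 1.
  by move: rp p0; rewrite (size1_polyC s1) rootC => /eqP ->; rewrite eqxx.
have [w Bw rw] := Bcl p hp s1.
have pE : p = (p %/ ('X - w%:P)) * ('X - w%:P) by rewrite divpK // dvdp_XsubCl.
set q := p %/ ('X - w%:P) in pE.
move: rp; rewrite pE rootM root_XsubC => /orP [rq|/eqP ->] //.
have q0 : q != 0 by apply: contraNneq p0 => q0; rewrite pE q0 mul0r.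
apply: (IHn q) => //; last first.
  by rewrite -ltnS; apply: leq_trans sn; rewrite ltnS pE size_Mmonic ?monicXsubC // size_XsubC addn2.
(* Horner's recurrence; by descending induction it keeps the coefficients of the quotient in B. *)
have qi i : q`_i = p`_i.+1 + w * q`_i.+1.
  by rewrite {1}pE mulrBr coefB coefMX coefMC /= mulrC subrK.
suff H k' i : (size q <= i + k')%N -> B q`_i by move=> i; apply: (H (size q)); rewrite leq_addl.
elim: k' i => [|k' IHk] i; first by rewrite addn0 => h; rewrite nth_default.
by rewrite addnS -addSn => /IHk h; rewrite qi; apply: (Badd) => //; apply: (Bmul).
Qed.

End Subfield.

Lemma generated_is_subfield (L : fieldType) (G : set L) : is_subfield (generated_subfield G).
Proof.
split=> [B [[h1 h2 h3] _] //|u v hu hv B hB|u v hu hv B hB].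
  by case: (hB) => -[h1 h2 h3] _; apply: h2; [exact: hu | exact: hv].
by case: (hB) => -[h1 h2 h3] _; apply: h3; [exact: hu | exact: hv].
Qed.

Lemma generated_sub (L : fieldType) (G : set L) z : G z -> generated_subfield G z.
Proof. by move=> Gz B [_]; apply. Qed.

Section SubfieldClosed.
Variables (L : fieldType) (A : set L) (hA : is_subfield A).
Hypothesis Lcl : alg_closed L.

Local Notation Alg := (subfield_of (algebraics_subfield hA)).

Lemma algebraics_closed : alg_closed Alg.
Proof.
move=> p sp; pose iota := sfv (algebraics_subfield hA).
have [|z rz] := Lcl (p := map_poly iota p); first by rewrite size_map_poly.
have p0 : map_poly iota p != 0 by rewrite map_poly_eq0 -size_poly_gt0 ltnW.
have Az : algebraics A z.
  by apply: (root_algebraics hA p0) rz => i; rewrite coef_map; exact: sfv_in.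
have [w wE] := sfv_ex (algebraics_subfield hA) Az.
by exists w; rewrite -(fmorph_root iota) -/iota in wE *; rewrite wE.
Qed.

Lemma subfield_char0 : char0 L -> char0 Alg.
Proof.
move=> L0 n; rewrite -(fmorph_eq0 (sfv (algebraics_subfield hA))) rmorph_nat; exact: L0.
Qed.

End SubfieldClosed.

(** Produces the numbering of the solutions: the variable itself at index 0, then the small ones,
    then the others. *)
Lemma seq_reorder (A : eqType) (d : A) (P : pred A) (s : seq A) a : uniq s -> a \in s -> ~~ P a ->
  exists s', [/\ perm_eq s' s, nth d s' 0 = a &
    forall i, (i < size s)%N -> P (nth d s' i) = (1 <= i <= count P s)%N].
Proof.
move=> us sa Pa; pose s1 := filter P s; pose s2 := filter (predC P) (rem a s).
have ps : perm_eq (a :: s1 ++ s2) s.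
  rewrite perm_sym (perm_trans (perm_to_rem sa)) // perm_cons.
  have -> : s1 = filter P (rem a s).
    rewrite /s1 rem_filter // -filter_predI; apply: eq_filter => b /=.
    by case: (eqVneq b a) => [->|]; rewrite ?(negbTE Pa) ?andbF ?andbT.
  by rewrite perm_sym perm_filterC.
exists (a :: s1 ++ s2); split=> // i; rewrite -(perm_size ps) /= ltnS size_cat.
case: i => [|i] /=; first by rewrite (negbTE Pa).
rewrite nth_cat -size_filter -/s1 => hi; case: (ltnP i (size s1)) => h.
  by have := mem_nth d h; rewrite mem_filter => /andP [].
have : nth d s2 (i - size s1) \in s2 by apply: mem_nth; lia.
by rewrite mem_filter /= => /andP [/negbTE ->].
Qed.

Lemma seq_reorder0 (A : eqType) (d : A) (P : pred A) (s : seq A) :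
  exists s', perm_eq s' s /\
    forall i, (i < size s)%N -> P (nth d s' i) = (i < count P s)%N.
Proof.
exists (filter P s ++ filter (predC P) s); have ps := permEl (perm_filterC P s).
split=> // i; rewrite -(perm_size ps) nth_cat size_cat -size_filter => hi.
case: ltnP => h; first by have := mem_nth d h; rewrite mem_filter => /andP [].
set s2 := filter (predC P) s in hi *.
have : nth d s2 (i - size (filter P s)) \in s2 by apply: mem_nth; lia.
by rewrite mem_filter /= => /andP [/negbTE ->].
Qed.

(** * Roots of the kernel polynomial and the one-variable statement *)

Section KerpolyRoots.
Variables (K : fieldType) (sp : {poly K}) (m : nat).
Local Notation F := (puiseux K).

Lemma kerpoly_rootP (sigma r : F) : r != 0 ->
  root (kerpoly sp m sigma) r <->
  1 - sigma * (r ^- m * (map_poly (@pconst K) sp).[r]) = 0.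
Proof.
move=> r0; have rm : r ^+ m != 0 by rewrite expf_neq0.
have E : (kerpoly sp m sigma).[r] =
    r ^+ m * (1 - sigma * (r ^- m * (map_poly (@pconst K) sp).[r])).
  rewrite /kerpoly hornerD hornerN hornerZ hornerXn; move: (_.[r]) => A.
  by rewrite mulrBr mulr1 [r ^+ m * (sigma * _)]mulrCA mulVKf.
rewrite rootE E mulf_eq0 (negbTE rm); split=> [/eqP //|-> //].
by rewrite eqxx.
Qed.

End KerpolyRoots.

Section KerpolyMap.
Variables (L K : fieldType) (iota : {rmorphism L -> K}) (sp : {poly L}) (m M : nat).
Hypotheses (Lcl : alg_closed L) (L0 : char0 L).

Lemma kerpoly_map (sigma : puiseux L) :
  kerpoly (map_poly iota sp) m (puiseux_map iota sigma) =
  map_poly (puiseux_map iota) (kerpoly sp m sigma).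
Proof.
rewrite /kerpoly rmorphB /= map_polyXn map_polyZ /=; congr (_ - _ *: _).
by rewrite -!map_poly_comp; apply: eq_map_poly => c /=; rewrite puiseux_map_mono.
Qed.

(** The polynomial has coefficients in series over L, a field closed by Puiseux's theorem. With L
    the algebraic closure of Q(y), it gives the algebraicity of the coefficients of the roots. *)
Lemma kerpoly_root_descent (sigma : puiseux L) r : kerpoly sp m sigma != 0 ->
  root (kerpoly (map_poly iota sp) m (puiseux_map iota sigma)) r ->
  exists f, r = puiseux_map iota f.
Proof.
move=> P0; rewrite kerpoly_map.
by move=> /(root_map_closed (puiseux_closed Lcl L0) P0) [f _ ->]; exists f.
Qed.

Lemma polyx_map p : polyx (map_poly iota p) = puiseux_map iota (polyx p).
Proof.
rewrite !polyxE size_map_poly rmorph_sum /=; apply: eq_bigr => j _.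
by rewrite coef_map puiseux_map_mono.
Qed.

Lemma laurentx_map : laurentx (map_poly iota sp) m = puiseux_map iota (laurentx sp m).
Proof.
rewrite /laurentx rmorphM polyx_map fmorphV rmorphXn /= puiseux_map_mono rmorph1 //.
Qed.

End KerpolyMap.

Section OneDim.
Variables (K : fieldType) (sp : {poly K}) (m M : nat).
Hypotheses (Kcl : alg_closed K) (K0 : char0 K).
Hypotheses (ssp : size sp = (m + M).+1) (M0 : (0 < M)%N).
Hypothesis (sp0 : (0 < m)%N -> sp`_0 != 0).
Local Notation F := (puiseux K).
Local Notation cst := (@pconst K).
Local Notation x := (@y_ K).
Local Notation T := (@pmono F 1 1).
Local Notation s := (laurentx sp m).
Local Notation small := (fun r : F => `[< no_neg_power r >]).

Lemma count_small sigma e (rs : seq F) : 0 < e -> vge sigma e -> sigma != 0 ->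
  uniq rs -> (forall r, (r \in rs) = root (kerpoly sp m sigma) r) ->
  count small rs = m.
Proof.
move=> e0 hs s0 urs hrs.
have [g [h [h1 h2 h3 h4 h5]]] := kernel_seq_factor ssp.
rewrite -size_filter.
have [] // := small_roots_prod Kcl K0 ssp M0 sp0 h1 h2 h3 h4 h5 e0 hs s0
  (filter_uniq small urs).
move=> r; rewrite mem_filter hrs; split=> [/andP [/asboolP]//|[h6 h7]].
by rewrite h6 andbT; apply/asboolP.
Qed.

Lemma root_x : root (kerpoly sp m s^-1) x.
Proof.
apply/kerpoly_rootP; first exact: x_neq0.
by rewrite -[_ * _.[_]]/s mulVf ?subrr // (laurentx_neq0 ssp).
Qed.

Lemma x_not_small : ~ no_neg_power x.
Proof. by move=> /(_ (-1) ltac:(by [])) /eqP; rewrite /= oner_eq0. Qed.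

Lemma x_solutions_ex : exists rs : seq F, [/\ uniq rs, size rs = (m + M)%N, rs`_0 = x,
  forall r, (r \in rs) = root (kerpoly sp m s^-1) r &
  forall i, (i < m + M)%N -> (no_neg_power rs`_i <-> (1 <= i <= m)%N)].
Proof.
have e0 := natr_M_gt0 M0; have hs := vge_laurentxV ssp.
have s0 : s^-1 != 0 by rewrite invr_eq0 (laurentx_neq0 ssp).
have [rs [urs srs hrs _]] := kerpoly_roots Kcl K0 ssp M0 sp0 e0 hs s0.
have [||rs' [prs rs0 hsm]] := @seq_reorder _ 0 small rs x urs.
- by rewrite hrs root_x.
- by apply/asboolP; exact: x_not_small.
exists rs'; split=> //.
- by rewrite (perm_uniq prs).
- by rewrite (perm_size prs).
- by move=> r; rewrite (perm_mem prs).
move=> i im; have := hsm i; rewrite srs (count_small e0 hs s0 urs hrs) => /(_ im) <-.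
by split=> /asboolP.
Qed.

Lemma kernel_roots_ex : exists rs : seq F, [/\ uniq rs, size rs = (m + M)%N,
  forall r, (r \in rs) = root (kerpoly sp m (pmono 1 1)) r &
  forall i, (i < m + M)%N -> (no_neg_power rs`_i <-> (i < m)%N)].
Proof.
have hs := @vge_t K; have e0 := @ltr01 rat.
have s0 : pmono 1 1 != 0 :> F := pmono_neq0 1 (oner_neq0 _).
have [rs [urs srs hrs _]] := kerpoly_roots Kcl K0 ssp M0 sp0 e0 hs s0.
have [rs' [prs hsm]] := seq_reorder0 0 small rs.
exists rs'; split=> //.
- by rewrite (perm_uniq prs).
- by rewrite (perm_size prs).
- by move=> r; rewrite (perm_mem prs).
move=> i im; have := hsm i; rewrite srs (count_small e0 hs s0 urs hrs) => /(_ im) <-.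
by split=> /asboolP.
Qed.

(** A single [b] serves the recursion, the small solutions [rs] and the small kernel roots [Rs], all
    three coming from one Hensel factorization. The unknown x needs the quotients by the kernel, and
    y the projections of the products with s^n. *)
Lemma one_dim (rs Rs : seq F) : uniq rs -> uniq Rs ->
  (forall r, r \in rs <-> root (kerpoly sp m s^-1) r /\ no_neg_power r) ->
  (forall r, r \in Rs <-> root (kerpoly sp m (pmono 1 1)) r /\ no_neg_power r) ->
  exists b : nat -> F, [/\ b 0%N = 1, forall n, b n.+1 = pnonpos (s * b n),
    forall n, pnonpos (\prod_(r <- rs) (1 - x^-1 * r) * s ^+ n) = b n,
    puiseux_map (@pnonpos K) (pconst (\prod_(r <- rs) (1 - x^-1 * r)) / (1 - T * pconst s))
      = psubst T b &
    \prod_(r <- Rs) (1 - (pconst x)^-1 * puiseux_map cst r) / (1 - T * pconst s)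
      = psubst T b].
Proof.
move=> urs uRs hrs hRs.
have [g [h [h1 h2 h3 h4 h5]]] := kernel_seq_factor ssp.
have e0 := natr_M_gt0 M0; have hs := vge_laurentxV ssp.
have s0 : s^-1 != 0 by rewrite invr_eq0 (laurentx_neq0 ssp).
have t0 : pmono 1 1 != 0 :> F := pmono_neq0 1 (oner_neq0 _).
have [Gx sx] := small_roots_prod Kcl K0 ssp M0 sp0 h1 h2 h3 h4 h5 e0 hs s0 urs hrs.
have [Gt st] := small_roots_prod Kcl K0 ssp M0 sp0 h1 h2 h3 h4 h5 (@ltr01 rat) (@vge_t K) t0 uRs hRs.
have xE : \prod_(r <- rs) (1 - x^-1 * r) = x ^- m * (plift s^-1 m.+1 g).[x].
  by rewrite (prod_small_roots (x_neq0 K) sx) Gx.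
exists (walkpoly sp m g); split.
- exact: walkpoly0.
- exact: (walkpoly_rec h2 h3 h4).
- by move=> n; rewrite xE; exact: (pnonpos_small_roots ssp M0 h1 h2 h3 h4 n).
- by rewrite xE; exact: (nonneg_small_roots ssp M0 h1 h2 h3 h4).
rewrite -(kernel_factor _ h1 h4) -(big_map (puiseux_map cst) xpredT (fun r => 1 - (pconst x)^-1 * r)).
rewrite (@prod_small_roots _ (pconst x) _ m) ?size_map //; last first.
  by rewrite fmorph_eq0 x_neq0.
rewrite Gt rmorph_prod big_map /=.
by under [X in _ = _ * X.[_] / _]eq_bigr => r _ do rewrite rmorphB /= map_polyX map_polyC.
Qed.

(** This is the factorization of [kerpoly] over its roots, evaluated at X = x and divided by x^m. *)
Lemma kernel_large (Rs : seq F) : uniq Rs ->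
  (forall r, (r \in Rs) = root (kerpoly sp m (pmono 1 1)) r) ->
  (1 - T * pconst s) = - (T * pconst (cst (lead_coef sp))) * (pconst x) ^- m *
    \prod_(r <- Rs) (pconst x - puiseux_map cst r).
Proof.
move=> uRs hRs.
have t0 : pmono 1 1 != 0 :> F := pmono_neq0 1 (oner_neq0 _).
have [rs [urs srs hrs PE]] := kerpoly_roots Kcl K0 ssp M0 sp0 (@ltr01 rat) (@vge_t K) t0.
have prs : perm_eq Rs rs by apply: uniq_perm => // r; rewrite hRs hrs.
rewrite (perm_big _ prs) /=.
have xm0 : pconst x ^+ m != 0 by rewrite expf_neq0 // fmorph_eq0 x_neq0.
have spE : (map_poly (puiseux_map cst) (map_poly cst sp)).[pconst x] = pconst (polyx sp).
  rewrite -map_poly_comp /polyx -horner_map /= -map_poly_comp; congr (_.[_]).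
  by apply: eq_map_poly => c /=; rewrite puiseux_map_mono.
have tE : puiseux_map cst (pmono 1 1) = T by rewrite puiseux_map_mono rmorph1.
have := congr1 (fun p => (map_poly (puiseux_map cst) p).[pconst x]) PE.
rewrite /kerpoly rmorphB /= !map_polyZ /= map_polyXn hornerD hornerN !hornerZ hornerXn.
rewrite spE tE rmorph_prod horner_prod rmorphN rmorphM /= tE puiseux_map_mono => PE2.
have -> : \prod_(r <- rs) (pconst x - puiseux_map cst r) =
    \prod_(r <- rs) (map_poly (puiseux_map cst) ('X - r%:P)).[pconst x].
  by apply: eq_bigr => r _; rewrite rmorphB /= map_polyX map_polyC hornerXsubC.
rewrite mulrAC -PE2 mulrBl mulfV //; congr (_ - _).
rewrite /laurentx rmorphM fmorphV rmorphXn /= -mulrA; congr (_ * _).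
by rewrite mulrC.
Qed.

(** For M = 1 the only solution that is not small is x, so that [kerpoly] is -(lc / s) (X - x)
    prod_i (X - x_i), with lc the leading coefficient of [sp]; its derivative at X = x retains only
    the product. The left-hand side is s'(x). *)
Lemma deriv_small (rs : seq F) : M = 1%N -> uniq rs ->
  (forall r, r \in rs <-> root (kerpoly sp m s^-1) r /\ no_neg_power r) ->
  x ^- m * polyx sp^`() - (x ^- m.+1 * polyx sp) *+ m =
  cst (lead_coef sp) * \prod_(r <- rs) (1 - x^-1 * r).
Proof.
move=> M1 urs hrs.
have e0 := natr_M_gt0 M0; have hs := vge_laurentxV ssp.
have s0 : s^-1 != 0 by rewrite invr_eq0 (laurentx_neq0 ssp).
have [al [ual sal hal PE]] := kerpoly_roots Kcl K0 ssp M0 sp0 e0 hs s0.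
have cs := count_small e0 hs s0 ual hal.
have sx : ~~ small x by apply/asboolP; exact: x_not_small.
have srs : size rs = m.
  rewrite -cs -size_filter; apply: perm_size; apply: uniq_perm => //.
    exact: filter_uniq.
  move=> r; rewrite mem_filter hal; apply/idP/idP => [/hrs [-> h]|/andP [/asboolP h1 h2]].
    by rewrite andbT; apply/asboolP.
  exact/hrs.
have prs : perm_eq al (x :: rs).
  have xrs : uniq (x :: rs).
    by rewrite /= urs andbT; apply/negP => /hrs [_ /x_not_small].
  have [] := uniq_min_size xrs (s2 := al).
  - by move=> r; rewrite inE hal => /orP [/eqP ->|/hrs []] //; exact: root_x.
  - by rewrite sal /= srs M1 addn1.
  by move=> _ h; apply: uniq_perm => // r; rewrite h.
move: PE; rewrite (perm_big _ prs) big_cons => PE.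
have := congr1 (fun p => p^`().[x]) PE.
rewrite derivZ derivM /kerpoly derivB derivXn derivZ deriv_map derivXsubC mul1r.
rewrite !(hornerD, hornerN, hornerZ) hornerM hornerXsubC subrr mul0r addr0 hornerMn hornerXn.
rewrite -/(polyx _) (prod_small_roots (x_neq0 K) srs).
set q := (\prod_(r <- rs) _).[x]; have sn0 := laurentx_neq0 ssp => E.
(* The first summand comes from the X^m in [kerpoly]; it matches the term subtracted in s'(x). *)
have E2 : polyx sp^`() = s * (x ^+ m.-1 *+ m) + cst (lead_coef sp) * q.
  apply: (mulfI s0); rewrite mulrDr (mulKf sn0) mulrA.
  by rewrite -[X in _ = X + _](subrK (s^-1 * polyx sp^`())) E mulNr addrAC addNr add0r.
rewrite E2 mulrDr addrAC mulrCA [cst _ * (_ * q)]mulrCA.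
suff -> : s * (x ^- m * (x ^+ m.-1 *+ m)) = (x ^- m.+1 * polyx sp) *+ m by rewrite subrr add0r.
rewrite /laurentx; case: m => [|k]; first by rewrite !mulr0n !mulr0.
rewrite !mulrnAr; congr (_ *+ _); rewrite /=.
have xk : x ^+ k != 0 by rewrite expf_neq0 // x_neq0.
by rewrite !exprS; move: x_neq0 (polyx sp) => /(_ K) x0 A; field; rewrite x0 xk.
Qed.
End OneDim.

(** * Hadamard models *)

Lemma sum_pick (V : zmodType) (A : eqType) (r : seq A) a (c : A -> V) : uniq r ->
  (a \notin r -> c a = 0) ->
  \sum_(s <- r) (if s == a then c s else 0) = c a.
Proof.
move=> ur ha; have [ar|ar] := boolP (a \in r).
  rewrite (bigD1_seq a) //= eqxx big1 ?addr0 // => s /negbTE -> //.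
rewrite ha // big_seq big1 // => s sr; case: eqP => // sa.
by rewrite -sa sr in ar.
Qed.

Lemma shift_ge0 (k : int) (m M : nat) : - m%:Z <= k <= M%:Z -> 0 <= k + m%:Z.
Proof. lia. Qed.

Lemma shift_eq (k : int) (m M j : nat) : - m%:Z <= k <= M%:Z ->
  (j == absz (k + m%:Z)) = (k == j%:Z - m%:Z).
Proof. move=> h; apply/eqP/eqP; lia. Qed.

Section LaurentEval.
Variables (C : fieldType).

Lemma lpeval_wide (A : fieldType) (h : {rmorphism C -> A}) (P : laurent C) (a : A) ks :
  uniq ks -> (forall k, P k != 0 -> k \in ks) ->
  lpeval h P a = \sum_(k <- ks) h (P k) * a ^ k.
Proof.
move=> uks hks; rewrite /lpeval.
have -> : \sum_(k <- ks) h (P k) * a ^ k = \sum_(k <- [seq k <- ks | P k != 0]) h (P k) * a ^ k.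
  rewrite big_filter [RHS]big_mkcond; apply: eq_bigr => k _.
  by case: eqVneq => //= ->; rewrite rmorph0 mul0r.
apply: perm_big; apply: uniq_perm; rewrite ?fset_uniq ?filter_uniq // => k.
rewrite mem_filter mem_finsupp; apply/idP/andP => [h1|[]//].
by split=> //; apply: hks.
Qed.

(** X^m P(X); the absolute value is harmless as long as the exponents of [P] are at least -m. *)
Definition lpoly (P : laurent C) (m : nat) : {poly C} :=
  \sum_(k <- finsupp P) P k *: 'X^(absz (k + m%:Z)).

Lemma exprz_shift (A : fieldType) (a : A) (k : int) (m : nat) : a != 0 -> 0 <= k + m%:Z ->
  a ^- m * a ^+ absz (k + m%:Z) = a ^ k.
Proof.
move=> a0 km; rewrite exprnN [a ^+ _]exprnP gez0_abs // -expfzDr //.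
by congr (_ ^ _); lia.
Qed.

Section LPoly.
Variables (P : laurent C) (m M : nat).
Hypotheses (hP : forall k, P k != 0 -> - m%:Z <= k <= M%:Z).

Lemma lpevalE (A : fieldType) (h : {rmorphism C -> A}) (a : A) : a != 0 ->
  lpeval h P a = a ^- m * (map_poly h (lpoly P m)).[a].
Proof.
move=> a0; rewrite /lpeval /lpoly rmorph_sum horner_sum mulr_sumr.
rewrite !big_seq; apply: eq_bigr => k; rewrite mem_finsupp => /hP km.
rewrite /= map_polyZ map_polyXn hornerZ hornerXn mulrCA exprz_shift //; lia.
Qed.

Lemma coef_lpoly j : (lpoly P m)`_j = P (j%:Z - m%:Z).
Proof.
rewrite /lpoly coef_sum.
have [Pj|Pj] := eqVneq (P (j%:Z - m%:Z)) 0.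
  rewrite Pj big_seq big1 // => k; rewrite mem_finsupp coefZ coefXn => Pk.
  case: eqP => [jk|_]; rewrite ?mulr0 // mulr1.
  by have -> : k = j%:Z - m%:Z by have := hP Pk; lia.
rewrite (bigD1_seq (j%:Z - m%:Z)) ?fset_uniq ?mem_finsupp //= coefZ coefXn.
have -> : absz (j%:Z - m%:Z + m%:Z) = j by lia.
rewrite eqxx mulr1 big_seq_cond big1 ?addr0 // => k /andP [].
rewrite mem_finsupp coefZ coefXn => Pk kj.
case: eqP => [jk|_]; rewrite ?mulr0 //.
by case/eqP: kj; have := hP Pk; lia.
Qed.

Lemma size_lpoly : P M%:Z != 0 -> size (lpoly P m) = (m + M).+1.
Proof.
move=> PM; apply/eqP; rewrite eqn_leq; apply/andP; split.
  apply/leq_sizeP => j hj; rewrite coef_lpoly; apply/eqP/negP => /negP /hP; lia.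
rewrite ltnNge; apply/negP => /leq_sizeP /(_ _ (leqnn _)); rewrite coef_lpoly.
by rewrite PoszD addrAC subrr add0r; apply/eqP.
Qed.

End LPoly.
End LaurentEval.

Section StepPoly.
Variables (C : fieldType) (S : {fset int * int}) (m M : nat).
Hypothesis (hx : has_val_deg S fst (- m%:Z) M%:Z).
Local Notation Fy := (puiseux C).
Local Notation y := (@y_ C).

Definition steppoly : {poly Fy} := \sum_(s <- S) y ^ s.2 *: 'X^(absz (s.1 + m%:Z)).

Lemma y_expz (k : int) : y ^ k = pmono 1 (- k%:~R).
Proof. by rewrite pmonoXz mulN1r. Qed.

Lemma stepevalE (X : puiseux Fy) : X != 0 ->
  stepeval S X (pconst y) = X ^- m * (map_poly (@pconst Fy) steppoly).[X].
Proof.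
move=> X0; rewrite /stepeval /steppoly rmorph_sum horner_sum mulr_sumr.
rewrite !big_seq; apply: eq_bigr => s; case: hx => hs _ _ /hs sS.
rewrite /= map_polyZ map_polyXn hornerZ hornerXn /= fmorphXz.
have h := shift_ge0 sS.
move: (_ ^ s.2) => c; rewrite -(exprz_shift X0 h).
by rewrite -mulrA [_ * c]mulrC.
Qed.

Lemma coef_steppoly j : steppoly`_j = stepcoefx S (j%:Z - m%:Z) y.
Proof.
rewrite /steppoly coef_sum /stepcoefx [RHS]big_mkcond !big_seq; apply: eq_bigr => s.
case: hx => hs _ _ /hs sS; rewrite coefZ coefXn.
by rewrite (shift_eq _ sS); case: (_ == _); rewrite ?mulr1 ?mulr0.
Qed.

(** Distinct steps with the same first coordinate contribute distinct powers of y, so nothing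
    cancels: the power given by [s] has coefficient 1. *)
Lemma stepcoefx_neq0 k : (exists2 s, s \in S & s.1 = k) -> stepcoefx S k y != 0.
Proof.
move=> [s sS sk]; apply/eqP => /(congr1 (fun f => pcoef f (- s.2%:~R))).
rewrite pcoef0 /stepcoefx pcoef_sum big_mkcond /=.
suff -> : \sum_(s' <- S) (if s'.1 == k then pcoef (y ^ s'.2) (- s.2%:~R) else 0) =
    \sum_(s' <- S) (if s' == s then 1 else 0) :> C.
  by rewrite (@sum_pick _ _ S s (fun=> 1)) ?fset_uniq ?sS //; apply/eqP/oner_neq0.
apply: eq_bigr => s' _; rewrite y_expz /= eqr_opp eqr_int -sk.
by rewrite -pair_eqE /pair_eq [s.2 == _]eq_sym; case: (s'.1 == s.1).
Qed.

Lemma size_steppoly : size steppoly = (m + M).+1.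
Proof.
apply/eqP; rewrite eqn_leq; case: hx => hs _ [s sS sM]; apply/andP; split.
  apply/leq_sizeP => j hj; rewrite coef_steppoly /stepcoefx big_seq_cond big1 //.
  by move=> [a b] /andP [/hs /= h /eqP /= h']; lia.
rewrite ltnNge; apply/negP => /leq_sizeP /(_ _ (leqnn _)); rewrite coef_steppoly.
apply/eqP; rewrite PoszD addrAC subrr add0r; apply: stepcoefx_neq0.
by exists s.
Qed.

Lemma lead_steppoly : lead_coef steppoly = stepcoefx S M%:Z y.
Proof.
by rewrite lead_coefE size_steppoly coef_steppoly PoszD addrAC subrr add0r.
Qed.

Lemma steppoly0 : steppoly`_0 != 0.
Proof.
rewrite coef_steppoly sub0r; apply: stepcoefx_neq0.
by case: hx => _ [s sS sm] _; exists s.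
Qed.

Lemma laurentx_steppoly : laurentx steppoly m = stepeval S x_ yx_.
Proof. by rewrite [RHS]stepevalE ?x_neq0. Qed.

Lemma lead_steppoly_neq0 : stepcoefx S M%:Z y != 0.
Proof. by rewrite -lead_steppoly lead_coef_eq0 -size_poly_gt0 size_steppoly. Qed.

End StepPoly.

Section Hadamard.
Variables (C : fieldType) (S : {fset int * int}) (U V T : laurent C).
Hypothesis hS : hadamard S U V T.
Local Notation Fy := (puiseux C).
Local Notation Fxy := (puiseux Fy).

Lemma x_expz (k : int) : (x_ : Fxy) ^ k = pmono 1 (- k%:~R).
Proof. by rewrite pmonoXz mulN1r. Qed.

Lemma yx_expz (k : int) : (yx_ : Fxy) ^ k = pconst (pmono 1 (- k%:~R)).
Proof. by rewrite -y_expz fmorphXz. Qed.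

(** The coefficient of x^k y^l; the signs are due to the series variables 1/x and 1/y. *)
Definition lcoef (f : Fxy) (k l : int) : C := pcoef (pcoef f (- k%:~R)) (- l%:~R).

Lemma lcoefD f g k l : lcoef (f + g) k l = lcoef f k l + lcoef g k l.
Proof. by []. Qed.

Lemma lcoef_sum (I : Type) (r : seq I) (F : I -> Fxy) k l :
  lcoef (\sum_(i <- r) F i) k l = \sum_(i <- r) lcoef (F i) k l.
Proof. by rewrite /lcoef pcoef_sum pcoef_sum. Qed.

Lemma lcoef_mono c k l k' l' :
  lcoef (cst_xy c * x_ ^ k * yx_ ^ l) k' l' = if (k, l) == (k', l') then c else 0.
Proof.
rewrite x_expz yx_expz /cst_xy /lcoef !pmonoM !mulr1 !add0r !addr0 /=.
rewrite eqr_opp eqr_int xpair_eqE [k' == k]eq_sym; case: eqP => //= _.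
by rewrite eqr_opp eqr_int [l' == l]eq_sym.
Qed.

(** Comparing coefficients of x^k y^l turns the Hadamard identity, an equality of series, into
    equalities in C. *)
Lemma hadamard_coef k l :
  ((k, l) \in S)%:R = (if l == 0 then U k else 0) + V k * T l :> C.
Proof.
have cM (c d : C) : cst_xy (c * d) = cst_xy c * cst_xy d by rewrite /cst_xy !rmorphM.
have := congr1 (fun f => lcoef f k l) hS; rewrite lcoefD => E.
transitivity (lcoef (stepeval S x_ yx_) k l).
  rewrite /stepeval lcoef_sum -(@sum_pick _ _ S (k, l) (fun s => (s \in S)%:R)) ?fset_uniq //.
    rewrite !big_seq; apply: eq_bigr => s sS; rewrite sS.
    have c1 : cst_xy 1 = 1 :> Fxy by rewrite /cst_xy !rmorph1.
    by rewrite -[x_ ^ _]mul1r -c1 lcoef_mono -surjective_pairing.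
  by move=> /negbTE ->.
rewrite E; congr (_ + _).
  rewrite /lpeval lcoef_sum.
  under eq_bigr => k' _ do rewrite -[_ * _]mulr1 -[1](expr0z yx_) lcoef_mono xpair_eqE.
  rewrite [0 == l]eq_sym; case: (l == 0) => /=; last by rewrite big1 // => k' _; rewrite andbF.
  under eq_bigr => k' _ do rewrite andbT.
  by rewrite (sum_pick _ (c := U)) ?fset_uniq // memNfinsupp => /eqP.
rewrite /lpeval mulr_suml lcoef_sum.
transitivity (\sum_(k' <- finsupp V) if k' == k then V k' * T l else 0).
  apply: eq_bigr => k' _; rewrite mulr_sumr lcoef_sum.
  under eq_bigr => l' _ do rewrite mulrACA -cM mulrA lcoef_mono xpair_eqE.
  case: (k' == k) => /=; last by rewrite big1.
  by rewrite (sum_pick (c := fun l' => V k' * T l')) ?fset_uniq // memNfinsupp => /eqP ->; rewrite mulr0.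
by rewrite (sum_pick (c := fun k' => V k' * T l)) ?fset_uniq // memNfinsupp => /eqP ->; rewrite mul0r.
Qed.

(** The identity is assumed at the generic point (x, y) only; since coefficients agree, it can be
    evaluated at other pairs, in particular at the solutions X and Y. *)
Lemma stepeval_hadamard (A : fieldType) (h : {rmorphism C -> A}) (X Y : A) :
  stepeval S X Y = lpeval h U X + lpeval h V X * lpeval h T Y.
Proof.
pose ks := undup (map fst S ++ finsupp U ++ finsupp V).
(* The exponent 0 of y is added to receive the terms of U. *)
pose ls := undup (0 :: map snd S ++ finsupp T).
have uks : uniq ks by exact: undup_uniq.
have uls : uniq ls by exact: undup_uniq.
have Sks (s : int * int) : s \in S -> s.1 \in ks.
  by move=> sS; rewrite mem_undup mem_cat map_f.
have Sls (s : int * int) : s \in S -> s.2 \in ls.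
  by move=> sS; rewrite mem_undup inE mem_cat map_f ?orbT.
rewrite (lpeval_wide h (P := U) X uks); last first.
  by move=> k Uk; rewrite mem_undup !mem_cat mem_finsupp Uk orbT.
rewrite (lpeval_wide h (P := V) X uks); last first.
  by move=> k Uk; rewrite mem_undup !mem_cat !mem_finsupp Uk !orbT.
rewrite (lpeval_wide h (P := T) Y uls); last first.
  by move=> k Uk; rewrite mem_undup inE mem_cat mem_finsupp Uk !orbT.
pose L := [seq (k, l) | k <- ks, l <- ls].
have uL : uniq L by apply: allpairs_uniq => // -[a b] [a' b'] _ _ [-> ->].
transitivity (\sum_(p <- L) (if p \in S then X ^ p.1 * Y ^ p.2 else 0)).
  rewrite /stepeval; under eq_big_seq => s sS.
    rewrite -(sum_pick (a := s) (c := fun s => X ^ s.1 * Y ^ s.2) uL).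
      over.
    case: s sS => a b sS; move=> /negP []; apply/allpairsP; exists (a, b).
    by split=> //; [exact: (Sks _ sS) | exact: (Sls _ sS)].
  rewrite exchange_big /=; apply: eq_bigr => p _.
  under eq_bigr => s _ do rewrite eq_sym.
  case: ifP => pS.
    by rewrite (sum_pick (c := fun=> X ^ p.1 * Y ^ p.2)) ?fset_uniq // pS.
  rewrite big_seq big1 // => s sS; case: eqP => // sp.
  by rewrite -sp sS in pS.
rewrite big_allpairs mulr_suml -big_split; apply: eq_bigr => k _ /=.
have -> : h (U k) * X ^ k = \sum_(l <- ls) (if l == 0 then h (U k) * X ^ k else 0).
  rewrite (sum_pick (c := fun=> h (U k) * X ^ k)) // => /negP [].
  by rewrite mem_undup inE eqxx.
rewrite mulr_sumr -big_split; apply: eq_bigr => l _ /=.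
transitivity (h ((k, l) \in S)%:R * (X ^ k * Y ^ l)).
  by case: ((k, l) \in S); rewrite ?rmorph1 ?mul1r // rmorph0 mul0r.
rewrite hadamard_coef rmorphD rmorphM mulrDl; congr (_ + _); last by rewrite mulrACA.
by case: eqP => [->|_]; rewrite ?rmorph0 ?mul0r // expr0z mulr1.
Qed.

Section TLaurent.
Variables (m' M' : nat).
Hypotheses (hy : has_val_deg S snd (- m'%:Z) M'%:Z) (hM' : (0 < M')%N) (hT : T M'%:Z = 1).

(** A step (k0, M') of top degree in y gives V_k0 T_M' = 1, so V_k0 = 1 by the normalization of T.
    The column k0 of S then shows the coefficients of T, except T_0, which is mixed with U. *)
Lemma hadamard_pick : exists2 k0, V k0 = 1 &
  forall l, l != 0 -> T l = ((k0, l) \in S)%:R.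
Proof.
case: hy => _ _ [[k0 l0] sS /= l0E].
have V1 : V k0 = 1.
  have := hadamard_coef k0 l0; rewrite sS l0E hT mulr1 ifF ?add0r //; lia.
exists k0 => // l l0'; have := hadamard_coef k0 l.
by rewrite V1 mul1r (negbTE l0') add0r.
Qed.

Lemma T_bounds k : T k != 0 -> - m'%:Z <= k <= M'%:Z.
Proof.
have [->|k0] := eqVneq k 0; first by lia.
have [k1 _ ->] := hadamard_pick => //.
by case: (boolP (_ \in S)) => [sS _|]; [case: hy => /(_ _ sS) | rewrite eqxx].
Qed.

(** For m' = 0 the coefficient in question would be T_0, which can vanish: a constant added to T is
    compensated in U. *)
Lemma T_val : (0 < m')%N -> T (- m'%:Z) != 0.
Proof.
move=> m0; case: hy => _ [[k1 l1] sS /= l1E] _.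
have := hadamard_coef k1 l1; rewrite sS l1E ifF ?add0r; last by lia.
by move=> h; apply/eqP => T0; move: h; rewrite T0 mulr0 => /eqP; rewrite oner_eq0.
Qed.

End TLaurent.

End Hadamard.

(** * Quadrant walks *)

Section Walks.
Variables (C : fieldType) (S : {fset int * int}).
Local Notation Fy := (puiseux C).
Local Notation Fxy := (puiseux Fy).
Local Notation Nx := (@pnonpos Fy).
Local Notation Ny := (puiseux_map (@pnonpos C)).

Definition mono_xy (p : int * int) : Fxy := x_ ^ p.1 * yx_ ^ p.2.

Lemma mono_xyE p : mono_xy p = pmono (pmono 1 (- p.2%:~R)) (- p.1%:~R).
Proof. by rewrite /mono_xy x_expz yx_expz pmonoM mul1r addr0. Qed.

Lemma mono_xyD p q : mono_xy (p + q) = mono_xy p * mono_xy q.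
Proof.
rewrite !mono_xyE !pmonoM mul1r /=; congr pmono; last by rewrite intrD opprD.
by congr pmono; rewrite intrD opprD.
Qed.

Lemma nonneg_mono_xy p : Nx (Ny (mono_xy p)) = if in_quadrant p then mono_xy p else 0.
Proof.
rewrite mono_xyE; apply: puiseuxP => q; apply: puiseuxP => r.
transitivity (if in_quadrant p then
  pcoef (pcoef (pmono (pmono (1 : C) (- p.2%:~R)) (- p.1%:~R)) q) r else 0); last by case: ifP.
rewrite /in_quadrant /=.
case: (eqVneq q (- p.1%:~R)) => [->|_] /=; last by rewrite raddf0 !if_same.
rewrite oppr_le0 ler0z; case: (0 <= p.1) => //=.
case: (eqVneq r (- p.2%:~R)) => [->|_]; last by rewrite !if_same.
by rewrite oppr_le0 ler0z.
Qed.

Definition good n (w : n.-tuple S) : bool :=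
  [forall k : 'I_n.+1, in_quadrant (position (take k w))].

Definition walk_gf n : Fxy := \sum_(w : n.-tuple S | good w) mono_xy (position w).

Lemma good_position n (w : n.-tuple S) : good w -> in_quadrant (position w).
Proof.
move/forallP/(_ ord_max); rewrite /= take_oversize //.
by rewrite size_tuple.
Qed.

(** Walks are grouped by endpoint; [r] lists the finitely many endpoints, which makes the sum over
    all pairs a finite one. *)
Lemma walk_gfE n : \sum_(p \in [set: nat * nat])
    (quadrant_walks S p.1 p.2 n)%:R * @x_ C ^+ p.1 * @yx_ C ^+ p.2 = walk_gf n.
Proof.
pose ap (w : n.-tuple S) := (absz (position w).1, absz (position w).2).
pose r := undup [seq ap w | w <- enum [pred w | good w]].
have apE w : good w -> position w = ((ap w).1%:Z, (ap w).2%:Z).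
  move/good_position => /andP [h1 h2].
  by rewrite /ap /= !gez0_abs // -surjective_pairing.
have qE p : (quadrant_walks S p.1 p.2 n)%:R * @x_ C ^+ p.1 * @yx_ C ^+ p.2 =
    \sum_(w : n.-tuple S | good w) (if p == ap w then mono_xy (position w) else 0).
  rewrite /quadrant_walks -sum1_card natr_sum !mulr_suml /=.
  rewrite -[RHS]big_mkcondr /=; apply: eq_big => [w|w].
    rewrite inE; case gw: (good w); rewrite -/(good w) gw //=.
    by rewrite (apE w gw) [p]surjective_pairing !xpair_eqE eq_sym [_ == p.2 :> int]eq_sym.
  by rewrite inE => /andP [_ /eqP ->]; rewrite mul1r.
rewrite (@fsbigE _ _ _ _ _ r) ?undup_uniq //.
  under eq_bigr => p _ do rewrite qE.
  rewrite exchange_big /=; apply: eq_bigr => w gw.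
  under eq_bigl => p do rewrite in_setT.
  rewrite (sum_pick (c := fun=> mono_xy (position w))) ?undup_uniq // => /negP [].
  by rewrite mem_undup map_f // mem_enum inE.
move=> p _; rewrite qE => pr; rewrite big1 // => w gw.
case: eqP => // pE; case/negP: pr; rewrite mem_undup pE map_f // mem_enum inE //.
Qed.

Lemma walk_gf0 : walk_gf 0 = 1.
Proof.
rewrite /walk_gf (big_pred1 [tuple]) => [|w].
  by rewrite /position big_nil /mono_xy !expr0z mulr1.
rewrite [w]tuple0 [RHS]/= eqxx; apply/forallP => k.
by rewrite /= /position big_nil.
Qed.

Lemma good_rcons n (w : n.-tuple S) s :
  good [tuple of rcons w s] = good w && in_quadrant (position w + val s).
Proof.
have pr : position (rcons w s) = position w + val s.
  by rewrite /position -cats1 big_cat big_seq1.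
apply/forallP/andP => [h|[/forallP h1 h2] k].
  split; last by have := h ord_max; rewrite /= take_oversize ?size_rcons ?size_tuple // pr.
  apply/forallP => k; have := h (widen_ord (leqnSn _) k) => /=.
  by rewrite -cats1 takel_cat // size_tuple -ltnS.
have [kn|kn] := leqP k n.
  have := h1 (Ordinal (kn : (k < n.+1)%N)) => /=.
  by rewrite -cats1 takel_cat // size_tuple.
by rewrite take_oversize ?pr // size_rcons size_tuple.
Qed.

(** Decomposition by the last step: the projections remove exactly the extensions whose endpoint
    leaves the quadrant. *)
Lemma walk_gfS n : walk_gf n.+1 = Nx (Ny (stepeval S x_ yx_ * walk_gf n)).
Proof.
pose f (p : n.-tuple S * S) : n.+1.-tuple S := [tuple of rcons p.1 p.2].
have fb : bijective f.
  apply: inj_card_bij => [[w s] [w' s'] /(congr1 val) /= /rcons_inj [/val_inj -> ->] //|].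
  by rewrite card_prod !card_tuple expnSr.
rewrite {1}/walk_gf (reindex f) /=; last exact: onW_bij.
have -> : stepeval S x_ yx_ = \sum_(s : S) mono_xy (val s) :> Fxy.
  by rewrite /stepeval big_seq_fsetE.
rewrite mulrC /walk_gf mulr_suml !raddf_sum /=.
rewrite -(pair_big_dep xpredT (fun w s => good (f (w, s))) (fun w s => mono_xy (position (f (w, s))))) /=.
rewrite [RHS]big_mkcond; apply: eq_bigr => w _.
case gw: (good w); last by rewrite big1 // => s; rewrite good_rcons gw.
rewrite mulr_sumr !raddf_sum /= big_mkcond; apply: eq_bigr => s _.
rewrite good_rcons gw -mono_xyD nonneg_mono_xy /=.
by rewrite /position -cats1 big_cat big_seq1.
Qed.

Lemma quadrant_gfE : quadrant_gf S = psubst (pmono 1 1) walk_gf.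
Proof. by rewrite /quadrant_gf pseriesE; apply: psubst_eq => n; exact: walk_gfE. Qed.

End Walks.

(** * The projection [y^>=] and polynomials in T(y) *)

Section AdditiveProjection.
Variables (R : comNzRingType) (N : {additive R -> R}).

Lemma projection_scale (c t p u : R) : (forall f, N (c * f) = c * N f) ->
  N (p * (t * u)) = N (t * N (p * u)) ->
  N (t * (p * (c * u))) = N (t * N (p * (c * u))).
Proof.
move=> Nc h; rewrite (mulrCA p) Nc !(mulrCA t c) !Nc -h.
by rewrite (mulrCA t p).
Qed.

(** The shape of S = U(x) + V(x) T(y): the monomials [a i] and [b j] commute with the projection
    [N], and only d = T(y) needs an exchange property on [g]. *)
Lemma projection_sum (I J : Type) (r : seq I) (r' : seq J) (a : I -> R) (b : J -> R) (d g : R) :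
  (forall i f, N (a i * f) = a i * N f) -> (forall j f, N (b j * f) = b j * N f) ->
  N (N g) = N g -> N (d * g) = N (d * N g) ->
  N ((\sum_(i <- r) a i + \sum_(j <- r') b j * d) * g) =
  N ((\sum_(i <- r) a i + \sum_(j <- r') b j * d) * N g).
Proof.
move=> ha hb h1 h2; rewrite !mulrDl !mulr_suml !raddfD !raddf_sum /=; congr (_ + _).
  by apply: eq_bigr => i _; rewrite !ha h1.
by apply: eq_bigr => j _; rewrite -!mulrA !hb h2.
Qed.

End AdditiveProjection.

Section NonnegY.
Variable C : fieldType.
Local Notation Fy := (puiseux C).
Local Notation Fxy := (puiseux Fy).
Local Notation ny := (@pnonpos C).
Local Notation Nx := (@pnonpos Fy).
Local Notation Ny := (puiseux_map ny).

Lemma pnonpos_constM (K : fieldType) (c : K) f : pnonpos (pconst c * f) = pconst c * pnonpos f.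
Proof.
apply: puiseuxP => q; rewrite pcoef_constM /=.
by case: ifP => _; rewrite ?mulr0 // -pcoef_constM.
Qed.

Lemma Ny_monoM (c : C) u f : Ny (pmono (pconst c) u * f) = pmono (pconst c) u * Ny f.
Proof.
apply: puiseuxP => q; rewrite pcoef_monoM.
change (ny (pcoef (pmono (pconst c) u * f) q) = pconst c * ny (pcoef f (q - u))).
by rewrite pcoef_monoM pnonpos_constM.
Qed.

Lemma NxNyC f : Nx (Ny f) = Ny (Nx f).
Proof. by apply: puiseuxP => q /=; case: ifP => // _; rewrite raddf0. Qed.

Variables (S : {fset int * int}) (U V T : laurent C).
Hypothesis hS : hadamard S U V T.
Variables (Py : Fy).
Local Notation W := (@stepeval S Fxy x_ yx_).
Local Notation Ty := (lpeval (@pconst C) T (@y_ C)).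
Hypothesis Py0 : ny Py = 1.
Hypothesis PyS : forall n, ny (Py * Ty ^+ n.+1) = ny (Ty * ny (Py * Ty ^+ n)).

Definition poly_in_T (f : Fy) : Prop := exists p : {poly C}, f = (map_poly (@pconst C) p).[Ty].

(* Only polynomials in [T(y)] are allowed: [T(y)^-1] would not do. *)
Lemma ny_poly_in_T f : poly_in_T f -> ny (Ty * (Py * f)) = ny (Ty * ny (Py * f)).
Proof.
move=> [p ->]; rewrite horner_coef size_map_poly !mulr_sumr !raddf_sum /= mulr_sumr raddf_sum.
apply: eq_bigr => i _; rewrite coef_map; apply: projection_scale.
  by move=> g; apply: pnonpos_constM.
by rewrite -exprS; apply: PyS.
Qed.

Lemma poly_in_T0 : poly_in_T 0.
Proof. by exists 0; rewrite rmorph0 horner0. Qed.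
Lemma poly_in_T1 : poly_in_T 1.
Proof. by exists 1; rewrite rmorph1 hornerC. Qed.
Lemma poly_in_TD f g : poly_in_T f -> poly_in_T g -> poly_in_T (f + g).
Proof. by move=> [p ->] [q ->]; exists (p + q); rewrite rmorphD hornerD. Qed.
Lemma poly_in_TZ c f : poly_in_T f -> poly_in_T (pconst c * f).
Proof. by move=> [p ->]; exists (c *: p); rewrite map_polyZ hornerZ. Qed.
Lemma poly_in_TM f : poly_in_T f -> poly_in_T (Ty * f).
Proof. by move=> [p ->]; exists (p * 'X); rewrite rmorphM /= map_polyX hornerM hornerX mulrC. Qed.
Lemma poly_in_T_sum (I : Type) (r : seq I) (F : I -> Fy) :
  (forall i, poly_in_T (F i)) -> poly_in_T (\sum_(i <- r) F i).
Proof. by move=> h; elim/big_ind: _ => [|f g|//]; [exact: poly_in_T0|exact: poly_in_TD]. Qed.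

Lemma step_series : W = \sum_(k <- finsupp U) pmono (pconst (U k)) (- k%:~R) +
  \sum_(k <- finsupp V) pmono (pconst (V k)) (- k%:~R) * pconst Ty.
Proof.
rewrite hS /lpeval -mulr_suml; congr (_ + _ * _).
- by apply: eq_bigr => k _; rewrite x_expz /cst_xy pmonoM mulr1 add0r.
- by apply: eq_bigr => k _; rewrite x_expz /cst_xy pmonoM mulr1 add0r.
rewrite rmorph_sum; apply: eq_bigr => l _.
by rewrite rmorphM /= fmorphXz.
Qed.

Definition coefs_in_T (f : Fxy) : Prop := forall q, poly_in_T (pcoef f q).

(** Multiplication by S combines coefficients linearly over C and multiplies some by T(y); the
    projection in x only drops coefficients. *)
Lemma coefs_in_T_step f : coefs_in_T f -> coefs_in_T (Nx (W * f)).
Proof.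
move=> hf q; rewrite /=; case: ifP => _; last exact: poly_in_T0.
change (poly_in_T (pcoef (W * f) q)); rewrite step_series mulrDl pcoefD !mulr_suml !pcoef_sum.
apply: poly_in_TD; apply: poly_in_T_sum => k.
  by rewrite pcoef_monoM; apply: poly_in_TZ.
by rewrite -mulrA pcoef_monoM pcoef_constM; apply/poly_in_TZ/poly_in_TM.
Qed.

Lemma Ny_stepM f : coefs_in_T f ->
  Ny (W * (pconst Py * f)) = Ny (W * Ny (pconst Py * f)).
Proof.
move=> hf; rewrite step_series; apply: projection_sum.
- by move=> k g; apply: Ny_monoM.
- by move=> k g; apply: Ny_monoM.
- by apply: puiseuxP => q; apply: puiseuxP => r /=; case: (r <= 0).
apply: puiseuxP => q; set g := pconst Py * f.
change (ny (pcoef (pconst Ty * g) q) = ny (pcoef (pconst Ty * Ny g) q)).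
rewrite (pcoef_constM Ty g) (pcoef_constM Ty (Ny g)).
change (ny (Ty * pcoef g q) = ny (Ty * ny (pcoef g q))).
by rewrite /g pcoef_constM ny_poly_in_T.
Qed.

(** In the induction, [Ny_stepM] removes the inner projection in y; the two projections then
    commute, and the factor [Py], free of x, leaves the projection in x, where the recursion of [b]
    appears. *)
Lemma walk_gf_hadamard (b : nat -> Fxy) : b 0%N = 1 ->
  (forall n, b n.+1 = Nx (W * b n)) ->
  forall n, walk_gf C S n = Ny (pconst Py * b n).
Proof.
move=> b0 bS; have hb n : coefs_in_T (b n).
  elim: n => [|n IHn]; last by rewrite bS; apply: coefs_in_T_step.
  by rewrite b0 => q; rewrite pcoef1; case: (q == 0); [exact: poly_in_T1|exact: poly_in_T0].
elim=> [|n IHn].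
  rewrite walk_gf0 b0 mulr1; apply: puiseuxP => q /=.
  by case: ifP => _; rewrite ?Py0 ?raddf0.
rewrite walk_gfS IHn bS -Ny_stepM // NxNyC.
by rewrite -pnonpos_constM mulrCA.
Qed.

End NonnegY.

Section SubfieldOps.
Variables (L : fieldType) (A : set L).
Hypothesis hA : is_subfield A.

Lemma subfield1 : A 1. Proof. by case: hA. Qed.
Lemma subfieldB u v : A u -> A v -> A (u - v). Proof. by case: hA => _ h _; apply: h. Qed.
Lemma subfield_div u v : A u -> A v -> A (u / v). Proof. by case: hA => _ _; apply. Qed.
Lemma subfield0 : A 0. Proof. by rewrite -(subrr 1); apply: subfieldB subfield1 subfield1. Qed.
Lemma subfieldV u : A u -> A u^-1.
Proof. by move=> hu; rewrite -[u^-1]mul1r; apply: subfield_div subfield1 hu. Qed.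
Lemma subfieldM u v : A u -> A v -> A (u * v).
Proof. by move=> hu hv; rewrite -[v]invrK; apply: subfield_div (subfieldV hv). Qed.
Lemma subfieldD u v : A u -> A v -> A (u + v).
Proof.
move=> hu hv; rewrite -[v]opprK -[- v]sub0r; apply: subfieldB => //.
exact: subfieldB subfield0 hv.
Qed.
Lemma subfieldX u n : A u -> A (u ^+ n).
Proof.
move=> hu; elim: n => [|n IHn]; first by rewrite expr0; exact: subfield1.
by rewrite exprS; apply: subfieldM.
Qed.
Lemma subfieldXz u (k : int) : A u -> A (u ^ k).
Proof.
move=> hu; case: k => n; first exact: subfieldX.
by rewrite NegzE -exprnN; apply/subfieldV/subfieldX.
Qed.
Lemma subfield_sum (I : Type) (r : seq I) (P : pred I) (F : I -> L) :
  (forall i, A (F i)) -> A (\sum_(i <- r | P i) F i).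
Proof. by move=> h; elim/big_ind: _ => [|u v|//]; [exact: subfield0|exact: subfieldD]. Qed.

Lemma subfield_stepeval S a b : A a -> A b -> A (stepeval S a b).
Proof.
by move=> ha hb; apply: subfield_sum => s; apply: subfieldM; apply: subfieldXz.
Qed.

End SubfieldOps.

(** Trades a block of indices for the set of entries with property P, the form in which the
    one-variable results take their roots. *)
Lemma block_uniq (A : eqType) (d : A) (xs : seq A) (a b N : nat) (P : A -> Prop) :
  uniq xs -> size xs = N -> (b <= N)%N ->
  (forall i, (i < N)%N -> (P (nth d xs i) <-> (a <= i < b)%N)) ->
  let rs := [seq nth d xs i | i <- index_iota a b] in
  uniq rs /\ forall r, r \in rs <-> r \in xs /\ P r.
Proof.
move=> uxs sxs bN hP rs; split.
  rewrite map_inj_in_uniq ?iota_uniq // => i j.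
  rewrite !mem_index_iota => /andP [_ ib] /andP [_ jb] /eqP.
  by rewrite nth_uniq ?sxs ?(leq_trans ib) ?(leq_trans jb) // => /eqP.
move=> r; rewrite /rs {rs}; split.
  move=> /mapP [i iab ->]; rewrite mem_index_iota in iab; have iN : (i < N)%N.
    by case/andP: iab => _ ib; apply: leq_trans bN.
  by split; [rewrite mem_nth ?sxs | apply/hP].
case=> /(nthP d) [i iN <-]; rewrite sxs in iN => /(hP i iN) h.
by apply/mapP; exists i => //; rewrite mem_index_iota.
Qed.

(** The derivative of c a^k, computed from a^-m (c a^n) with n = k + m; when n = 0, the truncated
    exponent [n.-1] is multiplied by 0. *)
Lemma deriv_term (A : fieldType) (a c : A) (k : int) (m : nat) : a != 0 -> 0 <= k + m%:Z ->
  a ^- m * (c * (a ^+ (absz (k + m%:Z)).-1 *+ absz (k + m%:Z))) -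
  (a ^- m.+1 * (c * a ^+ absz (k + m%:Z))) *+ m = (c * a ^ (k - 1)) *~ k.
Proof.
move=> a0 km; set n := absz _.
have kE : k = n%:Z - m%:Z by rewrite /n; lia.
have pw : a ^- m.+1 * a ^+ n = a ^ (k - 1).
  rewrite exprnN [a ^+ n]exprnP -expfzDr //; congr (_ ^ _); lia.
have -> : a ^- m * (c * (a ^+ n.-1 *+ n)) = (c * a ^ (k - 1)) *+ n.
  rewrite -pw; case: (n) => [|n']; first by rewrite !mulr0n !mulr0.
  rewrite !mulrnAr /= [a ^+ n'.+1]exprS [a ^+ m.+1]exprS invfM.
  by rewrite mulrACA mulVf // mul1r mulrCA.
rewrite [a ^- m.+1 * (c * _)]mulrCA pw; move: (c * _) => w.
by rewrite kE mulrzBr -!pmulrn.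
Qed.

Lemma puiseux_char0 (K : fieldType) : char0 K -> char0 (puiseux K).
Proof. by move=> K0 n; rewrite -(rmorph_nat (@pconst K)) fmorph_eq0; apply: K0. Qed.

Lemma complex_closed (R : realType) : alg_closed (complexF R).
Proof. by move=> p sp; apply: (closed_rootP _ _); rewrite gtn_eqF. Qed.

Lemma complex_char0 (R : realType) : char0 (complexF R).
Proof. by move=> n; rewrite pnatr_eq0. Qed.

Section NonnegXY.
Variable C : fieldType.
Implicit Types f : puiseux (puiseux (puiseux C)).

Lemma nonneg_xyC f : nonneg_x (nonneg_y f) = nonneg_y (nonneg_x f).
Proof. by apply: puiseuxP => q; exact: NxNyC. Qed.

Lemma nonneg_x_const (c : puiseux C) f :
  nonneg_x (pconst (pconst c) * f) = pconst (pconst c) * nonneg_x f.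
Proof.
apply: puiseuxP => q; rewrite pcoef_constM.
change (pnonpos (pcoef (pconst (pconst c) * f) q) = pconst c * pnonpos (pcoef f q)).
by rewrite pcoef_constM pnonpos_constM.
Qed.

End NonnegXY.

Lemma quotient_large (F : fieldType) (a c p1 p2 z K : F) :
  K = - c * a * (p1 * p2) -> K != 0 -> a * p1 * z / K = - (z / (c * p2)).
Proof.
move=> KE K0; have : [&& c != 0, a != 0, p1 != 0 & p2 != 0].
  by move: K0; rewrite KE !mulf_eq0 oppr_eq0 !negb_or => /andP [/andP [-> ->] /andP [-> ->]].
by case/and4P=> c0 a0 p10 p20; rewrite KE; field; rewrite oppr_eq0 c0 a0 p10 p20.
Qed.

Lemma scale_quotient (F : fieldType) (b u v K : F) : b != 0 ->
  (b * u * v) / (b * K) = u * v / K.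
Proof. by move=> b0; rewrite -[b * u * v]mulrA -mulf_div divff // mul1r. Qed.

Lemma affine_eq (F : fieldType) (u v a b : F) : v != 0 -> (u + v * a = u + v * b <-> a = b).
Proof. by move=> v0; split=> [/addrI /(mulfI v0)|->]. Qed.

Lemma scale_solve (F : fieldType) (w ym v A : F) : ym != 0 -> w != 0 -> v = w^-1 ->
  w = ym^-1 * A -> ym = v * A.
Proof. by move=> y0 w0 -> h; rewrite -[A](mulVKf y0) -h mulrCA mulVf ?mulr1. Qed.

(** * Solutions, orbit and generating function *)

Section Assembly.
Variable C : fieldType.
Hypotheses (Ccl : alg_closed C) (C0 : char0 C).
Variables (S : {fset int * int}) (U V T : laurent C) (m M m' M' : nat).
Hypothesis hS : hadamard S U V T.
Hypotheses (hx : has_val_deg S fst (- m%:Z) M%:Z) (hy : has_val_deg S snd (- m'%:Z) M'%:Z).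
Hypotheses (hM : (0 < M)%N) (hM' : (0 < M')%N) (hT : T M'%:Z = 1).
Local Notation Fy := (puiseux C).
Local Notation Fxy := (puiseux (puiseux C)).
Local Notation x := (@x_ C).
Local Notation y := (@y_ C).
Local Notation cst_C := (@pconst C).
Local Notation cst_y := (@pconst Fy).
Local Notation W := (@stepeval S Fxy x_ yx_).
Local Notation Ty := (lpeval cst_C T y).
Local Notation spx := (steppoly C S m).
Local Notation spy := (lpoly T m').
Local Notation t1 := (pmono 1 1).

Lemma Fy_closed : alg_closed Fy. Proof. exact: puiseux_closed. Qed.
Lemma Fy_char0 : char0 Fy. Proof. exact: puiseux_char0. Qed.
Lemma Fxy_closed : alg_closed Fxy. Proof. exact: puiseux_closed Fy_closed Fy_char0. Qed.

Lemma size_spx : size spx = (m + M).+1. Proof. exact: (size_steppoly _ hx). Qed.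
Lemma T_supp k : T k != 0 -> - m'%:Z <= k <= M'%:Z. Proof. exact: (T_bounds hS hy hM' hT). Qed.
Lemma size_spy : size spy = (m' + M').+1.
Proof. by apply: size_lpoly T_supp _; rewrite hT oner_neq0. Qed.
Lemma spy0_neq0 : (0 < m')%N -> spy`_0 != 0.
Proof. by move=> m0; rewrite (coef_lpoly T_supp) sub0r; apply: (T_val hS hy). Qed.
Lemma spx0_neq0 : (0 < m)%N -> spx`_0 != 0. Proof. by move=> _; apply: steppoly0 hx. Qed.
Lemma laurentxE : laurentx spx m = W. Proof. exact: (laurentx_steppoly _ hx). Qed.
Lemma laurentyE : laurentx spy m' = Ty.
Proof. by rewrite (lpevalE T_supp) ?x_neq0. Qed.

Lemma W_neq0 : W != 0. Proof. by rewrite -laurentxE (laurentx_neq0 size_spx). Qed.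
Lemma Ty_neq0 : Ty != 0. Proof. by rewrite -laurentyE (laurentx_neq0 size_spy). Qed.

Lemma x_solutionP X : X != 0 /\ W = stepeval S X yx_ <-> root (kerpoly spx m W^-1) X.
Proof.
have r0 := root0_kerpoly spx0_neq0 (natr_M_gt0 hM) (vge_laurentxV size_spx) (invr_neq0 (laurentx_neq0 size_spx)).
rewrite -laurentxE in r0 *; split=> [[X0 WX]|rX].
  apply/(kerpoly_rootP _ _ _ X0); rewrite -(stepevalE hx X0) -[pconst y]/yx_ -WX.
  by rewrite mulVf ?subrr ?(laurentx_neq0 size_spx).
have X0 : X != 0 by apply: contraTneq rX => ->.
split; first exact: X0.
move: rX => /(kerpoly_rootP _ _ _ X0); rewrite -(stepevalE hx X0).
move/eqP; rewrite subr_eq0 => /eqP h.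
by apply: (mulfI (invr_neq0 (laurentx_neq0 size_spx))); rewrite mulVf ?(laurentx_neq0 size_spx).
Qed.

Lemma kernel_rootP (X : puiseux Fy) :
  X != 0 /\ 1 - t1 * stepeval S X (pconst y) = 0 <-> root (kerpoly spx m t1) X.
Proof.
have t0 : t1 != 0 :> puiseux Fy by exact: pmono_neq0 (oner_neq0 _).
have r0 := root0_kerpoly spx0_neq0 (@ltr01 rat) (@vge_t Fy) t0.
split=> [[X0 h]|rX]; first by apply/(kerpoly_rootP _ _ _ X0); rewrite -(stepevalE hx X0).
have X0 : X != 0 by apply: contraTneq rX => ->.
by split; [exact: X0 | move: rX => /(kerpoly_rootP _ _ _ X0); rewrite -(stepevalE hx X0)].
Qed.

Lemma step_in_y (X : Fxy) Y Y' : lpeval (cst_y \o cst_C) V X != 0 ->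
  (stepeval S X Y = stepeval S X Y' <->
   lpeval (cst_y \o cst_C) T Y = lpeval (cst_y \o cst_C) T Y').
Proof.
move=> VX; rewrite (stepeval_hadamard hS (cst_y \o cst_C) X Y).
by rewrite (stepeval_hadamard hS (cst_y \o cst_C) X Y'); apply: affine_eq.
Qed.

(** V has coefficients in C, so its nonzero roots lie in the algebraically closed field of series in
    1/y. *)
Lemma V_nonconst (X : Fxy) : X != 0 -> lpeval (cst_y \o cst_C) V X = 0 ->
  exists c, X = cst_y c.
Proof.
move=> X0 VX; have [k0 V1 _] := hadamard_pick hS hy hM' hT.
pose N := \max_(k <- finsupp V) absz k.
have hN k : V k != 0 -> - N%:Z <= k <= N%:Z.
  rewrite -mem_finsupp => kV; have : (absz k <= N)%N by apply: leq_bigmax_seq.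
  by lia.
have VN0 : lpoly V N != 0.
  apply/eqP => /(congr1 (fun p : {poly C} => p`_(absz (k0 + N%:Z)))).
  rewrite (coef_lpoly hN) coef0; have := hN k0; rewrite V1 oner_neq0 => /(_ isT) h.
  have -> : (absz (k0 + N%:Z))%:Z - N%:Z = k0 by lia.
  by rewrite V1 => /eqP; rewrite oner_eq0.
move: VX; rewrite (lpevalE hN) // => /eqP; rewrite mulf_eq0 invr_eq0 expf_eq0 (negbTE X0) andbF /=.
rewrite map_poly_comp => rX.
have [|c _ ->] := root_map_closed Fy_closed _ (rX : root (map_poly cst_y _) X).
  by rewrite map_poly_eq0.
by exists c.
Qed.

Lemma V_neq0 X : X != 0 -> W = stepeval S X yx_ -> lpeval (cst_y \o cst_C) V X != 0.
Proof.
move=> X0 WX; apply/eqP => /(V_nonconst X0) [c Xc].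
have := has_val_laurentx size_spx; rewrite laurentxE WX Xc.
have -> : stepeval S (cst_y c) yx_ = cst_y (stepeval S c y).
  rewrite /stepeval rmorph_sum; apply: eq_bigr => s _.
  by rewrite [RHS]rmorphM [in RHS]fmorphXz [in RHS]fmorphXz.
(* A series constant in x has no coefficient at x^M, since M > 0. *)
move=> [_]; rewrite /= oppr_eq0 pnatr_eq0 eqn0Ngt hM /=.
by rewrite eqxx.
Qed.

Lemma step_in_y_x Y : Y != 0 ->
  (W = stepeval S x_ Y <-> lpeval cst_xy T yx_ = lpeval cst_xy T Y).
Proof. by move=> Y0; apply: step_in_y; apply: V_neq0 (x_neq0 _) erefl. Qed.

Lemma y_rootP (Y : Fy) : Y != 0 /\ lpeval cst_C T Y = Ty <-> root (kerpoly spy m' Ty^-1) Y.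
Proof.
have r0 := root0_kerpoly spy0_neq0 (natr_M_gt0 hM') (vge_laurentxV size_spy) (invr_neq0 (laurentx_neq0 size_spy)).
rewrite -laurentyE in r0 *; split=> [[Y0 TY]|rY].
  apply/(kerpoly_rootP _ _ _ Y0); rewrite -(lpevalE T_supp _ Y0) TY.
  by rewrite mulVf ?subrr ?(laurentx_neq0 size_spy).
have Y0 : Y != 0 by apply: contraTneq rY => ->.
split; first exact: Y0.
move: rY => /(kerpoly_rootP _ _ _ Y0); rewrite -(lpevalE T_supp _ Y0).
move/eqP; rewrite subr_eq0 => /eqP h.
by apply: (mulfI (invr_neq0 (laurentx_neq0 size_spy))); rewrite mulVf ?(laurentx_neq0 size_spy).
Qed.

Lemma lpeval_pconst (P : laurent C) (Y : Fy) :
  lpeval (cst_y \o cst_C) P (cst_y Y) = cst_y (lpeval cst_C P Y).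
Proof.
rewrite /lpeval rmorph_sum; apply: eq_bigr => k _.
by rewrite rmorphM /= fmorphXz.
Qed.

(** V(x) being nonzero, the equation is T(Y) = T(y), with coefficients in series in 1/y; that field
    is closed, so Y does not involve x. *)
Lemma y_solutionP (Y : Fxy) : Y != 0 /\ W = stepeval S x_ Y <->
  exists2 c, root (kerpoly spy m' Ty^-1) c & Y = cst_y c.
Proof.
split=> [[Y0 /(step_in_y_x Y0)]|[c /y_rootP [c0 Tc] ->]]; last first.
  have c0' : cst_y c != 0 by rewrite fmorph_eq0.
  split; [exact: c0' | apply/(step_in_y_x c0')].
  by rewrite -[lpeval cst_xy T yx_]/(lpeval (cst_y \o cst_C) T (cst_y y))
    -[lpeval cst_xy T _]/(lpeval (cst_y \o cst_C) T (cst_y c)) !lpeval_pconst Tc.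
rewrite -[lpeval cst_xy T yx_]/(lpeval (cst_y \o cst_C) T (cst_y y)) lpeval_pconst => TY.
have hr : root (map_poly cst_y (kerpoly spy m' Ty^-1)) Y.
  apply/rootP; rewrite /kerpoly rmorphB /= map_polyXn map_polyZ hornerD hornerN hornerZ hornerXn.
  rewrite -map_poly_comp; apply/eqP; rewrite subr_eq0; apply/eqP.
  have := TY; rewrite -[lpeval cst_xy T Y]/(lpeval (cst_y \o cst_C) T Y) (lpevalE T_supp _ Y0) => TY'.
  apply: (scale_solve _ _ _ TY').
  - by rewrite expf_neq0.
  - by rewrite fmorph_eq0 Ty_neq0.
  - exact: fmorphV.
have P0 : kerpoly spy m' Ty^-1 != 0.
  rewrite -size_poly_gt0 -laurentyE.
  by rewrite (size_kerpoly size_spy hM' (invr_neq0 (laurentx_neq0 size_spy))).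
by have [c rc ->] := root_map_closed Fy_closed P0 hr; exists c.
Qed.

Let HQ : is_subfield (@Qy C) := @generated_is_subfield Fy [set y].
Local Notation HA := (algebraics_subfield HQ).

Lemma steppoly_algebraic : exists p, map_poly (sfv HA) p = spx.
Proof.
apply: sfv_poly => i; rewrite (coef_steppoly _ hx); apply: (subfield_sum HA) => s.
by apply: (subfieldXz HA); apply: (sub_algebraics HQ); apply: generated_sub.
Qed.

Lemma kernel_neq0_spx sigma : sigma != 0 -> kerpoly spx m sigma != 0.
Proof. by move=> s0; rewrite -size_poly_gt0 (size_kerpoly size_spx hM s0). Qed.

Lemma root_algebraic p (sigma : puiseux (subfield_of HA)) r : map_poly (sfv HA) p = spx ->
  puiseux_map (sfv HA) sigma != 0 ->
  root (kerpoly spx m (puiseux_map (sfv HA) sigma)) r ->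
  forall q, algebraic_over (@Qy C) (pcoef r q).
Proof.
move=> pE s0 rr q; have k0 := kernel_neq0_spx s0.
rewrite -pE in rr k0; rewrite kerpoly_map map_poly_eq0 in k0.
have [f ->] := kerpoly_root_descent (@algebraics_closed _ _ HQ Fy_closed)
  (@subfield_char0 _ _ HQ Fy_char0) k0 rr.
exact: (sfv_in (pcoef f q : subfield_of HA)).
Qed.

Lemma x_root_algebraic r : root (kerpoly spx m W^-1) r ->
  forall q, algebraic_over (@Qy C) (pcoef r q).
Proof.
have [p pE] := steppoly_algebraic.
have WVE : W^-1 = puiseux_map (sfv HA) (laurentx p m)^-1.
  by rewrite -laurentxE -pE (laurentx_map (sfv HA) p m) fmorphV.
rewrite WVE; apply: (root_algebraic pE); rewrite -WVE invr_eq0; exact: W_neq0.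
Qed.

Lemma kernel_root_algebraic r : root (kerpoly spx m t1) r ->
  forall q, algebraic_over (@Qy C) (pcoef r q).
Proof.
have [p pE] := steppoly_algebraic.
have tE : t1 = puiseux_map (sfv HA) (pmono 1 1) :> puiseux Fy.
  by rewrite puiseux_map_mono rmorph1.
rewrite tE; apply: (root_algebraic pE); rewrite -tE; exact: pmono_neq0 (oner_neq0 _).
Qed.

Lemma algebraic_nth (rs : seq (puiseux Fy)) i q :
  (forall r, r \in rs -> forall q, algebraic_over (@Qy C) (pcoef r q)) ->
  algebraic_over (@Qy C) (pcoef rs`_i q).
Proof.
move=> h; have [ir|ir] := ltnP i (size rs); first by apply/h/mem_nth.
(* Beyond the end of the list the entry is the default 0, which is algebraic. *)
rewrite nth_default // pcoef0; exact: (subfield0 HA).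
Qed.

Lemma x_solutions_exist : exists xs, @x_solutions C S m M xs.
Proof.
have [rs [urs srs rs0 hrs hsm]] := x_solutions_ex Fy_closed Fy_char0 size_spx hM spx0_neq0.
rewrite laurentxE in hrs; exists rs; split.
- by split.
- exact: rs0.
- by move=> X; rewrite hrs; split=> /x_solutionP.
- by move=> i q; apply: algebraic_nth => r; rewrite hrs; apply: x_root_algebraic.
- exact: hsm.
Qed.

Lemma kernel_roots_exist : exists Xs, @kernel_roots C S m M Xs.
Proof.
have [rs [urs srs hrs hsm]] := kernel_roots_ex Fy_closed Fy_char0 size_spx hM spx0_neq0.
exists rs; split.
- by split.
- by move=> X; rewrite hrs; split=> /kernel_rootP.
- by move=> i q; apply: algebraic_nth => r; rewrite hrs; apply: kernel_root_algebraic.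
- exact: hsm.
Qed.

Lemma y_solutions_exist : exists ys, @y_solutions C S m' M' ys.
Proof.
have [rs [urs srs rs0 hrs hsm]] := x_solutions_ex Ccl C0 size_spy hM' spy0_neq0.
rewrite laurentyE in hrs; exists rs; split.
- by split.
- exact: rs0.
- move=> Y; split=> [/mapP [c crs ->]|/y_solutionP [c rc ->]].
    by apply/y_solutionP; exists c; rewrite -?hrs.
  by apply: map_f; rewrite hrs.
- exact: hsm.
Qed.

Lemma closure_exists : exists A, is_algebraic_closure (@Cxy C) A.
Proof.
exists (algebraics (@Cxy C)); apply: algebraics_closure Fxy_closed.
exact: generated_is_subfield.
Qed.

Lemma step_eq_y (X Y Y' : Fxy) : lpeval (cst_y \o cst_C) T Y = lpeval (cst_y \o cst_C) T Y' ->
  stepeval S X Y = stepeval S X Y'.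
Proof.
move=> h; have e1 := stepeval_hadamard hS (cst_y \o cst_C) X Y.
have e2 := stepeval_hadamard hS (cst_y \o cst_C) X Y'.
apply: (eq_trans e1 (eq_trans _ (esym e2))).
exact: (congr1 (fun z => lpeval _ U X + lpeval _ V X * z) h).
Qed.

Let HC : is_subfield (@Cxy C) := @generated_is_subfield Fxy _.

Lemma Cxy_x : Cxy x. Proof. by apply: generated_sub; left; right. Qed.
Lemma Cxy_y : Cxy (@yx_ C). Proof. by apply: generated_sub; right. Qed.
Lemma Cxy_cst c : Cxy (@cst_xy C c). Proof. by apply: generated_sub; left; left; exists c. Qed.

(** The root is algebraic over C(x, y), so it belongs to every algebraic closure [A]; the orbit
    computed in [A] does not lose any pair. *)
Lemma kerpoly_closure (A : set Fxy) (K : fieldType) (h : {rmorphism K -> Fxy}) (p : {poly K}) n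
    (c r : Fxy) : is_algebraic_closure (@Cxy C) A ->
  (forall i, Cxy (h p`_i)) -> Cxy c -> 'X^n - c *: map_poly h p != 0 ->
  root ('X^n - c *: map_poly h p) r -> A r.
Proof.
move=> hA hp hc q0 rr; apply: (closure_algebraics hA).
apply: (root_algebraics HC q0) rr => i; apply: (sub_algebraics HC).
rewrite coefB coefXn coefZ coef_map; apply: (subfieldB HC); last exact: (subfieldM HC hc (hp i)).
by case: eqP => _; [exact: (subfield1 HC) | exact: (subfield0 HC)].
Qed.

Lemma x_root_closure A r : is_algebraic_closure (@Cxy C) A ->
  root (kerpoly spx m W^-1) r -> A r.
Proof.
move=> hA; have W0 : W^-1 != 0 by rewrite invr_eq0 W_neq0.
apply: (kerpoly_closure hA) => [i||]; last exact: kernel_neq0_spx.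
  rewrite (coef_steppoly _ hx) rmorph_sum; apply: (subfield_sum HC) => s.
  by rewrite /= fmorphXz; apply: (subfieldXz HC); exact: Cxy_y.
apply: (subfieldV HC); apply: (subfield_stepeval HC); [exact: Cxy_x | exact: Cxy_y].
Qed.

Lemma y_root_closure A c : is_algebraic_closure (@Cxy C) A ->
  root (kerpoly spy m' Ty^-1) c -> A (cst_y c).
Proof.
move=> hA rc.
have E : map_poly cst_y (kerpoly spy m' Ty^-1) =
    'X^m' - (cst_y Ty)^-1 *: map_poly (cst_y \o cst_C) spy.
  by rewrite /kerpoly rmorphB /= map_polyXn map_polyZ -map_poly_comp fmorphV.
have P0 : kerpoly spy m' Ty^-1 != 0.
  rewrite -size_poly_gt0 -laurentyE.
  by rewrite (size_kerpoly size_spy hM' (invr_neq0 (laurentx_neq0 size_spy))).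
apply: (kerpoly_closure (h := cst_y \o cst_C) (p := spy) (n := m') (c := (cst_y Ty)^-1) hA).
- by move=> i; exact: Cxy_cst.
- apply: (subfieldV HC); rewrite rmorph_sum; apply: (subfield_sum HC) => k.
  rewrite rmorphM /= fmorphXz; apply: (subfieldM HC); first exact: Cxy_cst.
  by apply: (subfieldXz HC); exact: Cxy_y.
- by rewrite -E map_poly_eq0.
by rewrite -E fmorph_root.
Qed.

(** * The orbit and the formulas, for arbitrary lists of solutions *)

Section Solutions.
Variables (xs : seq Fxy) (ys : seq Fy) (Xs : seq (puiseux Fy)).
Hypotheses (hxs : x_solutions S m M xs) (hys : y_solutions S m' M' ys)
  (hXs : kernel_roots S m M Xs).

Lemma xs_root r : (r \in xs) = root (kerpoly spx m W^-1) r.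
Proof.
case: hxs => _ _ h _ _; apply/idP/idP => [/h /x_solutionP //|rr].
by apply/h/x_solutionP.
Qed.

Lemma Xs_root r : (r \in Xs) = root (kerpoly spx m t1) r.
Proof.
case: hXs => _ h _ _; apply/idP/idP => [/h /kernel_rootP //|rr].
by apply/h/kernel_rootP.
Qed.

Lemma ys_root r : (r \in ys) = root (kerpoly spy m' Ty^-1) r.
Proof.
have inj : injective cst_y by exact: fmorph_inj.
case: hys => _ _ h _; rewrite -(mem_map inj); apply/idP/idP => [/h /y_solutionP [c rc /inj ->] //|rr].
by apply/h/y_solutionP; exists r.
Qed.

Lemma xs_small : let rs := [seq xs`_i | i <- index_iota 1 m.+1] in
  uniq rs /\ forall r, r \in rs <-> root (kerpoly spx m W^-1) r /\ no_neg_power r.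
Proof.
case: hxs => -[sz us] _ _ _ hsm.
have [] := @block_uniq _ 0 xs 1 m.+1 (m + M) (@no_neg_power Fy) us sz.
- by rewrite -addn1 leq_add2l.
- by move=> i iN; rewrite ltnS; apply: hsm.
by move=> u h; split=> // r; rewrite -xs_root; apply: h.
Qed.

Lemma Xs_small : let rs := [seq Xs`_i | i <- index_iota 0 m] in
  uniq rs /\ forall r, r \in rs <-> root (kerpoly spx m t1) r /\ no_neg_power r.
Proof.
case: hXs => -[sz us] _ _ hsm.
have [] := @block_uniq _ 0 Xs 0 m (m + M) (@no_neg_power Fy) us sz.
- by rewrite leq_addr.
- by move=> i iN; apply: hsm.
by move=> u h; split=> // r; rewrite -Xs_root; apply: h.
Qed.

Lemma ys_small : let rs := [seq ys`_i | i <- index_iota 1 m'.+1] in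
  uniq rs /\ forall r, r \in rs <-> root (kerpoly spy m' Ty^-1) r /\ no_neg_power r.
Proof.
case: hys => -[sz us] _ _ hsm.
have [] := @block_uniq _ 0 ys 1 m'.+1 (m' + M') (@no_neg_power C) us sz.
- by rewrite -addn1 leq_add2l.
- by move=> i iN; rewrite ltnS; apply: hsm.
by move=> u h; split=> // r; rewrite -ys_root; apply: h.
Qed.

Definition orbit_pred (u : Fxy * Fxy) : Prop := u.1 \in xs /\ u.2 \in map cst_y ys.

Lemma orbit_predE u : orbit_pred u <-> exists i j, [/\ (i < m + M)%N, (j < m' + M')%N &
           u = (xs`_i, pconst ys`_j)].
Proof.
case: hxs hys => -[sx _] _ _ _ _ [] -[sy _] _ _ _.
case: u => a b; rewrite /orbit_pred /=; split.
  case=> /(nthP 0) [i ix <-] /mapP [c /(nthP 0) [j jy <-] ->].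
  by exists i, j; rewrite -sx -sy.
move=> [i [j [im jm [-> ->]]]]; split; first by rewrite mem_nth ?sx.
by apply: map_f; rewrite mem_nth ?sy.
Qed.

Lemma xs_sol r : r \in xs -> r != 0 /\ W = stepeval S r yx_.
Proof. by case: hxs => _ _ h _ _ /h. Qed.

Lemma ys_sol r : r \in map cst_y ys -> r != 0 /\
  lpeval (cst_y \o cst_C) T yx_ = lpeval (cst_y \o cst_C) T r.
Proof.
case: hys => _ _ h _ /h [r0 e]; split; first exact: r0.
exact: ((step_in_y_x r0).1 e).
Qed.

(** If y changes, the nonzero V(x_i) cancels and T(Y) = T(y_j) = T(y). If x changes, T(y_j) = T(y)
    makes S(., y_j) and S(., y) equal, so the new x solves the original equation. *)
Lemma adjacent_orbit A u v : adjacent S A u v -> orbit_pred u -> orbit_pred v.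
Proof.
case: u v => [a b] [c d] [_ [/= _ _ c0 d0] /= Suv h] [/= ax byy].
have [a0 Wa] := xs_sol ax; have [b0 Tb'] := ys_sol byy.
case: h => [[/= ac _]|[/= _ bd]]; split=> /=.
- by rewrite -ac.
- case: hys => _ _ hY _; apply/hY; split; first exact: d0.
  apply/(step_in_y_x d0).
  rewrite -[lpeval cst_xy T yx_]/(lpeval (cst_y \o cst_C) T yx_) Tb'.
  apply: (step_in_y b d (V_neq0 a0 Wa)).1; rewrite {2}ac; exact: Suv.
- case: hxs => _ _ hX _ _; apply/hX; split; first exact: c0.
  rewrite Wa (step_eq_y a Tb') Suv -bd; exact/esym/step_eq_y.
by rewrite -bd.
Qed.

Lemma orbit_description A : is_algebraic_closure (@Cxy C) A ->
  forall u, orbit_xy S A u <-> exists i j, [/\ (i < m + M)%N, (j < m' + M')%N &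
           u = (xs`_i, pconst ys`_j)].
Proof.
move=> hA u; rewrite -orbit_predE; split.
  have start : orbit_pred (x, yx_).
    case: hxs hys => -[sx _] x0 _ _ _ [] -[sy _] y0 _ _; split=> /=.
      by rewrite -x0 mem_nth // sx (leq_trans hM) ?leq_addl.
    by apply: map_f; rewrite -y0 mem_nth // sy (leq_trans hM') ?leq_addl.
  have gen v w : clos_refl_trans _ (adjacent S A) v w -> orbit_pred v -> orbit_pred w.
    elim=> {v w} [v w /adjacent_orbit|v|v w z _ h1 _ h2 hv]; [exact|exact|].
    exact: h2 (h1 hv).
  by move=> /gen; apply.
case: u => a b [/= ax byy]; have [a0 Wa] := xs_sol ax; have [b0 Tb'] := ys_sol byy.
have Aa : A a by apply: (x_root_closure hA); rewrite -xs_root.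
have Ab : A b.
  by case/mapP: byy => c cy ->; apply: (y_root_closure hA); rewrite -ys_root.
have CA z : Cxy z -> A z by case: hA => _ h _ _; apply: h.
have Ax : A x by exact: CA Cxy_x.
have Ay : A (@yx_ C) by exact: CA Cxy_y.
have y0 : @yx_ C != 0 by rewrite fmorph_eq0 x_neq0.
have Sab := step_eq_y a Tb'.
(* The path goes through (x_i, y); a move is skipped when its coordinate does not change, adjacency
   requiring distinct pairs. *)
apply: (@rt_trans _ _ _ (a, yx_)).
  have [->|ax'] := eqVneq a x; first exact: rt_refl.
  apply: rt_step; split.
  - by split; [exact: Ax | exact: Ay | exact: x_neq0 | exact: y0].
  - by split; [exact: Aa | exact: Ay | exact: a0 | exact: y0].
  - exact: Wa.
  - by right; split; [apply/eqP; rewrite eq_sym; exact: ax' | exact: erefl].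
have [->|by'] := eqVneq b yx_; first exact: rt_refl.
apply: rt_step; split.
- by split; [exact: Aa | exact: Ay | exact: a0 | exact: y0].
- by split; [exact: Aa | exact: Ab | exact: a0 | exact: b0].
- exact: Sab.
- by left; split; [exact: erefl | apply/eqP; rewrite eq_sym; exact: by'].
Qed.

Local Notation TT := (@pmono Fxy 1 1).
Local Notation Px := (\prod_(1 <= i < m.+1) (1 - x^-1 * xs`_i)).
Local Notation Py := (\prod_(1 <= j < m'.+1) (1 - y^-1 * ys`_j)).
Local Notation B := (stepcoefx S M%:Z y).
Local Notation PX := (\prod_(0 <= i < m) (1 - (pconst x)^-1 * kernel_root_emb Xs`_i)).

Lemma small_x_series : exists b : nat -> Fxy, [/\ b 0%N = 1,
    forall n, b n.+1 = pnonpos (W * b n),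
    nonneg_x (pconst Px / kernel S) = psubst TT b & PX / kernel S = psubst TT b].
Proof.
have [ux hrx] := xs_small; have [uX hrX] := Xs_small.
have hrx' r : r \in [seq xs`_i | i <- index_iota 1 m.+1] <->
    root (kerpoly spx m (laurentx spx m)^-1) r /\ no_neg_power r.
  by rewrite laurentxE; apply: hrx.
have [b [h1 h2 _ h4 h5]] := one_dim Fy_closed Fy_char0 size_spx hM spx0_neq0 ux uX hrx' hrX.
rewrite laurentxE !big_map in h2 h4 h5.
by exists b; split; [exact: h1 | exact: h2 | exact: h4 | exact: h5].
Qed.

(** By [one_dim] for T(y) over C, the projection of Py T^n is the n-th term of a sequence that
    starts at 1 and satisfies the recursion. These are the two properties of [Py] on which the
    exchange of [y^>=] rests. *)
Lemma small_y_rec : pnonpos Py = 1 /\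
  forall n, pnonpos (Py * Ty ^+ n.+1) = pnonpos (Ty * pnonpos (Py * Ty ^+ n)).
Proof.
have [uy hry] := ys_small.
have hry' r : r \in [seq ys`_i | i <- index_iota 1 m'.+1] <->
    root (kerpoly spy m' (laurentx spy m')^-1) r /\ no_neg_power r.
  by rewrite laurentyE; apply: hry.
have [rs [urs srs hrs hsm]] := kernel_roots_ex Ccl C0 size_spy hM' spy0_neq0.
have [] := @block_uniq _ 0 rs 0 m' (m' + M') (@no_neg_power C) urs srs (leq_addr _ _) hsm.
set Rs := map _ _ => uRs hRs.
have hRs' r : r \in Rs <-> root (kerpoly spy m' (pmono 1 1)) r /\ no_neg_power r.
  by rewrite -hrs; apply: hRs.
have [b [h1 h2 h3 _ _]] := one_dim Ccl C0 size_spy hM' spy0_neq0 uy uRs hry' hRs'.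
rewrite laurentyE big_map in h2 h3.
split=> [|n]; first by have := h3 0%N; rewrite expr0 mulr1 h1.
by rewrite (h3 n) (h3 n.+1) h2.
Qed.

Lemma quadrant_series b : b 0%N = 1 -> (forall n, b n.+1 = pnonpos (W * b n)) ->
  quadrant_gf S = nonneg_y (pconst (pconst Py) * psubst TT b).
Proof.
move=> b0 bS; have [Py0 PyS] := small_y_rec.
rewrite quadrant_gfE psubstT_scale /nonneg_y puiseux_map_psubstT; apply: psubst_eq => n.
exact: (walk_gf_hadamard hS Py0 PyS b0 bS n).
Qed.

(** The product over the y_j is free of x and leaves [x^>=]; the rest is the one-variable statement
    in x, and the two projections commute. *)
Lemma kernel_quadrant : [/\ quadrant_gf S = nonneg_x (nonneg_y (pconst (Px * pconst Py) / kernel S)),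
  nonneg_x (pconst (Px * pconst Py) / kernel S) = PX * pconst (pconst Py) / kernel S &
  quadrant_gf S = nonneg_y (PX * pconst (pconst Py) / kernel S)].
Proof.
have [b [b0 bS hx' hX']] := small_x_series.
have hQ := quadrant_series b0 bS.
have e1 : PX * pconst (pconst Py) / kernel S = pconst (pconst Py) * psubst TT b.
  by rewrite -hX' mulrAC mulrC.
have e2 : nonneg_x (pconst (Px * pconst Py) / kernel S) = pconst (pconst Py) * psubst TT b.
  by rewrite rmorphM [pconst Px * _]mulrC -mulrA nonneg_x_const hx'.
split.
- by rewrite nonneg_xyC e2.
- by rewrite e2 e1.
- by rewrite e1.
Qed.

(** Once the kernel is factored over all its roots, the factors of the small ones cancel against the
    numerator, together with x^-m. *)
Lemma quadrant_large : PX * pconst (pconst Py) / kernel S =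
  - (pconst (pconst Py) / (t_ * pconst (pconst B) *
       \prod_(m <= i < m + M) (pconst x - kernel_root_emb Xs`_i))).
Proof.
case: hXs => -[sX uX] _ _ _.
have KE := kernel_large Fy_closed Fy_char0 size_spx hM spx0_neq0 uX Xs_root.
rewrite laurentxE (lead_steppoly _ hx) in KE.
have PXE : PX = pconst x ^- m * \prod_(0 <= i < m) (pconst x - kernel_root_emb Xs`_i).
  have x0 : pconst x != 0 by rewrite fmorph_eq0 x_neq0.
  rewrite -(big_map (fun i => kernel_root_emb Xs`_i) xpredT (fun r => 1 - (pconst x)^-1 * r)).
  rewrite (prod_small_roots x0 (m := m)); last by rewrite size_map size_iota subn0.
  rewrite horner_prod big_map; congr (_ * _); apply: eq_bigr => i _.
  by rewrite hornerXsubC.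
rewrite PXE; apply: quotient_large; last exact: kernel_neq0.
rewrite /kernel KE; congr (_ * _).
rewrite (big_nth 0) sX (big_cat_nat (leq0n m) (leq_addr M m)) //=.
Qed.

Lemma deriv_x : M = 1%N -> stepeval_dx S x yx_ = pconst B * Px.
Proof.
move=> M1; have [ux hrx] := xs_small.
have hrx' r : r \in [seq xs`_i | i <- index_iota 1 m.+1] <->
    root (kerpoly spx m (laurentx spx m)^-1) r /\ no_neg_power r.
  by rewrite laurentxE; apply: hrx.
have := deriv_small Fy_closed Fy_char0 size_spx hM spx0_neq0 M1 ux hrx'.
rewrite (lead_steppoly _ hx) big_map => <-.
rewrite /stepeval_dx /steppoly raddf_sum !rmorph_sum /= !mulr_sumr -sumrMnl -sumrB.
rewrite !big_seq; apply: eq_bigr => s; case: hx => hs _ _ /hs sS.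
set n := absz _; rewrite (polyx_scaleXn (y ^ s.2) n) (polyx_deriv_scaleXn (y ^ s.2) n).
rewrite (deriv_term (pconst (y ^ s.2)) (x_neq0 Fy) (shift_ge0 sS)).
by congr (_ *~ _); rewrite mulrC fmorphXz.
Qed.

Lemma deriv_y : M' = 1%N -> lpderiv_eval cst_C T y = Py.
Proof.
move=> M1; have [uy hry] := ys_small.
have hry' r : r \in [seq ys`_i | i <- index_iota 1 m'.+1] <->
    root (kerpoly spy m' (laurentx spy m')^-1) r /\ no_neg_power r.
  by rewrite laurentyE; apply: hry.
have := deriv_small Ccl C0 size_spy hM' spy0_neq0 M1 uy hry'.
have -> : lead_coef spy = 1.
  by rewrite lead_coefE size_spy (coef_lpoly T_supp) PoszD addrAC subrr add0r.
rewrite rmorph1 mul1r big_map => <-.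
rewrite /lpderiv_eval /lpoly raddf_sum !rmorph_sum /= !mulr_sumr -sumrMnl -sumrB.
rewrite !big_seq; apply: eq_bigr => k; rewrite mem_finsupp => /T_supp /shift_ge0 km.
set n := absz _; rewrite (polyx_scaleXn (T k) n) (polyx_deriv_scaleXn (T k) n).
by rewrite (deriv_term (pconst (T k)) (x_neq0 C) km).
Qed.

Lemma quadrant_deriv : M = 1%N -> M' = 1%N ->
  quadrant_gf S = nonneg_x (nonneg_y (pconst (stepeval_dx S x yx_ * pconst (lpderiv_eval cst_C T y)) /
    (pconst (pconst B) * kernel S))).
Proof.
move=> M1 M1'; rewrite (deriv_x M1) (deriv_y M1').
have [-> _ _] := kernel_quadrant; congr (nonneg_x (nonneg_y _)).
have pM (f f' : Fxy) : pconst (f * f') = pconst f * pconst f' by exact: rmorphM.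
rewrite (pM Px) (pM (pconst B * Px)) (pM (pconst B) Px).
apply/esym/scale_quotient; rewrite !fmorph_eq0; exact: lead_steppoly_neq0 hx.
Qed.

End Solutions.
End Assembly.

Theorem proposition22 (R : realType) (S : {fset int * int})
    (U V T : laurent (complexF R)) (m M m' M' : nat)
    (hS : hadamard S U V T)
    (hx : has_val_deg S fst (- m%:Z) M%:Z)
    (hy : has_val_deg S snd (- m'%:Z) M'%:Z)
    (hM : (0 < M)%N) (hM' : (0 < M')%N) (hT : T M'%:Z = 1) :
  (* (1) *)
  (exists xs : seq (puiseux (puiseux (complexF R))), x_solutions S m M xs) /\
  (* (2) *)
  (forall Y : puiseux (puiseux (complexF R)), Y != 0 ->
     (stepeval S x_ yx_ = stepeval S x_ Y <->
      lpeval cst_xy T yx_ = lpeval cst_xy T Y)) /\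
  (exists ys : seq (puiseux (complexF R)), y_solutions S m' M' ys) /\
  (* roots of the kernel, algebraic closures of C(x,y) *)
  (exists Xs : seq (puiseux (puiseux (complexF R))), kernel_roots S m M Xs) /\
  (exists A, is_algebraic_closure (@Cxy (complexF R)) A) /\
  forall (xs : seq (puiseux (puiseux (complexF R)))) (ys : seq (puiseux (complexF R)))
         (Xs : seq (puiseux (puiseux (complexF R)))),
    x_solutions S m M xs -> y_solutions S m' M' ys -> kernel_roots S m M Xs ->
    let Q : puiseux (puiseux (puiseux (complexF R))) := quadrant_gf S in
    let K : puiseux (puiseux (puiseux (complexF R))) := kernel S in
    let Px := \prod_(1 <= i < m.+1) (1 - x_^-1 * xs`_i) in
    let Py := \prod_(1 <= j < m'.+1) (1 - y_^-1 * ys`_j) in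
    let B := stepcoefx S M%:Z y_ in
    (* (3) *)
    (forall A, is_algebraic_closure (@Cxy (complexF R)) A ->
       forall u, orbit_xy S A u <->
         exists i j, [/\ (i < m + M)%N, (j < m' + M')%N &
           u = (xs`_i, pconst ys`_j)]) /\
    (* (4) *)
    [/\ Q = nonneg_x (nonneg_y (pconst (Px * pconst Py) / K)),
        nonneg_x (pconst (Px * pconst Py) / K) =
          \prod_(0 <= i < m) (1 - (pconst x_)^-1 * kernel_root_emb Xs`_i)
            * pconst (pconst Py) / K,
        Q = nonneg_y
          (\prod_(0 <= i < m) (1 - (pconst x_)^-1 * kernel_root_emb Xs`_i)
            * pconst (pconst Py) / K) &
        Q = - nonneg_y (pconst (pconst Py) /
          (t_ * pconst (pconst B) *
           \prod_(m <= i < m + M) (pconst x_ - kernel_root_emb Xs`_i)))] /\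
    (* (5) *)
    [/\ M = 1%N -> stepeval_dx S x_ yx_ = pconst B * Px,
        M' = 1%N -> lpderiv_eval (@pconst (complexF R)) T y_ = Py &
        M = 1%N -> M' = 1%N ->
          Q = nonneg_x (nonneg_y
            (pconst (stepeval_dx S x_ yx_ *
                     pconst (lpderiv_eval (@pconst (complexF R)) T y_)) /
             (pconst (pconst B) * K)))].
Proof.
have Ccl := @complex_closed R; have C0 := @complex_char0 R.
split; first exact: (x_solutions_exist Ccl C0 hx hM).
split; first by move=> Y Y0; apply: (step_in_y_x Ccl C0 hS hx hy hM hM' hT).
split; first exact: (y_solutions_exist Ccl C0 hS hx hy hM hM' hT).
split; first exact: (kernel_roots_exist Ccl C0 hx hM).
split; first exact: (closure_exists Ccl C0).
move=> xs ys Xs hxs hys hXs Q K Px Py B; split.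
  by move=> A hA; apply: (orbit_description Ccl C0 hS hx hy hM hM' hT hxs hys hA).
have [q1 q2 q3] := kernel_quadrant Ccl C0 hS hx hy hM hM' hT hxs hys hXs.
split.
  split; [exact: q1 | exact: q2 | exact: q3 |].
  rewrite -raddfN; apply: (eq_trans q3); congr nonneg_y.
  exact: (quadrant_large Ccl C0 m' hx hM ys hXs).
split.
- exact: (deriv_x Ccl C0 hx hM hxs).
- exact: (deriv_y Ccl C0 hS hx hy hM hM' hT hys).
- exact: (quadrant_deriv Ccl C0 hS hx hy hM hM' hT hxs hys hXs).
Qed.
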